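(* Let $1<r<\infty$, let $\sigma=1-\frac1{\min\{r,2\}}$, and let $p=(p_k)_k$ be the increasing sequence of prime numbers. Then $$p^{-\sigma}\cdot B_{\ell_r}\subset\mathrm{mon}\,H_\infty(B_{\ell_r}),$$ and $\sigma$ is best possible here: for no real $\tau<\sigma$ does $p^{-\tau}\cdot B_{\ell_r}\subset\mathrm{mon}\,H_\infty(B_{\ell_r})$ hold.
   Context: $B_{\ell_r}$ is the open unit ball of complex $\ell_r$, and $H_\infty(B_{\ell_r})$ is the space of bounded holomorphic (Fréchet differentiable) functions on $B_{\ell_r}$. For each such $f$ the monomial coefficients $c_\alpha(f)$, $\alpha\in\mathbb N_0^{(\mathbb N)}$ (finitely supported multi-indices), are the unique scalars with $f(z)=\sum_\alpha c_\alpha(f)z^\alpha$ for all finitely supported $z\in B_{\ell_r}$. The set of monomial convergence is $\mathrm{mon}\,H_\infty(B_{\ell_r})=\{z\in B_{\ell_r}:\sum_\alpha|c_\alpha(f)z^\alpha|<\infty\text{ for all }f\in H_\infty(B_{\ell_r})\}$. For real $\tau$, $p^{-\tau}\cdot B_{\ell_r}=\{(p_k^{-\tau}u_k)_k:u\in B_{\ell_r}\}$. *)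

(* Defs.v *)
From HB Require Import structures.
From mathcomp Require Import all_boot all_order all_algebra finmap complex.
From mathcomp Require Import all_classical all_reals all_analysis.
(* only for [totally] and [partial_sum]: this file also defines a [summable] *)
From mathcomp.analysis Require summability.

Set Implicit Arguments.
Unset Strict Implicit.
Unset Printing Implicit Defensive.

Import Order.TTheory GRing.Theory Num.Theory numFieldNormedType.Exports.

Local Open Scope classical_set_scope.
Local Open Scope ring_scope.
Local Open Scope complex_scope.

HB.instance Definition _ (R : rcfType) := NormedModule.copy R[i] R[i]^o.

Import ComplexField.Normc.
Arguments normc {R} x.

Section ell.
Context (R : realType) (r : R) (r1 : 1 <= r).

Definition ell_norm (x : nat -> R[i]) : \bar R :=
  'N[counting]_(r%:E)[EFin \o (normc \o x)].

Lemma ell_normE (x : nat -> R[i]) :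
  ell_norm x = ((\sum_(0 <= k <oo) (normc (x k) `^ r)%:E) `^ r^-1)%E.
Proof.
rewrite /ell_norm Lnorm_counting ?(lt_le_trans ltr01)//.
congr poweR; apply: eq_eseriesr => k _ /=.
by rewrite ger0_norm// /normc; case: (x k) => a b; exact: sqrtr_ge0.
Qed.

Lemma normc_ge0 (z : R[i]) : 0 <= normc z.
Proof. by case: z => a b; exact: sqrtr_ge0. Qed.

Lemma ell_norm_ge0 (x : nat -> R[i]) : (0 <= ell_norm x)%E.
Proof. exact: Lnorm_ge0. Qed.

Lemma le_ell_norm (x y : nat -> R) : (forall k, `|x k| <= `|y k|) ->
  ('N[counting]_(r%:E)[EFin \o x] <= 'N[counting]_(r%:E)[EFin \o y])%E.
Proof.
move=> xy; have r0 : 0 < r by rewrite (lt_le_trans ltr01).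
rewrite !Lnorm_counting//; apply: gt0_ler_poweR; rewrite ?invr_ge0 ?(ltW r0)//.
- by rewrite in_itv/= leey andbT nneseries_ge0// => k _ _; rewrite lee_fin powR_ge0.
- by rewrite in_itv/= leey andbT nneseries_ge0// => k _ _; rewrite lee_fin powR_ge0.
apply: lee_nneseries => [k _ _|k _]; first by rewrite lee_fin powR_ge0.
by rewrite /= lee_fin ge0_ler_powR ?nnegrE ?(ltW r0).
Qed.

Lemma ell_normD (x y : nat -> R[i]) :
  (ell_norm (x + y)%R <= ell_norm x + ell_norm y)%E.
Proof.
apply: (@le_trans _ _ ('N[counting]_(r%:E)
    [EFin \o ((normc \o x) \+ (normc \o y))%R])%E).
  apply: le_ell_norm => k /=.
  rewrite !ger0_norm ?addr_ge0 ?normc_ge0//; exact: le_normcD.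
by apply: minkowski_EFin.
Qed.

Lemma ell_normZ (a : R[i]) (x : nat -> R[i]) :
  ell_norm (a *: x) = ((normc a)%:E * ell_norm x)%E.
Proof.
have r0 : 0 < r by rewrite (lt_le_trans ltr01).
rewrite !ell_normE.
under eq_eseriesr => k _.
  rewrite (_ : normc _ = normc a * normc (x k)); last exact: normcM.
  rewrite powRM ?normc_ge0// EFinM; over.
rewrite nneseriesZl; last by move=> k _; rewrite lee_fin powR_ge0.
rewrite poweRM ?lee_fin ?powR_ge0//; last first.
  by apply: nneseries_ge0 => k _ _; rewrite lee_fin powR_ge0.
by rewrite -[((_ `^ r)%:E `^ _)%E]/((_ `^ r) `^ r^-1)%:E -powRrM mulfV ?gt_eqF// powRr1 ?normc_ge0.
Qed.

(* The norm axioms need [1 <= r], so its proof is a parameter of the type. *)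
Definition ell_pred of 1 <= r : {pred nat -> R[i]} :=
  mem [set x | (ell_norm x < +oo)%E].

Lemma ell_submod_closed : submod_closed (ell_pred r1).
Proof.
split=> [|a x y].
  rewrite inE/= /ell_norm (_ : EFin \o _ = cst 0%E).
    by rewrite Lnorm0 ?ltry// eqe gt_eqF// (lt_le_trans ltr01).
  by apply/funext => k; congr EFin; exact: normc0.
rewrite !inE/= => xoo yoo; apply: (le_lt_trans (ell_normD _ _)).
rewrite lte_add_pinfty// ell_normZ lte_mul_pinfty ?lee_fin ?normc_ge0//.
Qed.

HB.instance Definition _ :=
  GRing.isSubmodClosed.Build _ _ (ell_pred r1) ell_submod_closed.

Record ell := Ell { ell_val :> nat -> R[i]; ell_valP : ell_val \in ell_pred r1 }.

HB.instance Definition _ := [isSub for ell_val].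
HB.instance Definition _ := [Choice of ell by <:].
HB.instance Definition _ := [SubChoice_isSubLmodule of ell by <:].

Lemma ell_norm_fin (x : ell) : ell_norm x \is a fin_num.
Proof. by have := ell_valP x; rewrite inE/= ge0_fin_numE// ell_norm_ge0. Qed.

Definition ell_normC (x : ell) : R[i] := (fine (ell_norm x))%:C.

Lemma ell_normCD x y : ell_normC (x + y) <= ell_normC x + ell_normC y.
Proof.
rewrite -rmorphD/= lecR -fineD ?ell_norm_fin// fine_le ?ell_norm_fin//.
  by rewrite fin_numD !ell_norm_fin.
exact: ell_normD.
Qed.

Lemma ell_normCZ a x : ell_normC (a *: x) = `|a| * ell_normC x.
Proof.
rewrite /ell_normC (_ : ell_val _ = a *: ell_val x)// ell_normZ.
by rewrite fineM ?ell_norm_fin// rmorphM/=; case: a.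
Qed.

Lemma ell_normC_eq0 x : ell_normC x = 0 -> x = 0.
Proof.
have r0 : 0 < r by rewrite (lt_le_trans ltr01).
move=> /(congr1 (@complex.Re R))/= x0.
have sum0 : ell_norm x = 0%E by rewrite -[LHS]fineK ?ell_norm_fin// x0.
apply/val_inj/funext => k /=; apply: eq0_normc; apply/eqP.
move: sum0; rewrite ell_normE => /poweR_eq0_eq0 s0.
have t0 i : (0 <= (normc (x i) `^ r)%:E)%E by rewrite lee_fin powR_ge0.
have h : (\sum_(0 <= i < k.+1) (normc (x i) `^ r)%:E <= 0)%E.
  have sge0 : (0 <= \sum_(0 <= i <oo) (normc (x i) `^ r)%:E)%E.
    by apply: nneseries_ge0 => i _ _; exact: t0.
  by rewrite -[leRHS](s0 sge0); apply: nneseries_lim_ge => i _ _; exact: t0.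
suff : normc (x k) `^ r == 0 by rewrite powR_eq0 => /andP[].
rewrite eq_le powR_ge0 andbT -lee_fin; apply: le_trans h.
by rewrite big_nat_recr//= leeDr// sume_ge0.
Qed.

HB.instance Definition _ := Lmodule_isNormed.Build R[i] ell
  ell_normCD ell_normCZ ell_normC_eq0.

Lemma normr_ellE (x : ell) : `|x| =
  (fine ((\sum_(0 <= k <oo) (normc (x k) `^ r)%:E) `^ r^-1)%E)%:C.
Proof. by rewrite -ell_normE. Qed.

End ell.

Section mon.
Context (R : realType) (r : R) (r1 : 1 <= r).
Implicit Types (f : ell r1 -> R[i]) (z : ell r1).

Definition unit_ball : set (ell r1) := [set z | `|z| < 1].

(* Functions on the ball are represented by total functions on [ell r1]; only
   their values on the ball are ever used. The scalars of [ell r1] are [R[i]],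
   so [differentiable] is complex Frechet differentiability. *)
Definition Hinfty : set (ell r1 -> R[i]) := [set f |
  (forall z, unit_ball z -> differentiable f z) /\
  [bounded f z | z in unit_ball]].

Definition multi_index := {fsfun nat -> nat with 0%N}.

Definition monomial (z : nat -> R[i]) (a : multi_index) : R[i] :=
  \prod_(k <- finsupp a) z k ^+ a k.

(* The sum over multi-indices is the limit of the net of the finite partial
   sums; in [R[i]] this is the same as absolute summability. *)
Definition monomial_expansion f (c : multi_index -> R[i]) : Prop :=
  forall z, unit_ball z -> finite_set [set k | z k != 0] ->
    summability.partial_sum (fun a => c a * monomial z a) @ summability.totally
      --> f z.

(* Every [f] in [Hinfty] has exactly one monomial expansion. *)
Definition monomial_coef f : multi_index -> R[i] :=
  get (monomial_expansion f).

Definition mon_Hinfty : set (ell r1) := [set z | unit_ball z /\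
  forall f, Hinfty f ->
    (\esum_(a in [set: multi_index])
       (normc (monomial_coef f a * monomial z a))%:E < +oo)%E].

Definition weighted_ball (p : nat -> nat) (tau : R) : set (nat -> R[i]) :=
  [set (fun k => ((p k)%:R `^ (- tau))%:C * u k) | u in unit_ball].

End mon.

Arguments unit_ball {R r} r1 _.
Arguments Hinfty {R r} r1 _.
Arguments mon_Hinfty {R r} r1 _.
Arguments weighted_ball {R r} r1 p tau _.

(* Main.v *)
(* Put s = 1 - 1/min(r,2).

   Inclusion.  Averages of f over roots of unity isolate the terms of f with a
   prescribed exponent in the first N0 coordinates and a prescribed total degree
   in the others; these are homogeneous polynomials, bounded on a small ball of
   l_r.  If P is m-homogeneous in n variables and bounded by 1 on the unit ball
   of l_r, then sum_a |c_a(P)| prod_i (i^-s u_i)^(a_i) <= D^m for every u in that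
   ball, with D independent of n.  The proof splits the monomials according to
   their largest variable and bounds the coefficients of a directional
   derivative of P: for r >= 2 by comparing the L^1 and L^2 norms of
   trigonometric polynomials, for r <= 2 by testing at points adapted to a single
   monomial and applying Young's inequality.  Choosing N0 such that the tail of u
   is small, one sums a geometric series, and p_k > k gives the weights.

   Optimality.  Random signs give m-linear forms in n variables whose norm on l_r
   is at most K n^2 (2 n^e)^m with e = 1/min(r,2) - 1/r.  Normalized sums of such
   forms over disjoint blocks of sizes n = N^(i+1) define f in H_infty.  At the
   point p^-tau u with u_k = c k^(-1/r - small), and since p_k = O(k^(1+small)),
   block i contributes at least a constant times 2^-i n^(m th - 2) to the
   monomial series, with th > 0 as soon as tau < s; for m th >= 3 and N large
   the series diverges. *)
Require Import Defs.
From HB Require Import structures.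
From mathcomp Require Import all_boot all_order all_algebra finmap complex.
From mathcomp Require Import all_classical all_reals all_analysis.
From mathcomp Require Import ring lra zify.
From mathcomp.analysis Require summability.

Set Implicit Arguments.
Unset Strict Implicit.
Unset Printing Implicit Defensive.

Import Order.TTheory GRing.Theory Num.Theory numFieldNormedType.Exports.
Import ComplexField.Normc.

Local Open Scope classical_set_scope.
Local Open Scope ring_scope.
Local Open Scope complex_scope.

(** * Averages over roots of unity *)

(** The estimates are borderline: after Cauchy-Schwarz or Young the weights become 1/i, and the sum
    of products of 1/i over all monomials in n variables diverges with n. Fixing the largest
    variable k removes n: it contributes a factor 1/k, and the variables up to k contribute a
    product of geometric series. Multiplying all variables by 1/2 or 1/4 beforehand makes that
    product at most k or sqrt k, at the cost of 2^m or 4^m, which a bound of the form D^m can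
    absorb. Such a bound helps only at points much smaller than the ball. Hence finitely many head
    coordinates are split off: the remaining tail of u is as small as desired, while in the head the
    slack between u and the unit sphere allows a dilation by some lam > 1, so that each head
    coordinate costs one convergent geometric series. For optimality crude bounds on random forms
    suffice: the loss n^2 does not depend on m, whereas the gain n^(m th) grows with m. Each slot of
    a form has its own variables, so every monomial occurs once, with a sign as coefficient. *)

Section ComplexModulus.
Variable R : realType.
Implicit Types x y : R[i].

Lemma normc_sum I (s : seq I) (P : pred I) (F : I -> R[i]) :
  normc (\sum_(i <- s | P i) F i) <= \sum_(i <- s | P i) normc (F i).
Proof.
elim/big_rec2: _ => [|i a b _ ab]; first by rewrite normc0.
by rewrite (le_trans (le_normcD _ _))// lerD2l.
Qed.

Lemma normc_prod I (s : seq I) (P : pred I) (F : I -> R[i]) :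
  normc (\prod_(i <- s | P i) F i) = \prod_(i <- s | P i) normc (F i).
Proof.
elim/big_rec2: _ => [|i a b _ <-]; first exact: normc1.
exact: normcM.
Qed.

Lemma normc_exp x n : normc (x ^+ n) = normc x ^+ n.
Proof. by elim: n => [|n IH]; rewrite ?expr0 ?normc1// !exprS normcM IH. Qed.

Lemma normc_real (a : R) : normc a%:C = `|a|.
Proof. by rewrite /normc/= expr0n addr0 sqrtr_sqr. Qed.

Lemma normc_conj x : normc x^*%C = normc x.
Proof. by case: x => a b; rewrite /normc/= sqrrN. Qed.

Lemma normc_sqr x : ((normc x) ^+ 2)%:C = x * x^*%C.
Proof. by rewrite -sqr_normc rmorphXn. Qed.

Lemma normc_gt0 x : x != 0 -> 0 < normc x.
Proof.
move=> x0; rewrite lt_def normc_ge0 andbT; apply: contraNneq x0.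
by move=> /eq0_normc ->.
Qed.

Lemma phase_ex x : {u : R[i] | normc u = 1 & u * x = (normc x)%:C}.
Proof.
have [->|x0] := eqVneq x 0; first by exists 1; rewrite ?normc1// mulr0 normc0.
exists (x^*%C / (normc x)%:C).
  by rewrite normcM normcV normc_conj normc_real ger0_norm ?normc_ge0// divff// gt_eqF// normc_gt0.
rewrite mulrAC [x^*%C * x]mulrC -normc_sqr rmorphXn/= expr2 mulfK//.
by rewrite eq_complex/= eqxx andbT gt_eqF// normc_gt0.
Qed.

Definition phase x : R[i] := s2val (phase_ex x).

Lemma normc_phase x : normc (phase x) = 1.
Proof. by rewrite /phase; case: phase_ex. Qed.

Lemma phaseM x : phase x * x = (normc x)%:C.
Proof. by rewrite /phase; case: phase_ex. Qed.

End ComplexModulus.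

Section RootAverages.
Variable R : realType.
Local Notation C := R[i].

(** Powers of two suffice, since only the size of the order matters later, and for them primitivity
    is easy to test: a [2 ^ K]-th root of -1 has an order that divides [2 ^ K.+1] but not
    [2 ^ K]. *)
Lemma prim_root_pow2 K : {w : C | (2 ^ K).-primitive_root w}.
Proof.
case: K => [|K]; first exists 1.
  by rewrite expn0 /primitive_root_of_unity/=; apply/forallP => i; rewrite ord1 unity_rootE expr1n !eqxx.
pose w : C := (2 ^ K).-root (-1).
have wK : w ^+ (2 ^ K) = -1 by rewrite /w rootCK// expn_gt0.
have w1 : w ^+ (2 ^ K.+1) = 1 by rewrite expnSr exprM wK sqrrN expr1n.
have N0 : (0 < 2 ^ K.+1)%N by rewrite expn_gt0.
have [k prk kd] := prim_order_exists N0 w1.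
exists w; suff -> : (2 ^ K.+1 = k)%N by [].
have /(dvdn_pfactor _ _ (isT : prime 2)) [j jK kE] := kd.
rewrite kE; congr (2 ^ _)%N; apply/eqP; rewrite eqn_leq jK andbT leqNgt.
apply/negP => jK'; have : (k %| 2 ^ K)%N by rewrite kE dvdn_exp2l.
rewrite (prim_order_dvd prk) wK -subr_eq0 -opprD oppr_eq0.
by rewrite -mulr2n pnatr_eq0.
Qed.

Variables (N : nat) (w : C).
Hypothesis prw : N.-primitive_root w.

Lemma normc_root : normc w = 1.
Proof.
have := congr1 (@normc R) (prim_expr_order prw).
rewrite normc_exp normc1 => /eqP; rewrite pexpr_eq1 ?(prim_order_gt0 prw)// ?normc_ge0//.
by move=> /eqP.
Qed.

Lemma root_neq0 : w != 0.
Proof. by apply/negP => /eqP w0; have := normc_root; rewrite w0 normc0 => /eqP; rewrite eq_sym oner_eq0. Qed.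

Lemma conj_root : w^*%C = w^-1.
Proof.
apply: (mulfI root_neq0); rewrite divff ?root_neq0// -normc_sqr normc_root expr1n.
by [].
Qed.

Lemma sum_root d e :
  \sum_(a < N) w ^+ (a * d) * w^-1 ^+ (a * e) = (if d == e %[mod N] then N%:R else 0) :> C.
Proof.
pose z := w ^+ d * w^-1 ^+ e.
transitivity (\sum_(a < N) z ^+ a).
  by apply: eq_bigr => a _; rewrite /z exprMn -!exprM ![(a * _)%N]mulnC.
have z1 : (z == 1) = (d == e %[mod N]).
  rewrite -(eq_prim_root_expr prw) /z exprVn -subr_eq0 -(inj_eq (mulIf (expf_neq0 e root_neq0))).
  by rewrite mul0r mulrBl mulfVK ?expf_neq0 ?root_neq0// mul1r subr_eq0.
case: ifP => de.
  move: z1; rewrite de => /eqP ->.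
  by under eq_bigr do rewrite expr1n; rewrite sumr_const card_ord.
have /eqP := subrX1 z N; rewrite {1}/z exprMn -!exprM mulnC [(e * N)%N]mulnC !exprM exprVn.
rewrite (prim_expr_order prw) invr1 !expr1n mulr1 subrr eq_sym mulf_eq0 subr_eq0 z1 de.
by move=> /eqP.
Qed.

Variable I : finType.
Implicit Types (g : {ffun I -> 'I_N}) (d e : I -> nat).

(** A character of the group (Z/N)^I: for [v = w] the monomial with exponents [e] at the grid point
    [(w ^+ g i)_i], for [v = w^-1] its conjugate. *)
Definition chi (v : C) g e : C := \prod_i v ^+ (g i * e i).

Lemma chi_conj g e : (chi w g e)^*%C = chi w^-1 g e.
Proof. by rewrite /chi rmorph_prod; apply: eq_bigr => i _; rewrite rmorphXn/= -conj_root. Qed.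

Lemma chiD v g d e : chi v g (fun i => d i + e i)%N = chi v g d * chi v g e.
Proof. by rewrite /chi -big_split; apply: eq_bigr => i _ /=; rewrite mulnDr exprD. Qed.

Lemma sum_chi d e : \sum_g chi w g d * chi w^-1 g e =
  if [forall i, d i == e i %[mod N]] then (N ^ #|I|)%:R else 0.
Proof.
transitivity (\prod_(i : I) \sum_(a < N) w ^+ (a * d i) * w^-1 ^+ (a * e i)).
  rewrite bigA_distr_bigA; apply: eq_bigr => g _.
  by rewrite /chi -big_split.
under eq_bigr do rewrite sum_root.
case: ifPn => [/forallP de|].
  rewrite (eq_bigr (fun=> N%:R)) => [|i _]; last by rewrite de.
  by rewrite prodr_const natrX.
rewrite negb_forall => /existsP[i /negbTE de].
by rewrite (bigD1 i)//= de mul0r.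
Qed.

Section L2.
Variables (T : finType) (P : pred T) (e : T -> I -> nat).
Hypothesis eN : forall t i, P t -> (e t i < N)%N.

Definition trigpoly (A : T -> C) g : C := \sum_(t | P t) A t * chi w g (e t).

Lemma sum_trigpoly2 (A : T -> C) :
  (\sum_g normc (trigpoly A g) ^+ 2)%:C = (N ^ #|I|)%:R *
    \sum_(t | P t) \sum_(s | P s && [forall i, e t i == e s i]) A t * (A s)^*%C.
Proof.
rewrite rmorph_sum/=.
transitivity (\sum_(t | P t) \sum_(s | P s) (A t * (A s)^*%C) *
   \sum_g chi w g (e t) * chi w^-1 g (e s)).
  under eq_bigr => g _.
    rewrite normc_sqr /trigpoly rmorph_sum/= big_distrlr/=; over.
  rewrite exchange_big/=; apply: eq_bigr => t _.
  rewrite exchange_big/=; apply: eq_bigr => s _.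
  rewrite mulr_sumr; apply: eq_bigr => g _.
  by rewrite rmorphM/= chi_conj mulrACA.
rewrite mulr_sumr; apply: eq_bigr => t Pt; rewrite mulr_sumr big_mkcondr/=.
apply: eq_bigr => s Ps; rewrite sum_chi.
rewrite (eq_forallb (P2 := fun i => e t i == e s i)) => [|i].
  by case: ifP => _; rewrite ?mulr0// mulrC.
by rewrite !modn_small ?eN.
Qed.

Lemma sum_trigpoly2_inj (A : T -> C) :
  (forall t s, P t -> P s -> e t =1 e s -> t = s) ->
  \sum_g normc (trigpoly A g) ^+ 2 = (N ^ #|I|)%:R * \sum_(t | P t) normc (A t) ^+ 2.
Proof.
move=> einj; apply: complexI; rewrite sum_trigpoly2 rmorphM rmorph_nat rmorph_sum/=.
congr (_ * _); apply: eq_bigr => t Pt; rewrite (big_pred1 t) ?normc_sqr// => s /=.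
apply/andP/eqP => [[Ps /forallP ts]|->]; last by split=> //; apply/forallP.
by symmetry; apply: einj => // i; apply/eqP.
Qed.

(** Exponents may coincide here, at most [D] of them at a time. In Parseval's double sum the modulus
    of [A t * (A s)^*] is at most half the sum of the two squares, so each square is counted at most
    [D] times. *)
Lemma sum_trigpoly2_le (A : T -> C) D :
  (forall t, P t -> #|[pred s | P s && [forall i, e t i == e s i]]| <= D)%N ->
  \sum_g normc (trigpoly A g) ^+ 2 <=
    (N ^ #|I|)%:R * (D%:R * \sum_(t | P t) normc (A t) ^+ 2).
Proof.
move=> eD; have h0 : 0 <= \sum_g normc (trigpoly A g) ^+ 2.
  by apply: sumr_ge0 => g _; rewrite exprn_ge0// normc_ge0.
rewrite -(ger0_norm h0) -normc_real sum_trigpoly2 normcM.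
rewrite -[X in normc X * _]/((N ^ #|I|)%:R) -(rmorph_nat (real_complex R)) normc_real normr_nat.
rewrite ler_wpM2l// (le_trans (normc_sum _ _ _))//.
pose B t s := [forall i, e t i == e s i].
have BC t s : B t s = B s t by apply: eq_forallb => i; rewrite eq_sym.
apply: (@le_trans _ _ (\sum_(t | P t) \sum_(s | P s && B t s)
   (normc (A t) ^+ 2 / 2 + normc (A s) ^+ 2 / 2))).
  apply: ler_sum => t _; rewrite (le_trans (normc_sum _ _ _))//.
  apply: ler_sum => s _; rewrite normcM normc_conj.
  have := sqr_ge0 (normc (A t) - normc (A s)); lra.
rewrite (eq_bigr _ (fun t _ => big_split _ _ _ _ _)) big_split/=.
rewrite [X in _ + X](exchange_big_dep P)/=; last by move=> t s _ /andP[].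
rewrite [X in _ + X](eq_bigr (fun s => \sum_(t | P t && B s t) normc (A s) ^+ 2 / 2)); last first.
  by move=> s Ps; apply: eq_bigl => t; rewrite Ps BC.
rewrite -mulr2n mulr_sumr -sumrMnl; apply: ler_sum => t Pt.
rewrite sumr_const -mulrnA mulnC mulrnA -[_ *+ 2]mulr_natr divfK ?pnatr_eq0//.
by rewrite -[leLHS]mulr_natl ler_wpM2r ?exprn_ge0 ?normc_ge0// ler_nat; exact: eD.
Qed.
End L2.
End RootAverages.

Section L1L2.
Variables (R : realType) (I T : finType) (P : pred T) (e : T -> I -> nat) (d N : nat).
Variable w : R[i].
Hypothesis prw : N.-primitive_root w.
Hypothesis dN : (d + d < N)%N.
Hypothesis ed : forall t, P t -> (\sum_i e t i = d)%N.
Hypothesis einj : forall t s, P t -> P s -> e t =1 e s -> t = s.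

Lemma exponent_le t i : P t -> (e t i <= d)%N.
Proof. by move=> /ed <-; rewrite (bigD1 i)//= leq_addr. Qed.

(** The first factor determines the second, and its exponent at [i] takes one of
    [c i + 1 <= 2 ^ c i] values. *)
Lemma card_factorizations (c : I -> nat) : (\sum_i c i = d + d)%N ->
  (#|[pred s : T * T | (P s.1 && P s.2) && [forall i, c i == e s.1 i + e s.2 i]%N]| <= 4 ^ d)%N.
Proof.
move=> cd; pose M := (d + d).+1.
pose F : pred {ffun I -> 'I_M} := family (fun i => [pred a : 'I_M | (a <= c i)%N]).
pose h (s : T * T) : {ffun I -> 'I_M} := [ffun i => inord (e s.1 i)].
have eM t i : P t -> (e t i < M)%N.
  by move=> Pt; rewrite /M ltnS (leq_trans (exponent_le i Pt))// leq_addr.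
set A := [pred s | _].
have hinj : {in A &, injective h}.
  move=> [t1 s1] [t2 s2]; rewrite !inE/= => /andP[/andP[Pt1 Ps1] /forallP c1].
  move=> /andP[/andP[Pt2 Ps2] /forallP c2] /ffunP hh.
  have tE : t1 = t2.
    apply: einj => // i; have := congr1 val (hh i); rewrite !ffunE/=.
    by rewrite !inordK ?eM.
  rewrite -tE; congr (_, _); apply: einj => // i; apply/eqP.
  by rewrite -(eqn_add2l (e t1 i)) -(eqP (c1 i)) (eqP (c2 i)) tE.
rewrite -(card_in_imset hinj) (@leq_trans #|F|)//.
  apply: subset_leq_card; apply/fintype.subsetP => g /imsetP[[t s]].
  rewrite inE/= => /andP[/andP[Pt Ps] /forallP ct] ->; apply/familyP => i.
  by rewrite inE ffunE/= inordK ?eM// (eqP (ct i)) leq_addr.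
rewrite /F card_family foldrE big_map big_enum/=.
rewrite (_ : 4 ^ d = \prod_(i : I) 2 ^ c i)%N; last first.
  by rewrite -expn_sum cd addnn -muln2 mulnC expnM.
apply: leq_prod => i _.
rewrite (@leq_trans (c i).+1)//; last exact: ltn_expl.
have cM : ((c i).+1 <= M)%N.
  by rewrite /M ltnS -cd (bigD1 i)//= leq_addr.
apply: (@leq_trans #|[set widen_ord cM x | x in [set: 'I_(c i).+1]]%SET|).
  apply: subset_leq_card; apply/fintype.subsetP => a ac.
  apply/imsetP; exists (Ordinal (ac : (a < (c i).+1)%N)); rewrite ?finset.in_setT//.
  exact/val_inj.
by rewrite (leq_trans (leq_imset_card _ _))// cardsT card_ord.
Qed.

Hypothesis N4 : (0 < N)%N.
Variable A : T -> R[i].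
Local Notation Q := (trigpoly (N := N) w P e A).
Local Notation nrm := ((N ^ #|I|)%:R^-1 : R).

(** The fourth moment of [Q] is the second moment of [Q ^+ 2], whose frequencies have multiplicity
    at most [4 ^ d] by [card_factorizations]. Since [d + d < N], distinct frequencies of the square
    stay distinct modulo [N]. *)
Lemma avg_trigpoly4 : (nrm * \sum_(g : {ffun I -> 'I_N}) normc (Q g) ^+ 4) <=
  (4 ^ d)%:R * (\sum_(t | P t) normc (A t) ^+ 2) ^+ 2.
Proof.
have NI : 0 < ((N ^ #|I|)%:R : R) by rewrite ltr0n expn_gt0 N4.
rewrite ler_pdivrMl//.
pose P2 := [pred s : T * T | P s.1 && P s.2].
pose A2 (s : T * T) := A s.1 * A s.2.
pose e2 (s : T * T) i := (e s.1 i + e s.2 i)%N.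
have Q2 g : Q g ^+ 2 = trigpoly w P2 e2 A2 g.
  rewrite /trigpoly expr2 big_distrlr/= pair_big/=.
  by apply: eq_bigr => -[t s] _; rewrite /A2/= /e2/= chiD mulrACA.
under eq_bigr do rewrite (exprM _ 2 2) -normc_exp Q2.
rewrite (le_trans (@sum_trigpoly2_le _ _ _ prw _ _ _ e2 _ A2 (4 ^ d)%N _))//.
- by move=> [t s] i /andP[/= Pt Ps]; rewrite (leq_ltn_trans _ dN)// leq_add// exponent_le.
- move=> [t s] /andP[/= Pt Ps]; apply: card_factorizations.
  by rewrite big_split/= !ed.
rewrite ler_wpM2l ?(ltW NI)// ler_wpM2l// expr2 big_distrlr/= pair_big/=.
by apply: ler_sum => -[t s] _; rewrite /A2/= normcM exprMn.
Qed.

Lemma avg_trigpoly2 : (nrm * \sum_(g : {ffun I -> 'I_N}) normc (Q g) ^+ 2) = \sum_(t | P t) normc (A t) ^+ 2.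
Proof.
have NI : 0 < ((N ^ #|I|)%:R : R) by rewrite ltr0n expn_gt0 N4.
rewrite (sum_trigpoly2_inj prw)// => [|t i Pt]; first by rewrite mulKf// gt_eqF.
by rewrite (leq_ltn_trans (exponent_le i Pt))// (leq_ltn_trans _ dN)// leq_addr.
Qed.

(* The tangent inequality y >= (3 y^2 - y^4) / 2 turns bounds on the second and
   fourth moments into a lower bound on the first moment. *)
Lemma l2_le_avg_trigpoly :
  Num.sqrt (\sum_(t | P t) normc (A t) ^+ 2) <= 2 ^+ d * (nrm * \sum_(g : {ffun I -> 'I_N}) normc (Q g)).
Proof.
set S := \sum_(t | P t) _.
have NI : 0 < ((N ^ #|I|)%:R : R) by rewrite ltr0n expn_gt0 N4.
have S0 : 0 <= S by apply: sumr_ge0 => t _; rewrite exprn_ge0 ?normc_ge0.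
have avg0 : 0 <= (nrm * \sum_(g : {ffun I -> 'I_N}) normc (Q g)).
  by rewrite mulr_ge0 ?invr_ge0 ?(ltW NI)// sumr_ge0// => g _; rewrite normc_ge0.
have [S00|Sneq0] := eqVneq S 0; first by rewrite S00 sqrtr0 mulr_ge0// exprn_ge0.
pose x := Num.sqrt S.
have x0 : 0 < x by rewrite sqrtr_gt0 lt_def Sneq0.
(* At this scale the two moment bounds leave [(3/2 - 1/2) * x / 2 ^+ d] in the tangent
   inequality. *)
pose s := 2 ^+ d * x.
have s0 : 0 < s by rewrite mulr_gt0// exprn_gt0.
have xx : x ^+ 2 = S by rewrite sqr_sqrtr.
have pt y : 0 <= y -> 3 / (2 * s) * y ^+ 2 - y ^+ 4 / (2 * s ^+ 3) <= y.
  move=> y0; rewrite -subr_ge0.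
  have -> : y - (3 / (2 * s) * y ^+ 2 - y ^+ 4 / (2 * s ^+ 3)) =
    y * (y - s) ^+ 2 * (y + 2 * s) / (2 * s ^+ 3) by field; rewrite gt_eqF.
  have : 0 <= (y - s) ^+ 2 by rewrite sqr_ge0.
  move=> ys; apply: divr_ge0; last by rewrite mulr_ge0// exprn_ge0// ltW.
  by apply: mulr_ge0; [exact: mulr_ge0|rewrite addr_ge0// mulr_ge0// ltW].
have h1 : 3 / (2 * s) * (nrm * \sum_(g : {ffun I -> 'I_N}) normc (Q g) ^+ 2) -
    (nrm * \sum_(g : {ffun I -> 'I_N}) normc (Q g) ^+ 4) / (2 * s ^+ 3) <=
    (nrm * \sum_(g : {ffun I -> 'I_N}) normc (Q g)).
  rewrite mulrCA -mulrA -mulrBr ler_wpM2l ?invr_ge0 ?(ltW NI)//.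
  rewrite mulr_sumr mulr_suml -sumrB; apply: ler_sum => g _.
  by apply: pt; rewrite normc_ge0.
have h4 := avg_trigpoly4; move: h1; rewrite avg_trigpoly2 -/S => h1.
have h5 : (nrm * \sum_(g : {ffun I -> 'I_N}) normc (Q g) ^+ 4) / (2 * s ^+ 3) <= (4 ^ d)%:R * S ^+ 2 / (2 * s ^+ 3).
  by rewrite ler_wpM2r// invr_ge0 mulr_ge0 ?exprn_ge0 ?(ltW s0).
have {h4 h5}h1 := le_trans (lerB (lexx _) h5) h1.
rewrite -ler_pdivrMl ?exprn_gt0//; apply: le_trans h1.
rewrite -/x -xx le_eqVlt; apply/orP; left; apply/eqP.
rewrite natrX (_ : (4%:R : R) = 2 ^+ 2) -?exprM; last by rewrite expr2; lra.
rewrite /s mulnC exprM; set D := 2 ^+ d.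
have D0 : D != 0 by rewrite gt_eqF// exprn_gt0.
by field; rewrite D0 gt_eqF.
Qed.

End L1L2.

(** * Coefficients of bounded homogeneous polynomials *)

Section PolynomialCoefficients.
Variable R : realType.
Local Notation C := R[i].

Lemma coef_root_average (p : {poly C}) N w j : N.-primitive_root w -> (size p <= N)%N -> (j < N)%N ->
  p`_j = N%:R^-1 * \sum_(a < N) p.[w ^+ a] * w^-1 ^+ (a * j).
Proof.
move=> prw pN jN.
have N0 : (N%:R : C) != 0 by rewrite pnatr_eq0 -lt0n (leq_ltn_trans _ jN).
transitivity (N%:R^-1 * \sum_(l < N) p`_l * \sum_(a < N) w ^+ (a * l) * w^-1 ^+ (a * j)).
  rewrite (bigD1 (Ordinal jN))//= sum_root// eqxx big1 ?addr0 => [|l lj].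
    by rewrite mulrC mulfK.
  rewrite sum_root// !modn_small// ifN ?mulr0//.
congr (_ * _); under eq_bigr do rewrite mulr_sumr.
rewrite exchange_big/=; apply: eq_bigr => a _.
rewrite (horner_coef_wide _ pN) mulr_suml; apply: eq_bigr => l _.
by rewrite mulrA exprM.
Qed.

(** Cauchy's estimate, with the contour integral replaced by an average over roots of unity whose
    order exceeds [j] and the degree. *)
Lemma normc_coef_le (p : {poly C}) j B : (forall x, normc x = 1 -> normc p.[x] <= B) -> normc p`_j <= B.
Proof.
move=> pB; set K := maxn (size p) j.+1.
have NK : (K < 2 ^ K)%N by rewrite ltn_expl.
have [w prw] := prim_root_pow2 R K.
rewrite (coef_root_average prw) ?(leq_trans _ (ltnW NK)) ?leq_maxl ?leq_maxr//.
rewrite normcM normcV -(rmorph_nat (real_complex R)) normc_real normr_nat.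
rewrite ler_pdivrMl ?ltr0n ?expn_gt0// (le_trans (normc_sum _ _ _))//.
rewrite -[X in X%:R](card_ord (2 ^ K)) mulr_natl -sumr_const; apply: ler_sum => a _.
rewrite normcM normc_exp normcV (normc_root prw) invr1 expr1n mulr1 pB//.
by rewrite normc_exp (normc_root prw) expr1n.
Qed.

Lemma coef0_prod (I : Type) (s : seq I) (F : I -> {poly C}) :
  (\prod_(i <- s) F i)`_0 = \prod_(i <- s) (F i)`_0.
Proof. by elim/big_rec2: _ => [|i a b _ <-]; rewrite ?coef1// coef0M. Qed.

Lemma coef1_prod (I : eqType) (s : seq I) (F : I -> {poly C}) : uniq s ->
  (\prod_(i <- s) F i)`_1 = \sum_(k <- s) (F k)`_1 * \prod_(i <- s | i != k) (F i)`_0.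
Proof.
elim: s => [|j s IH]; first by rewrite !big_nil coef1.
move=> /= /andP[js us]; rewrite !big_cons coefM !big_ord_recl big_ord0/= addr0.
rewrite subn0 subnn IH// coef0_prod eqxx/= addrC; congr (_ * _ + _).
  rewrite [RHS]big_seq_cond [LHS]big_seq; apply: eq_bigl => i; case: (boolP (i \in s)) => //= si.
  by apply/esym; apply: contraNneq js => <-.
rewrite mulr_sumr [LHS]big_seq [RHS]big_seq; apply: eq_bigr => k ks.
rewrite big_cons ifT; first by rewrite mulrCA.
by apply: contraNneq js => ->.
Qed.

Lemma coef01_affine_exp (a b : C) n :
  ((a%:P + b *: 'X) ^+ n)`_0 = a ^+ n /\ ((a%:P + b *: 'X) ^+ n)`_1 = n%:R * b * a ^+ n.-1.
Proof.
have l0 : (a%:P + b *: 'X)`_0 = a by rewrite coefD coefC coefZ coefX/= mulr0 addr0.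
have l1 : (a%:P + b *: 'X)`_1 = b by rewrite coefD coefC coefZ coefX/= mulr1 add0r.
elim: n => [|n [IH0 IH1]]; first by rewrite !expr0 !coef1 !mul0r.
rewrite !exprS coef0M IH0 l0 coefM !big_ord_recl big_ord0/= addr0 subn0 subnn IH0 IH1 l0 l1.
split=> //; case: n {IH0 IH1} => [|n] /=; first by ring.
by rewrite exprS (natrD _ 1 n.+1); ring.
Qed.

(** The sum in the conclusion is the coefficient of [x] in P(w + x v), that is, the derivative of P
    at [w] along [v], and Cauchy's estimate in [x] bounds it. Where [e t k = 0] the subtraction is
    truncated, but the factor [(e t k)%:R] removes the term. *)
Lemma directional_derivative_le (n : nat) (T : finType) (P : pred T) (e : T -> 'I_n -> nat)
    (a : T -> C) (w v : 'I_n -> C) B :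
  (forall x, normc x = 1 -> normc (\sum_(t | P t) a t * \prod_i (w i + x * v i) ^+ e t i) <= B) ->
  normc (\sum_k v k * \sum_(t | P t) (a t * (e t k)%:R) * \prod_i w i ^+ (e t i - (i == k))) <= B.
Proof.
move=> HB; pose q := \sum_(t | P t) a t *: \prod_i ((w i)%:P + v i *: 'X) ^+ e t i.
suff <- : q`_1 = \sum_k v k * \sum_(t | P t) (a t * (e t k)%:R) * \prod_i w i ^+ (e t i - (i == k)).
  apply: normc_coef_le => x /HB; rewrite /q horner_sum.
  under [X in _ -> normc X <= _]eq_bigr => t _.
    rewrite hornerZ horner_prod.
    under eq_bigr do rewrite horner_exp hornerD hornerC hornerZ hornerX [v _ * x]mulrC.
    over.
  by [].
rewrite /q coef_sum; under eq_bigr => t _.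
  rewrite coefZ coef1_prod ?index_enum_uniq// mulr_sumr; over.
rewrite exchange_big/=; apply: eq_bigr => k _; rewrite mulr_sumr; apply: eq_bigr => t _.
rewrite (coef01_affine_exp _ _ _).2.
under eq_bigr => i _ do rewrite (coef01_affine_exp _ _ _).1.
rewrite [in RHS](bigD1 k)//= eqxx subn1.
rewrite [in RHS](eq_bigr (fun i => w i ^+ e t i)) => [|i /negbTE ->]; last by rewrite subn0.
by ring.
Qed.

End PolynomialCoefficients.

(** * Sums of monomial weights with a prescribed largest variable *)

Section MaximalIndexSums.
Variable R : realType.

Lemma geometric_le (x : R) M : 0 <= x -> x < 1 -> \sum_(b < M) x ^+ b <= (1 - x)^-1.
Proof.
move=> x0 x1; have y0 : 0 < 1 - x by rewrite subr_gt0.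
rewrite -[leRHS]mul1r ler_pdivlMr// mulrC -opprB mulNr -subrX1 opprB.
by rewrite gerBl exprn_ge0.
Qed.

Definition max_at n M (k : 'I_n) : pred {ffun 'I_n -> 'I_M} :=
  [pred al : {ffun 'I_n -> 'I_M} | (0 < al k)%N && [forall i : 'I_n, (k < i)%N ==> (al i == 0 :> nat)%N]].

Lemma max_at_ex n M (al : {ffun 'I_n -> 'I_M}) : (0 < \sum_i al i)%N -> exists k, max_at k al.
Proof.
move=> al0; have [i0 i00] : exists i, (0 < al i)%N.
  apply/existsP; apply: contraTT al0; rewrite negb_exists -leqNgt => /forallP h.
  by rewrite big1// => i _; apply/eqP; rewrite -leqn0 leqNgt.
have [k k0 kmax] := @arg_maxnP _ i0 (fun i => (0 < al i)%N) (fun i => val i) i00.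
exists k; rewrite /max_at/= k0; apply/forallP => i; apply/implyP => ki.
by rewrite -leqn0 leqNgt; apply: contraL ki => /kmax; rewrite -leqNgt.
Qed.

Lemma prod_max_index n (k : 'I_n) (f : nat -> R) (c : R) :
  \prod_(i < n) (if (i < k)%N then f i else if (i == k :> nat)%N then c else 1) =
  c * \prod_(0 <= i < k) f i.
Proof.
rewrite -(big_mkord xpredT (fun i => if (i < k)%N then f i else if (i == k)%N then c else 1)).
rewrite (@big_cat_nat _ _ _ k)//=; last exact: ltnW.
rewrite mulrC big_ltn// ltnn eqxx big_nat big1 ?mulr1 => [|i /andP[ki _]]; last first.
  by rewrite ltnNge (ltnW ki)/= gtn_eqF.
by congr (_ * _); apply: eq_big_nat => i /andP[_ ->].
Qed.

(** [max_at k] constrains each exponent separately, so the sum factors: a full geometric series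
    below [k], a series starting at exponent 1 at [k], hence at most [2 * x k], and only the
    exponent 0 above [k]. This is where the dependence on [n] disappears. *)
Lemma sum_max_at_le n M (k : 'I_n) (x : nat -> R) :
  (forall i, 0 <= x i <= 2^-1) ->
  \sum_(al : {ffun 'I_n -> 'I_M} | max_at k al) \prod_(i < n) x i ^+ al i <=
    2 * x k * \prod_(0 <= i < k) (1 - x i)^-1.
Proof.
move=> x01; have x0 i : 0 <= x i by have /andP[] := x01 i.
have x1 i : x i <= 2^-1 by have /andP[] := x01 i.
pose Q (i : 'I_n) : pred 'I_M :=
  [pred b : 'I_M | if (i < k)%N then true else if (i == k :> nat)%N then (0 < b)%N else (b == 0 :> nat)%N].
have E al : max_at k al = (al \in family Q).
  apply/andP/familyP => [[ak /forallP h] i|h].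
    rewrite !inE; case: ltngtP => //= [ki|ik]; first by have := h i; rewrite ki.
    by rewrite (val_inj ik).
  split; first by have := h k; rewrite !inE ltnn eqxx.
  apply/forallP => i; apply/implyP => ki; have := h i.
  by rewrite !inE ltnNge (ltnW ki)/= gtn_eqF.
rewrite (_ : \sum_(al | _) _ = \prod_(i < n) \sum_(b | Q i b) x i ^+ b); last first.
  by rewrite bigA_distr_big_dep; apply: eq_bigl.
rewrite -(prod_max_index k (fun i => (1 - x i)^-1)).
apply: ler_prod => i _; rewrite sumr_ge0 => [|b _]; last by rewrite exprn_ge0.
have h1 : x i < 1 by rewrite (le_lt_trans (x1 _))// invf_lt1// ltr1n.
rewrite /Q/=; case: ltngtP => [ik|ki|/val_inj ->] /=.
- exact: geometric_le.
- case: (M) => [|M']; first by rewrite big_ord0.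
  by rewrite big_mkcond big_ord_recl/= expr0 big1 ?addr0.
case: (M) => [|M']; first by rewrite big_ord0 mulr_ge0.
rewrite big_mkcond big_ord_recl/= add0r.
under eq_bigr do rewrite exprS.
rewrite -mulr_sumr mulrC ler_wpM2r// (le_trans (geometric_le _ (x0 k) _))//.
  by rewrite (le_lt_trans (x1 k))// invf_lt1// ltr1n.
rewrite -[leRHS]invrK lef_pV2 ?posrE ?invr_gt0// ?subr_gt0.
  by have := x1 k; lra.
by rewrite (le_lt_trans (x1 k))// invf_lt1// ltr1n.
Qed.

Lemma prod_half_le k : \prod_(0 <= i < k) (1 - 2^-1 * i.+1%:R^-1)^-1 <= k.+1%:R :> R.
Proof.
elim: k => [|k IH]; first by rewrite big_nil.
rewrite big_nat_recr//=; have k0 : (0 : R) < k.+1%:R by rewrite ltr0n.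
have k1 : (1 : R) <= k.+1%:R by rewrite ler1n.
rewrite -[k.+2%:R]natr1; move: (k.+1%:R : R) k0 k1 IH => y y0 y1 IH.
have d0 : 0 < 2 * y - 1 by lra.
have -> : (1 - 2^-1 * y^-1)^-1 = (2 * y) / (2 * y - 1).
  by field; rewrite !gt_eqF//; lra.
rewrite mulrA ler_pdivrMr// (le_trans (ler_wpM2r _ IH)) ?mulr_ge0 ?(ltW y0)//.
by nra.
Qed.

Lemma prod_quarter_le k :
  \prod_(0 <= i < k) (1 - 4^-1 * i.+1%:R^-1)^-1 <= Num.sqrt k.+1%:R :> R.
Proof.
elim: k => [|k IH]; first by rewrite big_nil sqrtr1.
rewrite big_nat_recr//=; have k0 : (0 : R) < k.+1%:R by rewrite ltr0n.
have k1 : (1 : R) <= k.+1%:R by rewrite ler1n.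
rewrite -[k.+2%:R]natr1; move: (k.+1%:R : R) k0 k1 IH => y y0 y1 IH.
have d0 : 0 < 4 * y - 1 by lra.
have -> : (1 - 4^-1 * y^-1)^-1 = (4 * y) / (4 * y - 1).
  by field; rewrite !gt_eqF//; lra.
have f0 : 0 <= (4 * y) / (4 * y - 1) by rewrite divr_ge0// ?(ltW d0)// mulr_ge0// ltW.
rewrite (le_trans (ler_wpM2r f0 IH))//.
have y10 : 0 <= y + 1 by rewrite addr_ge0// ltW.
rewrite -(ler_pXn2r (isT : (0 < 2)%N)) ?nnegrE ?mulr_ge0 ?sqrtr_ge0//.
rewrite exprMn !sqr_sqrtr// ?(ltW y0)// expr_div_n mulrA ler_pdivrMr ?exprn_gt0//.
by rewrite -subr_ge0 (_ : _ - _ = (8 * y - 7) * y + 1); [nra|ring].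
- exact: ltW.
- by rewrite invr_ge0 ltW.
Qed.

(** Halving all variables costs [2 ^+ m] by homogeneity. The geometric series below [k] then
    multiply up to at most [k + 1], which the factor [1 / (k + 1)] of the largest variable
    cancels. *)
Lemma sum_max_at_half n M m (k : 'I_n) :
  \sum_(al : {ffun 'I_n -> 'I_M} | (\sum_i al i == m)%N && max_at k al)
    \prod_(i < n) (i.+1%:R^-1 : R) ^+ al i <= 2 ^+ m.
Proof.
rewrite -[leRHS]mulr1.
have x01 i : 0 <= (2^-1 * i.+1%:R^-1 : R) <= 2^-1.
  by rewrite mulr_ge0//= ler_piMr// invf_le1 ?ltr0n// ler1n.
rewrite -ler_pdivrMl ?exprn_gt0// mulr_sumr.
apply: (@le_trans _ _ (\sum_(al : {ffun 'I_n -> 'I_M} | max_at k al) \prod_(i < n) (2^-1 * i.+1%:R^-1 : R) ^+ al i)).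
  rewrite big_mkcondl/=; apply: ler_sum => al _; case: ifPn => [/eqP am|_]; last first.
    by apply: prodr_ge0 => i _; rewrite exprn_ge0//; have /andP[] := x01 i.
  rewrite -exprVn -am -prodrXr -big_split/=.
  by apply: ler_prod => i _; rewrite exprMn lexx andbT mulr_ge0// exprn_ge0.
rewrite (le_trans (sum_max_at_le M k x01))// mulrA divff ?mul1r ?pnatr_eq0//.
by rewrite ler_pdivrMl ?ltr0n// mulr1 prod_half_le.
Qed.

(** Quartering instead of halving reduces the product of the geometric series to [sqrt (k + 1)]. The
    decay in [k] that is left over makes a later sum over [k] converge. *)
Lemma sum_max_at_quarter n M m (k : 'I_n) :
  \sum_(al : {ffun 'I_n -> 'I_M} | (\sum_i al i == m)%N && max_at k al)
    \prod_(i < n) (i.+1%:R^-1 : R) ^+ al i <= 4 ^+ m / Num.sqrt k.+1%:R.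
Proof.
have x01 i : 0 <= (4^-1 * i.+1%:R^-1 : R) <= 2^-1.
  have : 0 <= (i.+1%:R^-1 : R) <= 1 by rewrite invr_ge0 ler0n invf_le1 ?ltr0n// ler1n.
  by move: (i.+1%:R^-1 : R) => z /andP[? ?]; apply/andP; split; lra.
rewrite -ler_pdivrMl ?exprn_gt0// mulr_sumr.
apply: (@le_trans _ _ (\sum_(al : {ffun 'I_n -> 'I_M} | max_at k al) \prod_(i < n) (4^-1 * i.+1%:R^-1 : R) ^+ al i)).
  rewrite big_mkcondl/=; apply: ler_sum => al _; case: ifPn => [/eqP am|_]; last first.
    by apply: prodr_ge0 => i _; rewrite exprn_ge0//; have /andP[] := x01 i.
  rewrite -exprVn -am -prodrXr -big_split/=.
  by apply: ler_prod => i _; rewrite exprMn lexx andbT mulr_ge0// exprn_ge0.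
rewrite (le_trans (sum_max_at_le M k x01))//.
have s0 : 0 < Num.sqrt k.+1%:R :> R by rewrite sqrtr_gt0 ltr0n.
have kE : (k.+1%:R : R) = Num.sqrt k.+1%:R ^+ 2 by rewrite sqr_sqrtr.
have := prod_quarter_le k; move: (\prod_(0 <= i < k) _) => p; rewrite [in X in _ -> X]kE.
set s := Num.sqrt _ in s0 *; move=> ps.
have c0 : 0 <= 2 * (4^-1 * (s ^+ 2)^-1) by rewrite !mulr_ge0// invr_ge0 exprn_ge0// ltW.
rewrite (le_trans (ler_wpM2l c0 ps))// (_ : _ * s = 2^-1 / s); last by field; rewrite gt_eqF.
by rewrite sqrtr_sqr gtr0_norm// ler_piMl ?invr_ge0 ?(ltW s0)//; lra.
Qed.

End MaximalIndexSums.

(** * Homogeneous polynomials bounded on the polydisc *)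

Section HomogeneousPolynomials.
Variable R : realType.
Local Notation C := R[i].
Variables (n d : nat).
Local Notation m := d.+1.
Local Notation T := {ffun 'I_n -> 'I_m.+1}.

(** Exponents in degree [m] are at most [m], so the finite type [T] contains all of them. The degree
    is [d.+1] because a constant monomial has no largest variable. *)
Definition homog : pred T := [pred al : T | (\sum_i al i == m)%N].

Lemma sum_lower (al : T) k : al \in homog -> (0 < al k)%N ->
  (\sum_i (al i - (i == k)) = d)%N.
Proof.
rewrite inE/= => /eqP alm ak.
have : ((\sum_i (al i - (i == k))).+1 = \sum_i al i)%N.
  rewrite (bigD1 k)//= [RHS](bigD1 k)//= eqxx subn1 -addSn prednK//.
  by congr addn; apply: eq_bigr => i /negbTE ->; rewrite subn0.
by rewrite alm => -[].
Qed.

Lemma prod_lower (x : C) (z : 'I_n -> C) (al : T) k : al \in homog -> (0 < al k)%N ->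
  \prod_i (x * z i) ^+ (al i - (i == k)) = x ^+ d * \prod_i z i ^+ (al i - (i == k)).
Proof.
move=> alm ak; transitivity (x ^+ (\sum_i (al i - (i == k))) * \prod_i z i ^+ (al i - (i == k))); last first.
  by rewrite (sum_lower alm ak).
by rewrite -prodrXr -big_split/=; apply: eq_bigr => i _; rewrite exprMn.
Qed.

Variable a : T -> C.
Definition hpoly (z : 'I_n -> C) : C := \sum_(al | al \in homog) a al * \prod_i z i ^+ al i.

Lemma derivative_sum_le (w v : 'I_n -> C) :
  (forall x, normc x = 1 -> normc (hpoly (fun i => w i + x * v i)) <= 1) ->
  normc (\sum_k v k * \sum_(al | (al \in homog) && (0 < al k)%N)
     (a al * (al k)%:R) * \prod_i w i ^+ (al i - (i == k))) <= 1.
Proof.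
move=> H; have := directional_derivative_le (P := fun al => al \in homog) (e := fun al i => al i) H.
congr (normc _ <= _); apply: eq_bigr => k _; congr (_ * _).
rewrite big_mkcondr/=; apply: eq_bigr => al _.
by case: posnP => [->|//]; rewrite mulr0 mul0r.
Qed.

(** At a point of the torus, taking the phases of the partial derivatives as direction [v] turns the
    directional derivative into the sum over [k] of their moduli. Averaging over the torus grid and
    passing from L^1 to L^2 for each [k] gives the mixed norm. Both the point and the direction are
    halved to keep [w + x v] in the polydisc. *)
Lemma mixed_norm_le :
  (forall z, (forall i, normc (z i) <= 1) -> normc (hpoly z) <= 1) ->
  \sum_k Num.sqrt (\sum_(al | (al \in homog) && (0 < al k)%N) normc (a al) ^+ 2) <= 4 ^+ m.
Proof.
move=> H.
pose K := (d + d).+1; pose N := (2 ^ K)%N.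
have KN : (d + d < N)%N by rewrite (leq_trans _ (ltnW (ltn_expl K (isT : (1 < 2)%N)))).
have [w prw] := prim_root_pow2 R K.
have N0 : (0 < N)%N by rewrite expn_gt0.
pose e (k : 'I_n) (al : T) (i : 'I_n) := (al i - (i == k))%N.
pose P k := fun al : T => (al \in homog) && (0 < al k)%N.
pose A k (al : T) : C := a al * (al k)%:R.
pose Q k := trigpoly (N := N) w (P k) (e k) (A k).
have half : normc (2^-1 : C) = 2^-1.
  by rewrite normcV -(rmorph_nat (real_complex R)) normc_real normr_nat.
have step g : \sum_k normc (Q k g) <= 2 ^+ m.
  pose z i : C := w ^+ g i.
  have z1 i : normc (z i) = 1 by rewrite normc_exp (normc_root prw) expr1n.
  pose v k : C := 2^-1 * phase (Q k g).
  have v1 k : normc (v k) = 2^-1 by rewrite normcM half normc_phase mulr1.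
  have := @derivative_sum_le (fun i => 2^-1 * z i) v.
  have QE k : \sum_(al | (al \in homog) && (0 < al k)%N)
     (a al * (al k)%:R) * \prod_i (2^-1 * z i) ^+ (al i - (i == k)) = 2^-1 ^+ d * Q k g.
    rewrite /Q /trigpoly mulr_sumr; apply: eq_bigr => al /andP[alm ak].
    rewrite prod_lower// mulrCA; congr (_ * (_ * _)).
    by apply: eq_bigr => i _; rewrite /z exprM.
  under eq_bigr do rewrite QE.
  have -> : \sum_k v k * (2^-1 ^+ d * Q k g) = (2^-1 ^+ m * \sum_k normc (Q k g))%:C.
    rewrite rmorphM rmorph_sum rmorphXn/= fmorphV rmorph_nat mulr_sumr.
    by apply: eq_bigr => k _; rewrite /v mulrACA phaseM -exprS.
  rewrite normc_real ger0_norm; last first.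
    by rewrite mulr_ge0 ?exprn_ge0 ?invr_ge0// sumr_ge0// => k _; rewrite normc_ge0.
  rewrite exprVn ler_pdivrMl ?exprn_gt0// mulr1; apply=> x x1; apply: H => i.
  rewrite (le_trans (le_normcD _ _))// !normcM half z1 x1 normc_phase.
  by lra.
have NI : 0 < ((N ^ #|'I_n|)%:R : R) by rewrite ltr0n expn_gt0 N0.
have l2 k : Num.sqrt (\sum_(al | P k al) normc (a al) ^+ 2) <=
    2 ^+ d * ((N ^ #|'I_n|)%:R^-1 * \sum_(g : {ffun 'I_n -> 'I_N}) normc (Q k g)).
  apply: le_trans (l2_le_avg_trigpoly (P := P k) (e := e k) prw KN _ _ N0 (A k)).
  - apply: ler_wsqrtr; apply: ler_sum => al /andP[_ ak].
    rewrite /A normcM -(rmorph_nat (real_complex R)) normc_real normr_nat exprMn.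
    by rewrite ler_peMr ?exprn_ge0 ?normc_ge0// exprn_ege1// ler1n.
  - by move=> al /andP[alm ak]; exact: sum_lower.
  move=> al be /andP[alm ak] /andP[bem bk] E; apply/ffunP => i; apply: val_inj => /=.
  have := E i; rewrite /e; case: eqP => [->|_]; last by rewrite !subn0.
  by rewrite /= -{2}(subnK ak) -{2}(subnK bk) => ->.
rewrite (le_trans (ler_sum _ (fun k _ => l2 k)))// -mulr_sumr -mulr_sumr exchange_big/=.
rewrite (_ : 4 ^+ m = 2 ^+ m * 2 ^+ m); last by rewrite -exprMn -natrM.
apply: ler_pM; rewrite ?exprn_ge0//.
- rewrite mulr_ge0 ?invr_ge0 ?(ltW NI)// sumr_ge0// => g _.
  by rewrite sumr_ge0// => k _; rewrite normc_ge0.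
- by rewrite exprS ler_peMl ?exprn_ge0// ler1n.
rewrite ler_pdivrMl// (le_trans (ler_sum _ (fun g _ => step g)))//.
by rewrite sumr_const card_ffun !card_ord mulr_natl.
Qed.

End HomogeneousPolynomials.

Section CauchySchwarz.
Variable R : realType.
Lemma sum_mul_le_sqrt (T : finType) (P : pred T) (f g : T -> R) :
  (forall t, 0 <= f t) -> (forall t, 0 <= g t) ->
  \sum_(t | P t) f t * g t <=
    Num.sqrt (\sum_(t | P t) f t ^+ 2) * Num.sqrt (\sum_(t | P t) g t ^+ 2).
Proof.
move=> f0 g0; set F := \sum_(t | P t) f t ^+ 2; set G := \sum_(t | P t) g t ^+ 2.
have F0 : 0 <= F by apply: sumr_ge0 => t _; rewrite sqr_ge0.
have G0 : 0 <= G by apply: sumr_ge0 => t _; rewrite sqr_ge0.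
have z (h : T -> R) : \sum_(t | P t) h t ^+ 2 = 0 -> forall t, P t -> h t = 0.
  move=> /eqP; rewrite psumr_eq0 => [/allP H t Pt|t _]; last exact: sqr_ge0.
  by have := H t (mem_index_enum t); rewrite Pt/= sqrf_eq0 => /eqP.
have [FE|F1] := eqVneq F 0.
  by rewrite big1 ?mulr_ge0 ?sqrtr_ge0// => t Pt; rewrite (z _ FE)// mul0r.
have [GE|G1] := eqVneq G 0.
  by rewrite big1 ?mulr_ge0 ?sqrtr_ge0// => t Pt; rewrite (z _ GE)// mulr0.
have x0 : 0 < Num.sqrt F by rewrite sqrtr_gt0 lt_def F1.
have y0 : 0 < Num.sqrt G by rewrite sqrtr_gt0 lt_def G1.
have xF : Num.sqrt F ^+ 2 = F by rewrite sqr_sqrtr.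
have yG : Num.sqrt G ^+ 2 = G by rewrite sqr_sqrtr.
move: (Num.sqrt F) (Num.sqrt G) x0 y0 xF yG => x y x0 y0 xF yG.
apply: (@le_trans _ _ (y / (2 * x) * F + x / (2 * y) * G)); last first.
  by rewrite -xF -yG le_eqVlt; apply/orP; left; apply/eqP; field; rewrite !gt_eqF.
rewrite /F /G !mulr_sumr -big_split; apply: ler_sum => t _ /=; rewrite -subr_ge0.
rewrite (_ : _ - _ = (y * f t - x * g t) ^+ 2 / (2 * x * y)); last first.
  by field; rewrite !gt_eqF.
by rewrite divr_ge0 ?sqr_ge0// !mulr_ge0// ltW.
Qed.
End CauchySchwarz.

Section TailPolydisc.
Variable R : realType.
Local Notation C := R[i].

(** Group the monomials by their largest variable [k] and apply Cauchy-Schwarz in each group: the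
    squared weights are products of 1/i and are controlled by [sum_max_at_half], and the
    coefficients give the terms of [mixed_norm_le]. *)
Lemma polydisc_coef_sum_le (n d : nat) (a : {ffun 'I_n -> 'I_d.+2} -> C) :
  (forall z, (forall i, normc (z i) <= 1) -> normc (hpoly a z) <= 1) ->
  \sum_(al | al \in @homog n d) normc (a al) * \prod_(i < n) Num.sqrt i.+1%:R^-1 ^+ al i <= 8 ^+ d.+1.
Proof.
move=> H; have := mixed_norm_le H.
set S := \sum_k _ => HS.
pose y (al : {ffun 'I_n -> 'I_d.+2}) : R := \prod_(i < n) Num.sqrt i.+1%:R^-1 ^+ al i.
have y0 al : 0 <= y al by apply: prodr_ge0 => i _; rewrite exprn_ge0 ?sqrtr_ge0.
apply: (@le_trans _ _ (\sum_k \sum_(al | (al \in @homog n d) && max_at k al) normc (a al) * y al)).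
  rewrite (exchange_big_dep (fun al => al \in @homog n d))/=; last by move=> k al _ /andP[].
  apply: ler_sum => al alm; have [k ak] : exists k, max_at k al.
    by apply: max_at_ex; move: alm; rewrite inE/= => /eqP ->.
  have akP : (al \in @homog n d) && max_at k al by apply/andP.
  rewrite (bigD1 k akP)/=.
  by rewrite lerDl sumr_ge0// => *; rewrite mulr_ge0 ?normc_ge0.
have step k : \sum_(al | (al \in @homog n d) && max_at k al) normc (a al) * y al <=
    Num.sqrt (\sum_(al | (al \in @homog n d) && (0 < al k)%N) normc (a al) ^+ 2) * 2 ^+ d.+1.
  rewrite (le_trans (sum_mul_le_sqrt _ _ _))// => [t|]; first exact: normc_ge0.
  apply: ler_pM; rewrite ?sqrtr_ge0//.
    apply: ler_wsqrtr; rewrite big_mkcondr [leRHS]big_mkcondr/=; apply: ler_sum => al _.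
    rewrite /max_at/=; case: ifPn => [/andP[-> _]//|_].
    by case: ifPn => // _; rewrite exprn_ge0 ?normc_ge0.
  rewrite (@le_trans _ _ (Num.sqrt (2 ^+ d.+1)))//.
    apply: ler_wsqrtr; apply: le_trans (sum_max_at_half R (d.+2) d.+1 k).
    apply: ler_sum => al _; rewrite /y -prodrXl; apply: ler_prod => i _.
    by rewrite exprn_ge0 ?exprn_ge0 ?sqrtr_ge0//= exprAC sqr_sqrtr// invr_ge0.
  rewrite -(ler_pXn2r (isT : (0 < 2)%N)) ?nnegrE ?sqrtr_ge0 ?exprn_ge0// sqr_sqrtr ?exprn_ge0//.
  by rewrite -exprM ler_eXn2l ?ltr1n// leq_pmulr.
rewrite (le_trans (ler_sum _ (fun k _ => step k)))// -mulr_suml.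
rewrite (_ : 8 ^+ d.+1 = 4 ^+ d.+1 * 2 ^+ d.+1); last by rewrite -exprMn -natrM.
by rewrite ler_wpM2r// exprn_ge0.
Qed.

End TailPolydisc.

Section RealInequalities.
Variable R : realType.

Lemma powR_exp (x r : R) n : 0 <= x -> (x ^+ n) `^ r = (x `^ r) ^+ n.
Proof.
move=> x0; elim: n => [|n IH]; first by rewrite !expr0 powR1.
by rewrite exprS powRM ?exprn_ge0// IH -exprS.
Qed.

Lemma powR_prod_exp (I : Type) (s : seq I) (P : pred I) (x : I -> R) (b : I -> nat) r :
  (forall i, 0 <= x i) ->
  (\prod_(i <- s | P i) x i ^+ b i) `^ r = \prod_(i <- s | P i) (x i `^ r) ^+ b i.
Proof.
move=> x0; have [h0 ->] : 0 <= \prod_(i <- s | P i) x i ^+ b i /\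
    (\prod_(i <- s | P i) x i ^+ b i) `^ r = \prod_(i <- s | P i) (x i `^ r) ^+ b i.
  elim/big_rec2: _ => [|i y1 y2 _ [y20 IH]]; first by rewrite powR1.
  split; first by rewrite mulr_ge0// exprn_ge0.
  by rewrite powRM ?exprn_ge0// IH powR_exp.
by [].
Qed.

Lemma exp_partial_sum_le (x : R) M : 0 <= x -> \sum_(b < M) x ^+ b / b`!%:R <= expR x.
Proof.
move=> x0; rewrite -(big_mkord xpredT (fun b => x ^+ b / b`!%:R)).
apply: (nondecreasing_cvgn_le (u_ := series (exp_coeff x))); last exact: is_cvg_series_exp_coeff.
apply/nondecreasing_seqP => n; rewrite /series/= big_nat_recr//= lerDl.
by rewrite divr_ge0// exprn_ge0.
Qed.

Lemma leq_fact_expn b : (b`! <= b ^ b)%N.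
Proof.
elim: b => // b IH; rewrite factS expnS leq_mul2l/= (leq_trans IH)//.
by case: b {IH} => // b; rewrite leq_exp2r.
Qed.

(** A telescoping bound for the series of [k^(-3/2)]. With consecutive square roots [s] and [t] the
    induction step is [t <= 4 s^2 (t - s)], which follows from [(t - s)(t + s) = 1] and
    [t <= 3/2 s]. *)
Lemma sum_three_halves_le n :
  \sum_(0 <= k < n) (k.+1%:R * Num.sqrt k.+1%:R)^-1 <= 4 - 4 / Num.sqrt n.+1%:R :> R.
Proof.
elim: n => [|n IH]; first by rewrite big_nil sqrtr1 divr1 subrr.
rewrite big_nat_recr//= (le_trans (lerD IH (lexx _)))//.
have s0 : 1 <= Num.sqrt n.+1%:R :> R by rewrite -[X in X <= _]sqrtr1 ler_wsqrtr// ler1n.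
have sE : (n.+1%:R : R) * Num.sqrt n.+1%:R = Num.sqrt n.+1%:R ^+ 3.
  by rewrite -{1}[n.+1%:R]sqr_sqrtr// -exprSr.
have t0 : 0 <= Num.sqrt n.+2%:R :> R by rewrite sqrtr_ge0.
have tE : Num.sqrt n.+2%:R ^+ 2 = (Num.sqrt n.+1%:R ^+ 2 : R) + 1.
  by rewrite !sqr_sqrtr// natr1.
rewrite sE; move: (Num.sqrt n.+1%:R) (Num.sqrt n.+2%:R) s0 t0 tE => s t s1 t0 tE.
have sp : 0 < s by lra.
have tp : 0 < t by rewrite lt_def t0 andbT; apply: contraTneq isT => t00; move: tE; rewrite t00; nra.
rewrite -subr_ge0 (_ : _ - _ = (4 * s ^+ 2 * (t - s) - t) / (s ^+ 3 * t)); last first.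
  by field; rewrite !gt_eqF.
rewrite divr_ge0// ?mulr_ge0 ?exprn_ge0 ?(ltW sp)//.
have ss : 1 <= s ^+ 2 by rewrite exprn_ege1.
have st : s <= t by rewrite -ler_sqr ?nnegrE ?(ltW sp)// tE lerDl.
have ts : t <= 3 / 2 * s.
  rewrite -ler_sqr ?nnegrE ?mulr_ge0 ?(ltW sp)// tE exprMn; move: (s ^+ 2) ss => q q1; lra.
have ts' : (t - s) * (t + s) = 1 by rewrite -subr_sqr tE; ring.
have h1 : 0 <= (t - s) * (5 / 2 * s - (t + s)) by apply: mulr_ge0; lra.
have h2 : 0 <= s * ((t - s) * (5 / 2 * s - (t + s))) by rewrite mulr_ge0// ltW.
have h3 : s * ((t - s) * (t + s)) = s by rewrite ts' mulr1.
have -> : 4 * s ^+ 2 * (t - s) - t = 8 / 5 * (s * ((t - s) * (5 / 2 * s - (t + s)))) +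
    (8 / 5 * s - t) + 8 / 5 * (s * ((t - s) * (t + s)) - s) by field.
rewrite h3 subrr mulr0 addr0; apply: addr_ge0; [exact: mulr_ge0|lra].
Qed.

End RealInequalities.

(** * Homogeneous polynomials bounded on the ball of l_r *)

Section DualEstimate.
Variable R : realType.
Local Notation C := R[i].

(** Cauchy's estimate in several variables. Different [t] may share an exponent, so what is isolated
    is the sum over all [t] with exponent [b]; later [t] is a pair of a variable [k] and a monomial,
    whose exponents coincide after differentiation in [k]. *)
Lemma trigpoly_coef_le (I T : finType) (P : pred T) (e : T -> I -> nat) N (w : C)
    (A : T -> C) (b : I -> nat) B :
  N.-primitive_root w -> (forall t i, P t -> (e t i < N)%N) -> (forall i, (b i < N)%N) ->
  (forall g : {ffun I -> 'I_N}, normc (trigpoly w P e A g) <= B) ->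
  normc (\sum_(t | P t && [forall i, e t i == b i]) A t) <= B.
Proof.
move=> prw eN bN HB.
have N0 : (0 < N)%N := prim_order_gt0 prw.
have NI : 0 < ((N ^ #|I|)%:R : R) by rewrite ltr0n expn_gt0 N0.
have E : \sum_(g : {ffun I -> 'I_N}) trigpoly w P e A g * chi w^-1 g b =
    (N ^ #|I|)%:R * \sum_(t | P t && [forall i, e t i == b i]) A t.
  under eq_bigr do rewrite mulr_suml.
  rewrite exchange_big/= mulr_sumr big_mkcondr/=; apply: eq_bigr => t Pt.
  under eq_bigr do rewrite -mulrA.
  rewrite -mulr_sumr (sum_chi prw) (eq_forallb (P2 := fun i => e t i == b i)) => [|i].
    by case: ifP => _; rewrite ?mulr0// mulrC.
  by rewrite !modn_small ?eN.
rewrite -(ler_pM2l NI) -{1}[(N ^ _)%:R]ger0_norm ?ler0n// -normc_real -normcM rmorph_nat -E.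
rewrite (le_trans (normc_sum _ _ _))//.
rewrite (_ : _ * B = \sum_(g : {ffun I -> 'I_N}) B); last first.
  by rewrite sumr_const card_ffun !card_ord mulr_natl.
apply: ler_sum => g _; rewrite normcM.
have -> : normc (chi w^-1 g b) = 1.
  by rewrite normc_prod big1// => i _; rewrite normc_exp normcV (normc_root prw) invr1 expr1n.
by rewrite mulr1.
Qed.

Variables n d : nat.
Local Notation T := {ffun 'I_n -> 'I_d.+2}.

Definition raise k (be : T) : T := [ffun i => inord (be i + (i == k))].
Definition lower k (al : T) : T := [ffun i => inord (al i - (i == k))].
Definition supp_le (k : 'I_n) (be : T) : bool :=
  [forall i : 'I_n, (k < i)%N ==> (be i == 0 :> nat)%N].
Definition lower_homog : pred T := [pred be : T | (\sum_i be i == d)%N].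

Lemma lowerE k (al : T) i : lower k al i = (al i - (i == k))%N :> nat.
Proof. by rewrite ffunE inordK// (leq_ltn_trans (leq_subr _ _)). Qed.

Lemma lower_homog_le (be : T) i : be \in lower_homog -> (be i <= d)%N.
Proof. by rewrite inE/= => /eqP; rewrite (bigD1 i)//= => E; rewrite -[X in (_ <= X)%N]E leq_addr. Qed.

Lemma raiseE k (be : T) i : be \in lower_homog -> raise k be i = (be i + (i == k))%N :> nat.
Proof.
move=> bed; rewrite ffunE inordK// ltnS (leq_trans (leq_add (lower_homog_le i bed) (leq_b1 _)))//.
by rewrite addn1.
Qed.

Lemma lowerK k (al : T) : (0 < al k)%N -> raise k (lower k al) = al.
Proof.
move=> ak; apply/ffunP => i; apply: val_inj; rewrite ffunE/= lowerE.
have -> : (al i - (i == k) + (i == k))%N = al i.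
  by case: eqP => [->|_]; rewrite ?subnK// subn0 addn0.
by rewrite inordK.
Qed.

Lemma lower_in_homog k (al : T) : al \in @homog n d -> (0 < al k)%N -> lower k al \in lower_homog.
Proof.
move=> alm ak; rewrite inE/=; under eq_bigr do rewrite lowerE.
by rewrite (sum_lower alm ak).
Qed.

Lemma raise_in_homog k (be : T) : be \in lower_homog -> raise k be \in @homog n d.
Proof.
move=> bed; rewrite inE/=; under eq_bigr do rewrite raiseE//.
rewrite big_split/= (eqP bed) (bigD1 k)//= eqxx big1 => [|i /negbTE ->//].
by rewrite addn1.
Qed.

(** A monomial is its largest variable [k] times a monomial of degree [d] in the variables up to
    [k], and [raise] recombines the two. *)
Lemma sum_homog_le (f : T -> R) : (forall al, 0 <= f al) ->
  \sum_(al | al \in @homog n d) f al <=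
    \sum_(be | be \in lower_homog) \sum_(k | supp_le k be) f (raise k be).
Proof.
move=> f0.
apply: (@le_trans _ _ (\sum_k \sum_(al | (al \in @homog n d) && max_at k al) f al)).
  rewrite (exchange_big_dep (fun al => al \in @homog n d))/=; last by move=> k al _ /andP[].
  apply: ler_sum => al alm; have [k ak] : exists k, max_at k al.
    by apply: max_at_ex; move: alm; rewrite inE/= => /eqP ->.
  have akP : (al \in @homog n d) && max_at k al by apply/andP.
  by rewrite (bigD1 k akP)/= lerDl sumr_ge0.
rewrite [leRHS](exchange_big_dep xpredT)//=; apply: ler_sum => k _.
rewrite (reindex_onto (raise k) (lower k))/=; last by move=> al /andP[_ /andP[ak _]]; rewrite lowerK.
rewrite big_mkcond [leRHS]big_mkcond/=; apply: ler_sum => be _.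
case: ifPn => [|_]; last by case: ifP.
move=> /andP[/andP[rm /andP[rk /forallP h]] /eqP be_]; rewrite ifT//; apply/andP; split.
  by rewrite -be_ lower_in_homog.
apply/forallP => i; apply/implyP => ki; rewrite -be_ lowerE.
by have := h i; rewrite ki/= => /eqP ->.
Qed.

Variables (r : R) (r1 : 1 <= r) (a : T -> C).
Hypothesis Ha : forall z : 'I_n -> C, \sum_i normc (z i) `^ r <= 1 -> normc (hpoly a z) <= 1.

(* Evaluate the directional derivative at [q i / 4] times roots of unity, in a
   direction with moduli [u k / 4], and extract the coefficient of [be]. *)
Lemma dual_estimate (u q : 'I_n -> R) (be : T) :
  (forall i, 0 <= u i) -> \sum_i u i `^ r <= 1 ->
  (forall i, 0 <= q i) -> \sum_i q i `^ r <= 1 -> be \in lower_homog ->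
  \prod_i q i ^+ be i * \sum_(k | supp_le k be) u k * normc (a (raise k be)) <= 4 ^+ d.+1.
Proof.
move=> u0 u1 q0 q1 bed.
pose N := (2 ^ d.+2)%N; have [w prw] := prim_root_pow2 R d.+2.
have KN : (d.+2 < N)%N by rewrite ltn_expl.
(* The phases make all contributions to the coefficient of [be] nonnegative, and the zeros discard
   the [k] below the largest variable of [be]. *)
pose v (k : 'I_n) : C := if supp_le k be then (4^-1 * u k)%:C * phase (a (raise k be)) else 0.
have v1 k : normc (v k) <= 4^-1 * u k.
  rewrite /v; case: ifP => _; last by rewrite normc0 mulr_ge0.
  by rewrite normcM normc_phase normc_real mulr1 ger0_norm ?mulr_ge0.
pose P (t : 'I_n * T) := (t.2 \in @homog n d) && (0 < t.2 t.1)%N.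
pose e (t : 'I_n * T) (i : 'I_n) := (t.2 i - (i == t.1))%N.
pose A (t : 'I_n * T) : C := v t.1 * (a t.2 * (t.2 t.1)%:R) *
  \prod_i (4^-1 * q i)%:C ^+ (t.2 i - (i == t.1)).
have main : normc (\sum_(t | P t && [forall i, e t i == be i]) A t) <= 1.
  apply: (trigpoly_coef_le prw) => [t i Pt|i|g].
  - by rewrite /e (leq_ltn_trans (leq_subr _ _))// (ltn_trans _ KN).
  - by rewrite (ltn_trans _ KN).
  pose D := \sum_k v k * \sum_(al | (al \in @homog n d) && (0 < al k)%N)
     (a al * (al k)%:R) * \prod_i ((4^-1 * q i)%:C * w ^+ g i) ^+ (al i - (i == k)).
  have <- : D = trigpoly w P e A g.
    rewrite /D; under eq_bigr do rewrite mulr_sumr.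
    rewrite pair_big_dep/= /trigpoly; apply: eq_bigr => -[k al] /andP[/= alm ak].
    rewrite /A/= -!mulrA; congr (_ * (_ * (_ * _))); rewrite /chi/= -big_split/=.
    by apply: eq_bigr => i _; rewrite exprMn exprM.
  apply: (@derivative_sum_le _ _ _ a (fun i => (4^-1 * q i)%:C * w ^+ g i) v) => x x1.
  (* Coordinate [i] has modulus at most half the larger of [q i] and [u i]. As [r >= 1], its [r]-th
     power is at most half of [q i ^ r] or of [u i ^ r], and the total is at most 1. *)
  apply: Ha; apply: (@le_trans _ _ (\sum_i (2^-1 * q i `^ r + 2^-1 * u i `^ r))); last first.
    by rewrite big_split/= -!mulr_sumr; lra.
  apply: ler_sum => i _.
  have hr y : 0 <= y -> (2^-1 * y) `^ r <= 2^-1 * y `^ r.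
    move=> y0; rewrite powRM// ler_wpM2r ?powR_ge0// -[leRHS]powRr1//.
    by rewrite ger_powR// invr_gt0// invf_le1// ler1n ltr0n.
  have step y : 0 <= y -> normc ((4^-1 * q i)%:C * w ^+ g i + x * v i) <= 2^-1 * y ->
     normc ((4^-1 * q i)%:C * w ^+ g i + x * v i) `^ r <= 2^-1 * y `^ r.
    move=> y0 h; rewrite (le_trans _ (hr _ y0))// ge0_ler_powR ?nnegrE ?mulr_ge0 ?normc_ge0//.
    by rewrite (le_trans ler01).
  have tri : normc ((4^-1 * q i)%:C * w ^+ g i + x * v i) <= 4^-1 * q i + 4^-1 * u i.
    rewrite (le_trans (le_normcD _ _))// !normcM x1 mul1r normc_exp (normc_root prw) expr1n mulr1.
    by rewrite normc_real ger0_norm ?mulr_ge0// lerD2l.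
  have [qu|uq] := leP (q i) (u i).
    by rewrite (le_trans (step (u i) _ _))// ?lerDr ?mulr_ge0 ?powR_ge0//; lra.
  by rewrite (le_trans (step (q i) _ _))// ?lerDl ?mulr_ge0 ?powR_ge0//; lra.
have E : \sum_(t | P t && [forall i, e t i == be i]) A t =
    (4^-1 ^+ d.+1 * (\prod_i q i ^+ be i *
      \sum_(k | supp_le k be) u k * normc (a (raise k be)) * (be k).+1%:R))%:C.
  rewrite (reindex_onto (fun k => (k, raise k be)) fst)/=; last first.
    move=> [k al] /andP[/andP[/= alm ak] /forallP eal]; congr (_, _).
    rewrite -[RHS](lowerK ak); congr raise; apply/ffunP => i; apply: val_inj.
    by rewrite /= lowerE -(eqP (eal i)).
  rewrite (eq_bigl xpredT) => [|k]; last first.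
    rewrite eqxx andbT /P/= raise_in_homog// raiseE// eqxx addn1/=.
    by apply/forallP => i; rewrite /e/= raiseE// addnK.
  rewrite !mulr_sumr rmorph_sum/= [RHS]big_mkcond/=; apply: eq_bigr => k _.
  rewrite /A/= /v; case: ifPn => [_|_]; last by rewrite !mul0r.
  have -> : \prod_i (4^-1 * q i)%:C ^+ (raise k be i - (i == k)) =
      (4^-1 ^+ d * \prod_i q i ^+ be i)%:C.
    rewrite -[X in 4^-1 ^+ X](eqP bed) -prodrXr -big_split/= rmorph_prod.
    by apply: eq_bigr => i _; rewrite raiseE// addnK -exprMn [RHS]rmorphXn.
  rewrite raiseE// eqxx addn1; set b := a _; set Q := \prod_i _.
  transitivity ((4^-1 * u k)%:C * (phase b * b) * (be k).+1%:R * (4^-1 ^+ d * Q)%:C); first by ring.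
  rewrite phaseM -(rmorph_nat (real_complex R)) -!rmorphM; congr (_%:C).
  by rewrite exprS; ring.
move: main; rewrite E normc_real ger0_norm; last first.
  rewrite !mulr_ge0 ?exprn_ge0 ?invr_ge0// ?prodr_ge0// => [i _|]; first by rewrite exprn_ge0.
  by apply: sumr_ge0 => k _; rewrite !mulr_ge0 ?normc_ge0.
rewrite exprVn ler_pdivrMl ?exprn_gt0// mulr1; apply: le_trans.
rewrite ler_wpM2l ?prodr_ge0// => [i _|]; first by rewrite exprn_ge0.
apply: ler_sum => k _; rewrite ler_peMr ?mulr_ge0 ?normc_ge0//.
by rewrite ler1n.
Qed.
End DualEstimate.

Section TailBall.
Variable R : realType.
Local Notation C := R[i].

Lemma max_at_inj n M (al : {ffun 'I_n -> 'I_M}) k l : max_at k al -> max_at l al -> k = l.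
Proof.
move=> /andP[ak /forallP hk] /andP[bl /forallP hl]; apply: val_inj => /=.
case: (ltngtP k l) => // [kl|lk].
  by have := hk l; rewrite kl/= => /eqP l0; rewrite l0 in bl.
by have := hl k; rewrite lk/= => /eqP l0; rewrite l0 in ak.
Qed.

Lemma exprD_superadd (x y : R) n : 0 <= x -> 0 <= y -> x ^+ n.+1 + y ^+ n.+1 <= (x + y) ^+ n.+1.
Proof.
move=> x0 y0; elim: n => [|n IH]; first by rewrite !expr1.
rewrite [leRHS]exprS (le_trans _ (ler_wpM2l (addr_ge0 x0 y0) IH))//.
rewrite mulrDl !mulrDr -!exprS lerD// ?lerDl ?lerDr mulr_ge0 ?exprn_ge0//.
Qed.

Lemma young_le (p A B : R) : 1 < p -> 0 <= A -> 0 <= B ->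
  A * B <= A `^ p + B `^ (1 - p^-1)^-1.
Proof.
move=> p1 A0 B0; have p0 : 0 < p by rewrite (lt_trans ltr01).
have s0 : 0 < 1 - p^-1 by rewrite subr_gt0 invf_lt1.
have := @conjugate_powR _ A B p (1 - p^-1)^-1 A0 B0 p0.
rewrite invr_gt0 invrK => /(_ s0) h; apply: le_trans (h _) _; first by rewrite addrC subrK.
apply: lerD; last by rewrite ler_piMr ?powR_ge0// gerBl invr_ge0 ltW.
by rewrite ler_piMr ?powR_ge0// invf_le1// ltW.
Qed.

(** Since b! is at most [b ^ b], the sum is dominated by a product of exponential series, which is
    [exp (d * \sum_i x i)]. An exponent 0 contributes the factor 1, as the quotient by 0 is raised
    to the power 0. *)
Lemma sum_expn_div_le n d (x : 'I_n -> R) : (forall i, 0 <= x i) -> \sum_i x i <= 1 ->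
  \sum_(be : {ffun 'I_n -> 'I_d.+2}) \prod_i (d%:R * x i / (be i)%:R) ^+ be i <= expR 1 ^+ d.
Proof.
move=> x0 x1.
apply: (@le_trans _ _ (\prod_(i < n) \sum_(b < d.+2) (d%:R * x i) ^+ b / b`!%:R)).
  rewrite bigA_distr_bigA/=; apply: ler_sum => be _; apply: ler_prod => i _.
  rewrite exprn_ge0 ?divr_ge0 ?mulr_ge0//= expr_div_n ler_wpM2l ?exprn_ge0 ?mulr_ge0//.
  by rewrite -natrX lef_pV2 ?posrE ?ltr0n ?fact_gt0 ?expn_gt0 ?ler_nat ?leq_fact_expn//; case: (val (be i)).
apply: (@le_trans _ _ (\prod_(i < n) expR (d%:R * x i))).
  apply: ler_prod => i _; rewrite exp_partial_sum_le ?mulr_ge0// andbT.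
  by apply: sumr_ge0 => b _; rewrite divr_ge0 ?exprn_ge0 ?mulr_ge0.
by rewrite -expR_sum -mulr_sumr -expRM_natl mulr1 ler_expR ler_piMr.
Qed.

Variables (r : R) (r1 : 1 < r).
Let sg := 1 - r^-1.

(** Applied at [q be], the dual estimate leaves the sum over [be] of [mono be / Q be] times the
    weight of the largest variable [K] of [be]. Each term is a product [A be * B K be], where [A]
    carries [u] and the normalization [Q], and [B] carries the powers of the indices. Young's
    inequality with the conjugate exponents [r] and [sg^-1] separates them, and both sums grow at
    most exponentially in [d]. *)
Lemma ball_coef_sum_le n d (a : {ffun 'I_n -> 'I_d.+2} -> C) (u : 'I_n -> R) :
  (forall z : 'I_n -> C, \sum_i normc (z i) `^ r <= 1 -> normc (hpoly a z) <= 1) ->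
  (forall i, 0 <= u i) -> \sum_i u i `^ r <= 1 ->
  \sum_(al | al \in @homog n d) normc (a al) * \prod_(i < n) (i.+1%:R `^ (- sg) * u i) ^+ al i
    <= (4 * expR 1 + 16) ^+ d.+1.
Proof.
move=> Ha u0 u1.
have r0 : 0 < r by rewrite (lt_trans ltr01).
have sg0 : 0 < sg by rewrite subr_gt0 invf_lt1.
(* the point of the unit sphere that maximizes the monomial [be] *)
pose q (be : {ffun 'I_n -> 'I_d.+2}) (i : 'I_n) : R := ((be i)%:R / d%:R) `^ r^-1.
have q0 be i : 0 <= q be i by rewrite powR_ge0.
have qr be i : q be i `^ r = (be i)%:R / d%:R.
  by rewrite -powRrM mulVf ?gt_eqF// powRr1// divr_ge0.
have q1 be : be \in @lower_homog n d -> \sum_i q be i `^ r <= 1.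
  move=> /eqP bed; under eq_bigr do rewrite qr.
  rewrite -mulr_suml -natr_sum [X in X%:R / _]bed.
  by case: (d) => [|e]; rewrite ?mul0r// divff ?pnatr_eq0.
pose Q be := \prod_i q be i ^+ be i.
have Q0 be : be \in @lower_homog n d -> 0 < Q be.
  move=> bed; apply: prodr_gt0 => i _; case: (posnP (be i)) => [->//|bi].
  by rewrite exprn_gt0 ?powR_gt0 ?divr_gt0 ?ltr0n// (leq_trans bi)// lower_homog_le.
pose z (i : 'I_n) : R := i.+1%:R `^ (- sg) * u i.
have w1 i : i.+1%:R `^ (- sg) <= 1 :> R.
  by rewrite -[leRHS](powRr0 i.+1%:R) ler_powR ?ler1n// oppr_le0 ltW.
have z0 i : 0 <= z i by rewrite mulr_ge0 ?powR_ge0.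
pose mono (al : {ffun 'I_n -> 'I_d.+2}) := \prod_i z i ^+ al i.
have mono0 al : 0 <= mono al by apply: prodr_ge0 => i _; rewrite exprn_ge0.
apply: le_trans (sum_homog_le _) _ => [al|]; first exact: mulr_ge0 (normc_ge0 _) (mono0 _).
have stepf be k : be \in @lower_homog n d ->
  normc (a (raise k be)) * mono (raise k be) = mono be * (normc (a (raise k be)) * z k).
  move=> bed; rewrite mulrCA; congr (_ * _).
  have -> : mono (raise k be) = \prod_i z i ^+ be i * \prod_i z i ^+ (i == k).
    by rewrite /mono -big_split/=; apply: eq_bigr => i _; rewrite raiseE// exprD.
  congr (_ * _); rewrite (bigD1 k)//= eqxx expr1 big1 ?mulr1// => i /negbTE ->.
  by rewrite expr0.
have dual be : be \in @lower_homog n d ->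
    \sum_(k | supp_le k be) u k * normc (a (raise k be)) <= 4 ^+ d.+1 / Q be.
  by move=> bed; rewrite ler_pdivlMr ?Q0// mulrC (dual_estimate (ltW r1) Ha) ?q1.
(* For [d > 0] the constant [c] will be the weight at the largest variable of [be]: any [k]
   compatible with [be] is at least as large, so its weight is at most [c]. *)
have weight be (c : R) : be \in @lower_homog n d -> 0 <= c ->
    (forall k : 'I_n, supp_le k be -> k.+1%:R `^ (- sg) <= c) ->
    \sum_(k | supp_le k be) normc (a (raise k be)) * mono (raise k be) <=
    4 ^+ d.+1 * (mono be / Q be * c).
  move=> bed c0 hc; under eq_bigr do rewrite stepf//.
  rewrite -mulr_sumr mulrCA -!mulrA ler_wpM2l// mulrA mulrC mulrA.
  apply: (@le_trans _ _ (\sum_(k | supp_le k be) c * (u k * normc (a (raise k be))))).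
    apply: ler_sum => k kb; rewrite /z mulrCA ler_pM ?powR_ge0 ?mulr_ge0 ?normc_ge0 ?hc//.
    by rewrite mulrC.
  by rewrite -mulr_sumr -mulrA ler_wpM2l// [leRHS]mulrC dual.
have D0 : 0 <= expR 1 :> R by rewrite expR_ge0.
(* For [d = 0] the only [be] is zero. It has no largest variable, so the grouping by [max_at] starts
   at [d = 1]. *)
have [dE|dpos] := posnP d.
  have be0 be : be \in @lower_homog n d -> forall i, be i = 0%N :> nat.
    by move=> /lower_homog_le h i; apply/eqP; rewrite -leqn0 -dE.
  apply: (@le_trans _ _ (\sum_(be | be \in @lower_homog n d) 4 ^+ d.+1)).
    apply: ler_sum => be bed; rewrite (le_trans (weight be 1 bed ler01 (fun k _ => w1 k)))//.
    rewrite mulr1 /mono /Q !big1 ?divr1 ?mulr1// => i _; by rewrite be0// expr0.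
  rewrite sumr_const -[leLHS]mulr_natl -[leRHS]mul1r ler_pM ?exprn_ge0//.
    rewrite lern1; apply/card_le1_eqP => b1 b2 b1d b2d; apply/ffunP => i; apply: val_inj.
    by rewrite /= !be0.
  by rewrite lerXn2r ?nnegrE ?addr_ge0 ?mulr_ge0//; lra.
have conj := young_le r1.
pose A be := \prod_(i < n) (u i / q be i) ^+ be i.
pose B (K : 'I_n) (be : {ffun 'I_n -> 'I_d.+2}) := (\prod_(i < n) (i.+1%:R `^ (- sg)) ^+ be i) * K.+1%:R `^ (- sg).
have A0 be : 0 <= A be by apply: prodr_ge0 => i _; rewrite exprn_ge0 ?divr_ge0.
have B0 K be : 0 <= B K be by rewrite mulr_ge0 ?powR_ge0 ?prodr_ge0// => i _; rewrite exprn_ge0 ?powR_ge0.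
have Aexp : \sum_(be | be \in @lower_homog n d) A be `^ r <= expR 1 ^+ d.
  apply: le_trans (sum_expn_div_le d (fun i => powR_ge0 (u i) r) u1).
  rewrite big_mkcond; apply: ler_sum => be _; case: ifP => _; last first.
    by apply: prodr_ge0 => i _; rewrite exprn_ge0 ?divr_ge0 ?mulr_ge0 ?powR_ge0.
  rewrite powR_prod_exp => [|i]; last by rewrite divr_ge0.
  rewrite le_eqVlt; apply/orP; left; apply/eqP; apply: eq_bigr => i _; congr (_ ^+ _).
  have invq : (q be i)^-1 `^ r = (q be i `^ r)^-1.
    by rewrite -(powR_inv1 (q0 be i)) -powRrM mulN1r powRN.
  by rewrite powRM ?invr_ge0// invq qr invf_div mulrA [_ * d%:R]mulrC.
(* The power [sg^-1] turns every weight into 1/(i+1). The monomials with largest variable [K] then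
   give [4 ^+ d / sqrt (K + 1)], and the additional factor 1/(K+1) makes the sum over [K]
   bounded. *)
have Bsum : \sum_(K < n) \sum_(be | (be \in @lower_homog n d) && max_at K be) B K be `^ sg^-1 <= 4 ^+ d.+1.
  apply: (@le_trans _ _ (\sum_(K < n) 4 ^+ d * (K.+1%:R * Num.sqrt K.+1%:R)^-1)).
    apply: ler_sum => K _.
    have inv (k : nat) : ((k.+1%:R : R) `^ (- sg)) `^ sg^-1 = k.+1%:R^-1.
      by rewrite -powRrM mulNr divff ?gt_eqF// powR_inv1.
    rewrite (eq_bigr (fun be : {ffun 'I_n -> 'I_d.+2} => (\prod_(i < n) (i.+1%:R^-1 : R) ^+ be i) * K.+1%:R^-1)).
      rewrite -mulr_suml invfM mulrCA [leRHS]mulrC; rewrite ler_wpM2r ?invr_ge0//.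
      exact: sum_max_at_quarter.
    move=> be _; rewrite powRM ?powR_ge0//; last by apply: prodr_ge0 => i _; rewrite exprn_ge0 ?powR_ge0.
    rewrite inv powR_prod_exp => [|i]; last exact: powR_ge0.
    by congr (_ * _); apply: eq_bigr => i _; rewrite inv.
  rewrite -mulr_sumr exprSr ler_wpM2l ?exprn_ge0//.
  rewrite -(big_mkord xpredT (fun K => (K.+1%:R * Num.sqrt K.+1%:R : R)^-1)).
  by rewrite (le_trans (sum_three_halves_le _ _))// gerBl divr_ge0 ?sqrtr_ge0.
apply: (@le_trans _ _ (\sum_(K < n) \sum_(be | (be \in @lower_homog n d) && max_at K be)
    4 ^+ d.+1 * (A be `^ r + B K be `^ sg^-1))).
  rewrite [leRHS](exchange_big_dep (fun be => be \in @lower_homog n d))/=; last by move=> K be _ /andP[].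
  apply: ler_sum => be bed; have [K beK] : exists k, max_at k be.
    by apply: max_at_ex; rewrite (eqP (bed : is_true (_ == _))).
  have beKP : (be \in @lower_homog n d) && max_at K be by apply/andP.
  rewrite (bigD1 K beKP)/= (le_trans _ (_ : 4 ^+ d.+1 * (A be `^ r + B K be `^ sg^-1) <= _))//; last first.
    by rewrite lerDl sumr_ge0// => k _; rewrite mulr_ge0 ?exprn_ge0 ?addr_ge0 ?powR_ge0.
  rewrite (le_trans (weight be (K.+1%:R `^ (- sg)) bed _ _)) ?powR_ge0// => [k kb|]; last first.
    rewrite ler_wpM2l ?exprn_ge0// (le_trans _ (conj _ _ (A0 be) (B0 K be)))//.
    rewrite le_eqVlt; apply/orP; left; apply/eqP.
    rewrite /B mulrA; congr (_ * _); rewrite /mono /Q /A -prodfV -!big_split/=.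
    by apply: eq_bigr => i _; rewrite /z -exprVn -!exprMn [u i / _ * _]mulrC mulrA.
  have Kk : (K <= k)%N.
    rewrite leqNgt; apply/negP => kK; move/forallP/(_ K): kb; rewrite kK/= => /eqP bK.
    by move: beK => /andP[]; rewrite bK.
  rewrite !powRN lef_pV2 ?posrE ?powR_gt0 ?ltr0n// ge0_ler_powR ?nnegrE ?(ltW sg0)//.
  by rewrite ler_nat.
rewrite (eq_bigr (fun K => 4 ^+ d.+1 * \sum_(be | (be \in @lower_homog n d) && max_at K be) A be `^ r +
   4 ^+ d.+1 * \sum_(be | (be \in @lower_homog n d) && max_at K be) B K be `^ sg^-1)); last first.
  by move=> K _; rewrite -mulrDr -big_split/= mulr_sumr.
rewrite big_split/= -!mulr_sumr -mulrDr.
have AK : \sum_(K < n) \sum_(be | (be \in @lower_homog n d) && max_at K be) A be `^ r <= expR 1 ^+ d.+1.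
  apply: (@le_trans _ _ (expR 1 ^+ d)); last by rewrite exprS ler_peMl ?exprn_ge0// -expR0 ler_expR.
  apply: le_trans Aexp.
  rewrite (exchange_big_dep (fun be => be \in @lower_homog n d))/=; last by move=> K be _ /andP[].
  apply: ler_sum => be bed; case: (pickP (fun K : 'I_n => max_at K be)) => [K beK|none].
    rewrite (big_pred1 K)// => k; rewrite bed/=.
    by apply/idP/eqP => [kb|->//]; apply: max_at_inj kb beK.
  by rewrite big_pred0 ?powR_ge0// => K; rewrite none andbF.
apply: (@le_trans _ _ (4 ^+ d.+1 * (expR 1 ^+ d.+1 + 4 ^+ d.+1))).
  by rewrite ler_wpM2l ?exprn_ge0// lerD.
by rewrite mulrDr -!exprMn -natrM exprD_superadd// mulr_ge0.
Qed.
End TailBall.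

(** * Both ranges of [r] together, and rescaling *)

Section TailBound.
Variable R : realType.
Local Notation C := R[i].
Variables (r : R) (r1 : 1 < r).
Let sg := 1 - (Num.min r 2)^-1.

(** For [r > 2] the numbers [u i] are absorbed into the coefficients: if all [z i] have modulus at
    most 1, then [(u i * z i)_i] lies in the ball of l_r, so the new polynomial is bounded on the
    polydisc, where the weight is [i^(-1/2)]. *)
Lemma unit_tail_coef_sum_le : exists2 D : R, 0 < D & forall n m (a : {ffun 'I_n -> 'I_m.+1} -> C) (u : 'I_n -> R),
  (forall z : 'I_n -> C, \sum_i normc (z i) `^ r <= 1 ->
     normc (\sum_(al : {ffun 'I_n -> 'I_m.+1} | (\sum_i al i == m)%N) a al * \prod_i z i ^+ al i) <= 1) ->
  (forall i, 0 <= u i) -> \sum_i u i `^ r <= 1 ->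
  \sum_(al : {ffun 'I_n -> 'I_m.+1} | (\sum_i al i == m)%N)
     normc (a al) * \prod_(i < n) (i.+1%:R `^ (- sg) * u i) ^+ al i <= D ^+ m.
Proof.
have r0 : 0 < r by rewrite (lt_trans ltr01).
have e0 : 0 <= expR 1 :> R by rewrite expR_ge0.
exists (4 * expR 1 + 16) => [|n [|d] a u Ha u0 u1]; first by rewrite ltr_wpDl ?mulr_ge0.
  have z0 (al : {ffun 'I_n -> 'I_1}) i : al i = 0%N :> nat by rewrite ord1.
  have := Ha (fun=> 0); rewrite big1 => [/(_ ler01)|i _]; last first.
    by rewrite normc0 powR0// gt_eqF.
  apply: le_trans; rewrite (big_pred1 [ffun=> ord0]) => [|al]; last first.
    rewrite big1 ?eqxx//=; apply/esym/eqP/ffunP => i; by rewrite ffunE ord1.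
  rewrite (big_pred1 [ffun=> ord0]) => [|al]; last first.
    rewrite big1 ?eqxx//=; apply/esym/eqP/ffunP => i; by rewrite ffunE ord1.
  by rewrite !big1 ?mulr1// => i _; rewrite z0 expr0.
have [r2|r2] := leP r 2.
  rewrite /sg min_l//; exact: ball_coef_sum_le.
have sgE i : i.+1%:R `^ (- sg) = Num.sqrt i.+1%:R^-1 :> R.
  rewrite /sg min_r ?(ltW r2)// (_ : - _ = -1 * 2^-1); last by field.
  by rewrite powRrM powR_inv1// powR12_sqrt// invr_ge0.
pose a' al : C := a al * (\prod_i u i ^+ al i)%:C.
have := @polydisc_coef_sum_le R n d a'.
rewrite /hpoly => H; apply: le_trans (_ : _ <= 8 ^+ d.+1) _; last first.
  by rewrite lerXn2r ?nnegrE ?addr_ge0 ?mulr_ge0//; lra.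
apply: le_trans (H _).
  apply: ler_sum => al _; rewrite /a' normcM normc_real ger0_norm; last first.
    by apply: prodr_ge0 => i _; rewrite exprn_ge0.
  rewrite -mulrA ler_wpM2l ?normc_ge0// -big_split/= le_eqVlt; apply/orP; left; apply/eqP.
  by apply: eq_bigr => i _; rewrite sgE exprMn mulrC.
move=> z z1; have := Ha (fun i => (u i)%:C * z i).
have -> : \sum_(al : {ffun 'I_n -> 'I_d.+2} | (\sum_i al i == d.+1)%N) a al * \prod_i ((u i)%:C * z i) ^+ al i =
    \sum_(al | al \in @homog n d) a' al * \prod_i z i ^+ al i.
  apply: eq_bigr => al _; rewrite /a' -mulrA; congr (_ * _).
  rewrite rmorph_prod -big_split/=; apply: eq_bigr => i _.
  by rewrite exprMn rmorphXn.
apply; apply: le_trans u1; apply: ler_sum => i _.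
rewrite normcM normc_real ger0_norm// powRM ?normc_ge0// ler_piMr ?powR_ge0//.
have p1 : (1 : R) `^ r = 1 by rewrite powR1.
by rewrite -[leRHS]p1 ge0_ler_powR ?nnegrE ?normc_ge0 ?(ltW r0).
Qed.

Definition tail_coef_bound (D : R) : Prop :=
  forall n m (a : {ffun 'I_n -> 'I_m.+1} -> C) (u : 'I_n -> R) (rho B : R),
  0 < rho -> 0 < B ->
  (forall z : 'I_n -> C, \sum_i normc (z i) `^ r <= rho `^ r ->
     normc (\sum_(al : {ffun 'I_n -> 'I_m.+1} | (\sum_i al i == m)%N) a al * \prod_i z i ^+ al i) <= B) ->
  (forall i, 0 <= u i) -> \sum_i u i `^ r <= (rho / D) `^ r ->
  \sum_(al : {ffun 'I_n -> 'I_m.+1} | (\sum_i al i == m)%N)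
     normc (a al) * \prod_(i < n) (i.+1%:R `^ (- sg) * u i) ^+ al i <= B * 2^-1 ^+ m.

(** By homogeneity, shrinking [u] to [rho / (2 * D)], with [D] the constant for the unit ball,
    trades the growth [D ^+ m] for the decay [2^-1 ^+ m], which can be summed over the degrees. *)
Lemma tail_coef_sum_le : exists2 D : R, 0 < D & tail_coef_bound D.
Proof.
have r0 : 0 < r by rewrite (lt_trans ltr01).
have [D D0 HD] := unit_tail_coef_sum_le.
exists (2 * D) => [|n m a u rho B rho0 B0 Ha u0 u1]; first by rewrite mulr_gt0.
pose t := rho / (2 * D); have t0 : 0 < t by rewrite divr_gt0// mulr_gt0.
pose c := rho ^+ m / B; have c0 : 0 < c by rewrite divr_gt0// exprn_gt0.
pose a' al : C := a al * c%:C.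
have hom (K : comNzRingType) (x : K) (y : 'I_n -> K) (al : {ffun 'I_n -> 'I_m.+1}) : (\sum_i al i == m)%N ->
    \prod_i (x * y i) ^+ al i = x ^+ m * \prod_i y i ^+ al i.
  move=> /eqP alm; rewrite -[X in x ^+ X]alm -prodrXr -big_split/=.
  by apply: eq_bigr => i _; rewrite exprMn.
have := HD n m a' (fun i => t^-1 * u i).
have -> : \sum_(al : {ffun 'I_n -> 'I_m.+1} | (\sum_i al i == m)%N)
     normc (a' al) * \prod_(i < n) (i.+1%:R `^ (- sg) * (t^-1 * u i)) ^+ al i =
  (c / t ^+ m) * \sum_(al : {ffun 'I_n -> 'I_m.+1} | (\sum_i al i == m)%N)
     normc (a al) * \prod_(i < n) (i.+1%:R `^ (- sg) * u i) ^+ al i.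
  rewrite mulr_sumr; apply: eq_bigr => al alm.
  rewrite /a' normcM normc_real (ger0_norm (ltW c0)).
  under eq_bigr do rewrite mulrCA.
  by rewrite hom// exprVn; ring.
set S := \sum_(al : {ffun 'I_n -> 'I_m.+1} | _) _ => H.
have {H} : c / t ^+ m * S <= D ^+ m.
  apply: H => [z z1|i|].
  - have -> : \sum_(al : {ffun 'I_n -> 'I_m.+1} | (\sum_i al i == m)%N) a' al * \prod_i z i ^+ al i =
      (B^-1)%:C * \sum_(al : {ffun 'I_n -> 'I_m.+1} | (\sum_i al i == m)%N) a al * \prod_i (rho%:C * z i) ^+ al i.
      rewrite mulr_sumr; apply: eq_bigr => al alm.
      by rewrite hom// /a' /c rmorphM rmorphXn/=; ring.
    rewrite normcM normc_real ger0_norm ?invr_ge0 ?(ltW B0)// ler_pdivrMl// mulr1 Ha//.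
    rewrite (eq_bigr (fun i => rho `^ r * normc (z i) `^ r)) => [|i _].
      by rewrite -mulr_sumr ler_piMr ?powR_ge0.
    by rewrite normcM normc_real gtr0_norm// powRM ?normc_ge0// ltW.
  - by rewrite mulr_ge0 ?invr_ge0 ?(ltW t0).
  rewrite (eq_bigr (fun i => t^-1 `^ r * u i `^ r)) => [|i _]; last first.
    by rewrite powRM ?invr_ge0 ?(ltW t0).
  rewrite -mulr_sumr (le_trans (ler_wpM2l _ u1)) ?powR_ge0// -/t -powRM ?invr_ge0 ?(ltW t0)//.
  by rewrite mulVf ?powR1// gt_eqF.
rewrite -ler_pdivlMl ?divr_gt0 ?exprn_gt0// => /le_trans; apply.
rewrite le_eqVlt; apply/orP; left; apply/eqP.
rewrite /c /t expr_div_n exprMn exprVn; field.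
by rewrite !gt_eqF// !exprn_gt0.
Qed.

End TailBound.

(** * Monomial expansions on the ball *)

Section EllBall.
Variables (R : realType) (r : R) (r1 : 1 <= r).
Local Notation C := R[i].
Let r0 : 0 < r. Proof. exact: lt_le_trans ltr01 r1. Qed.

Definition nrm (x : ell r1) : R := complex.Re `|x|.

Lemma normr_nrm x : `|x| = (nrm x)%:C.
Proof. by []. Qed.

Lemma nrm_ge0 x : 0 <= nrm x.
Proof. by have := normr_ge0 x; rewrite normr_nrm lecR. Qed.

Lemma nrm_sum_le (z : ell r1) n : \sum_(0 <= k < n) normc (z k) `^ r <= nrm z `^ r.
Proof.
pose S : \bar R := (\sum_(0 <= k <oo) (normc (z k) `^ r)%:E)%E.
have t0 k : (0 <= (normc (z k) `^ r)%:E)%E by rewrite lee_fin powR_ge0.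
have S0 : (0 <= S)%E by apply: nneseries_ge0 => k _ _.
have fin := ell_norm_fin z; rewrite ell_normE// -/S in fin.
have Sfin : (S < +oo)%E.
  move: fin; case: (S) S0 => [s|//|//] _; first by rewrite ltry.
  by rewrite poweRyr ?gt_eqF ?invr_gt0.
have SE : S = (fine S)%:E by rewrite fineK// ge0_fin_numE.
have -> : nrm z `^ r = fine S.
  have f0 : 0 <= fine S by rewrite fine_ge0.
  by rewrite /nrm normr_ellE /= -/S SE /= -powRrM mulVf ?gt_eqF// powRr1.
rewrite -lee_fin -SE -sumEFin; apply: nneseries_lim_ge => k _ _; exact: t0.
Qed.

Lemma ball_sum_le (z : ell r1) : unit_ball r1 z ->
  exists2 s, 0 <= s < 1 & forall n, \sum_(0 <= k < n) normc (z k) `^ r <= s.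
Proof.
rewrite /unit_ball/= normr_nrm ltcR => z1; exists (nrm z `^ r); last exact: nrm_sum_le.
have p1 : (1 : R) `^ r = 1 by rewrite powR1.
by rewrite powR_ge0/= -[ltRHS]p1 gt0_ltr_powR// nnegrE ?nrm_ge0.
Qed.

Lemma ball_of_sum_le (x : nat -> C) s : s < 1 ->
  (forall n, \sum_(0 <= k < n) normc (x k) `^ r <= s) ->
  exists2 z : ell r1, ell_val z = x & unit_ball r1 z.
Proof.
move=> s1 xs; pose S : \bar R := (\sum_(0 <= k <oo) (normc (x k) `^ r)%:E)%E.
have t0 k : (0 <= (normc (x k) `^ r)%:E)%E by rewrite lee_fin powR_ge0.
have S0 : (0 <= S)%E by apply: nneseries_ge0 => k _ _.
have Ss : (S <= s%:E)%E.
  by apply: lime_le; [exact: is_cvg_nneseries|apply: nearW => n; rewrite sumEFin lee_fin xs].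
have SE : S = (fine S)%:E by rewrite fineK// ge0_fin_numE// (le_lt_trans Ss)// ltry.
have xin : x \in ell_pred r1.
  by rewrite inE/= ell_normE// -/S SE poweR_EFin ltry.
exists (Ell xin) => //; rewrite /unit_ball/= normr_ellE/= -/S SE /= -[1]/(1%:C) ltcR.
have f0 : 0 <= fine S by rewrite fine_ge0.
have p1 : (1 : R) `^ r^-1 = 1 by rewrite powR1.
rewrite -[ltRHS]p1 gt0_ltr_powR ?invr_gt0// ?nnegrE//.
by rewrite -lte_fin -SE (le_lt_trans Ss)// lte_fin.
Qed.

End EllBall.

Section CoefficientExtraction.
Variables (R : realType) (r : R) (r1 : 1 <= r).
Local Notation C := R[i].

Lemma monomialE (z : nat -> C) (a : multi_index) n : (forall k, (n <= k)%N -> a k = 0%N) ->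
  monomial z a = \prod_(0 <= k < n) z k ^+ a k.
Proof.
move=> an; rewrite /monomial (perm_big [seq k <- index_iota 0 n | a k != 0%N]); last first.
  apply: uniq_perm; rewrite ?filter_uniq ?iota_uniq ?fset_uniq// => k.
  rewrite mem_finsupp mem_filter mem_index_iota/= andb_idr// => ak.
  by rewrite ltnNge; apply: contraNN ak => /an ->.
rewrite big_filter big_mkcond; apply: eq_bigr => k _.
by case: eqVneq => // ->.
Qed.

(** Coordinates in one class are rotated by the same root of unity, so averaging sees only the total
    exponent in each class. *)
Definition class_degree L (pi : nat -> 'I_L) (a : multi_index) (l : 'I_L) : nat :=
  (\sum_(k <- finsupp a | pi k == l) a k)%N.

Lemma monomial_twist L (pi : nat -> 'I_L) N w (g : {ffun 'I_L -> 'I_N}) (z z' : nat -> C) a :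
  (forall i, z' i = w ^+ g (pi i) * z i) ->
  monomial z' a = chi w g (class_degree pi a) * monomial z a.
Proof.
move=> z'E; rewrite /monomial (eq_bigr (fun k => w ^+ (g (pi k) * a k) * z k ^+ a k)) => [|k _]; last first.
  by rewrite z'E exprMn exprM.
rewrite big_split/=; congr (_ * _); rewrite (partition_big pi xpredT)//=.
rewrite /chi; apply: eq_bigr => l _; rewrite /class_degree big_distrr/= -prodrXr.
by apply: eq_bigr => k /eqP ->.
Qed.

Lemma expansion_approx (f : ell r1 -> C) c (z : ell r1) (e : R) :
  monomial_expansion f c -> unit_ball r1 z -> finite_set [set k | z k != 0] -> 0 < e ->
  exists A0 : {fset multi_index}, forall A : {fset multi_index}, (A0 `<=` A)%fset ->
    normc (f z - \sum_(a <- A) c a * monomial z a) < e.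
Proof.
move=> fc z1 zfin e0; have := fc z z1 zfin.
have e0' : 0 < e%:C by rewrite ltcR.
have tF : Filter (@summability.totally multi_index) by exact: summability.totally_filter.
move=> /(@cvgrPdist_lt _ _ _ _ tF) /(_ _ e0') [A0 _ H]; exists A0 => A A0A.
have := H A A0A; rewrite /summability.partial_sum /=.
by rewrite big_seq_fsetE/= -ltcR.
Qed.

Lemma twist_ex (z : ell r1) (v : nat -> C) : (forall i, normc (v i) = 1) -> unit_ball r1 z ->
  exists2 z' : ell r1, unit_ball r1 z' & forall i, z' i = v i * z i.
Proof.
move=> v1 z1; have [s /andP[_ s1] zs] := ball_sum_le z1.
have [|z' z'E z'1] := @ball_of_sum_le R r r1 (fun i => v i * z i) s s1.
  by move=> n; under eq_bigr do rewrite normcM v1 mul1r.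
by exists z' => // i; rewrite z'E.
Qed.

(** The expansion is only known as a limit of a net, so an infinite sum is never rearranged. All
    twisted values [f (Z g)] are approximated by sums over one finite set [A]; averaging keeps the
    monomials of [A] whose class degrees agree with [b] modulo [N]. For large [N] the unwanted ones
    among them avoid [A0], and by the Cauchy criterion their sum is small. *)
Lemma expansion_average (f : ell r1 -> C) c (z : ell r1) L (pi : nat -> 'I_L) (b : 'I_L -> nat)
    (S : {fset multi_index}) (e : R) :
  monomial_expansion f c -> unit_ball r1 z -> finite_set [set k | z k != 0] ->
  (forall a, monomial z a != 0 -> (a \in S) = [forall l, class_degree pi a l == b l]) ->
  0 < e ->
  exists K0, forall K w (Z : {ffun 'I_L -> 'I_(2 ^ K)} -> ell r1), (K0 <= K)%N ->
    (2 ^ K).-primitive_root w ->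
    (forall g, unit_ball r1 (Z g)) -> (forall g i, Z g i = w ^+ g (pi i) * z i) ->
    normc (\sum_(a <- S) c a * monomial z a -
      ((2 ^ K) ^ L)%:R^-1 * \sum_g f (Z g) * chi w^-1 g b) <= e.
Proof.
move=> fc z1 zfin HS e0; have e40 : 0 < e / 4 by rewrite divr_gt0.
have [A0 HA0] := expansion_approx fc z1 zfin e40.
pose x a := c a * monomial z a.
(* The sum over [D] is the difference of the partial sums over the union of [D] and [A0] and over
   [A0], both close to [f z]. *)
have small (D : {fset multi_index}) : [disjoint D & A0]%fset -> normc (\sum_(a <- D) x a) <= e / 2.
  move=> DA0; have h1 := HA0 (D `|` A0)%fset (fsubsetUr _ _); have h0 := HA0 A0 (fsubset_refl _).
  have -> : \sum_(a <- D) x a = (f z - \sum_(a <- A0) x a) + - (f z - \sum_(a <- (D `|` A0)%fset) x a).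
    have -> : \sum_(a <- (D `|` A0)%fset) x a = \sum_(a <- D) x a + \sum_(a <- A0) x a.
      rewrite -big_cat/=; apply: perm_big; apply: uniq_perm; rewrite ?fset_uniq//.
        rewrite cat_uniq !fset_uniq/= andbT; apply/hasPn => a aA0; apply/negP => aD.
        by move/fdisjointP: DA0 => /(_ a aD); rewrite aA0.
      by move=> a; rewrite mem_cat in_fsetU.
    by ring.
  rewrite (le_trans (le_normcD _ _))// normcN.
  by rewrite (_ : e / 2 = e / 4 + e / 4) ?lerD ?ltW//; lra.
(* Above [K0] the order [N] exceeds every [b l] and all class degrees in [A0], so that for indices
   in [A0] congruence modulo [N] is equality. *)
pose K0 := ((\sum_(a <- A0) \sum_l class_degree pi a l) + \sum_l b l)%N.
exists K0 => K w Z KK0 prw Z1 ZE; set N := (2 ^ K)%N.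
have N0 : (0 < N)%N by rewrite expn_gt0.
have KN : (K0 < N)%N by rewrite (leq_ltn_trans KK0)// ltn_expl.
have bN l : (b l < N)%N.
  by rewrite (leq_ltn_trans _ KN)// /K0 (bigD1 l)//= addnCA leq_addr.
have dN a l : a \in A0 -> (class_degree pi a l < N)%N.
  move=> aA; rewrite (leq_ltn_trans _ KN)// /K0 (big_fsetD1 a)//= (bigD1 l)//= -!addnA.
  by rewrite leq_addr.
have Zfin g : finite_set [set k | Z g k != 0].
  apply: sub_finite_set zfin => k /=; rewrite ZE; apply: contraNN => /eqP ->.
  by rewrite mulr0.
have /choice [Ag HAg] g := expansion_approx fc (Z1 g) (Zfin g) e40.
pose A := (A0 `|` S `|` \bigcup_(g <- index_enum {ffun 'I_L -> 'I_(2 ^ K)}) Ag g)%fset.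
have A0A : (A0 `<=` A)%fset by rewrite /A -fsetUA fsubsetUl.
have SA : (S `<=` A)%fset by rewrite /A fsetUAC fsubsetUr.
have AgA g : (Ag g `<=` A)%fset.
  by rewrite (fsubset_trans _ (fsubsetUr _ _))// bigfcup_sup// mem_index_enum.
have NI : 0 < ((N ^ L)%:R : R) by rewrite ltr0n expn_gt0 N0.
have nNI : normc ((N ^ L)%:R^-1 : C) = (N ^ L)%:R^-1.
  by rewrite normcV -(rmorph_nat (real_complex R)) normc_real normr_nat.
pose P a := [forall l, class_degree pi a l == b l %[mod N]].
have avg : (N ^ L)%:R^-1 * \sum_g (\sum_(a <- A) c a * monomial (Z g) a) * chi w^-1 g b =
    \sum_(a <- A | P a) x a.
  under eq_bigr do rewrite mulr_suml.
  rewrite exchange_big/= mulr_sumr [RHS]big_mkcond/=; apply: eq_bigr => a _.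
  under eq_bigr => g _.
    rewrite (monomial_twist _ (ZE g)) [_ * monomial z a]mulrC mulrA -mulrA; over.
  rewrite -mulr_sumr (sum_chi prw) card_ord -/N -/(P a); case: ifP => _; last by rewrite !mulr0.
  by rewrite mulrC mulfK// pnatr_eq0 expn_eq0 negb_and -lt0n N0.
pose D := [fset a in A | [&& P a, a \notin S & monomial z a != 0]]%fset.
have split_sum : \sum_(a <- S) x a = \sum_(a <- A | P a) x a - \sum_(a <- D) x a.
  have -> : \sum_(a <- S) x a = \sum_(a <- A) (if a \in S then x a else 0).
    rewrite -(big_fset_incl _ SA) => [|a _ /negbTE ->//].
    by rewrite [LHS]big_seq [RHS]big_seq; apply: eq_bigr => a ->.
  have -> : \sum_(a <- D) x a = \sum_(a <- A) (if [&& P a, a \notin S & monomial z a != 0] then x a else 0).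
    by rewrite /D -big_fset_condE [LHS]big_mkcond.
  rewrite [X in _ = X - _]big_mkcond/= -sumrB.
  apply: eq_bigr => a _; have [m0|m0] := eqVneq (monomial z a) 0.
    by rewrite /x m0 mulr0 !if_same subrr.
  rewrite andbT HS//; have [/forallP ab|] := boolP [forall l, class_degree pi a l == b l].
    by rewrite andbF subr0 ifT//; apply/forallP => l; rewrite (eqP (ab l)).
  by rewrite andbT; case: ifP; rewrite subrr.
have DA0 : [disjoint D & A0]%fset.
  apply/fdisjointP => a; rewrite !inE => /andP[_ /and3P[/forallP Pa aS m0]].
  apply: contra aS => aA0; rewrite HS//; apply/forallP => l.
  by have := Pa l; rewrite !modn_small ?dN.
rewrite split_sum -avg addrAC (le_trans (le_normcD _ _))// normcN.
rewrite (_ : e = e / 2 + e / 2); last by lra.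
rewrite lerD ?small// -mulrBr -sumrB normcM nNI ler_pdivrMl//.
rewrite (le_trans (normc_sum _ _ _))//.
apply: (@le_trans _ _ (\sum_(g : {ffun 'I_L -> 'I_(2 ^ K)}) e / 2)); last first.
  by rewrite sumr_const card_ffun !card_ord -[leLHS]mulr_natl.
apply: ler_sum => g _; rewrite -mulrBl normcM.
have -> : normc (chi w^-1 g b) = 1.
  by rewrite normc_prod big1// => i _; rewrite normc_exp normcV (normc_root prw) invr1 expr1n.
rewrite mulr1 -normcN opprB; have := HAg g A (AgA g); lra.
Qed.

Lemma expansion_sum_le (f : ell r1 -> C) c (z : ell r1) L (pi : nat -> 'I_L) (b : 'I_L -> nat)
    (S : {fset multi_index}) B :
  monomial_expansion f c -> unit_ball r1 z -> finite_set [set k | z k != 0] ->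
  (forall a, monomial z a != 0 -> (a \in S) = [forall l, class_degree pi a l == b l]) ->
  (forall z', unit_ball r1 z' -> normc (f z') <= B) ->
  normc (\sum_(a <- S) c a * monomial z a) <= B.
Proof.
move=> fc z1 zfin HS fB; apply/ler_addgt0Pr => e e0.
have [K0 HK] := expansion_average fc z1 zfin HS e0.
have [w prw] := prim_root_pow2 R K0.
have /choice [Z HZ] : forall g : {ffun 'I_L -> 'I_(2 ^ K0)}, exists z' : ell r1,
    unit_ball r1 z' /\ forall i, z' i = w ^+ g (pi i) * z i.
  move=> g; have [i|z' ? ?] := @twist_ex z (fun i => w ^+ g (pi i)) _ z1; last by exists z'.
  by rewrite normc_exp (normc_root prw) expr1n.
have := HK K0 w Z (leqnn _) prw (fun g => (HZ g).1) (fun g => (HZ g).2).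
set S1 := \sum_(a <- S) _; set avg := (X in S1 - X) => h.
rewrite -[S1](subrK avg) (le_trans (le_normcD _ _))// addrC lerD//.
rewrite /avg normcM normcV -(rmorph_nat (real_complex R)) normc_real normr_nat.
rewrite ler_pdivrMl ?ltr0n ?expn_gt0// (le_trans (normc_sum _ _ _))//.
apply: (@le_trans _ _ (\sum_(g : {ffun 'I_L -> 'I_(2 ^ K0)}) B)); last first.
  by rewrite sumr_const card_ffun !card_ord -[leLHS]mulr_natl.
apply: ler_sum => g _; rewrite normcM normc_prod big1 ?mulr1 => [|i _].
  exact: fB (HZ g).1.
by rewrite normc_exp normcV (normc_root prw) invr1 expr1n.
Qed.

(** Each coordinate below [n] gets its own class and class [n] collects the coordinates where [z]
    vanishes. Then [c a * monomial z a] and [c' a * monomial z a] are approximated by the same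
    averages of [f], and [monomial z a] is nonzero. *)
Lemma expansion_unique (f : ell r1 -> C) c c' (z : ell r1) n (a : multi_index) :
  monomial_expansion f c -> monomial_expansion f c' -> unit_ball r1 z ->
  (forall k, (z k != 0) = (k < n)%N) -> (forall k, (n <= k)%N -> a k = 0%N) -> c a = c' a.
Proof.
move=> fc fc' z1 zn an; have zfin : finite_set [set k | z k != 0].
  by apply: (@sub_finite_set _ _ `I_n) => // k /=; rewrite zn.
have mz (a' : multi_index) : monomial z a' != 0 -> forall k, (n <= k)%N -> a' k = 0%N.
  move=> m0 k nk; apply: contraNeq m0 => ak; rewrite prodf_seq_eq0.
  apply/hasP; exists k; first by rewrite mem_finsupp.
  by rewrite /= expf_eq0 lt0n ak; apply: contraLR nk; rewrite zn -ltnNge.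
pose pi (k : nat) : 'I_n.+1 := inord (minn k n).
have cd (a' : multi_index) l : (forall k, (n <= k)%N -> a' k = 0%N) ->
    class_degree pi a' l = a' l.
  move=> an'; rewrite /class_degree big_seq_cond.
  rewrite (eq_bigl (fun k => (k \in finsupp a') && (k == l :> nat))) => [|k]; last first.
    case: (boolP (k \in finsupp a')) => //=; rewrite mem_finsupp => ak.
    have kn : (k < n)%N by rewrite ltnNge; apply: contraNN ak => /an' ->.
    by rewrite -val_eqE/= /pi inordK ?ltnS ?geq_minr// (minn_idPl (ltnW kn)).
  rewrite -big_seq_cond; case: (boolP (val l \in finsupp a')) => la.
    rewrite big_mkcond (bigD1_seq (val l) la (fset_uniq _))/= ifT; last exact: eqxx.
    by rewrite big1 ?addn0// => k /negbTE kl; rewrite ifF.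
  rewrite big_seq_cond big_pred0 => [|k].
    by move: la; rewrite mem_finsupp negbK => /eqP.
  by apply/negbTE; rewrite negb_and; case: eqP => [->|_]; rewrite ?la ?orbT.
have HS a' : monomial z a' != 0 -> (a' \in [fset a]%fset) = [forall l, class_degree pi a' l == a l].
  move=> /mz an'; rewrite inE; apply/eqP/forallP => [-> l|h]; first by rewrite cd.
  apply/fsfunP => k; case: (ltnP k n) => kn; last by rewrite an// an'.
  have kn1 : (k < n.+1)%N by rewrite (ltn_trans kn).
  by have := h (Ordinal kn1); rewrite cd//= => /eqP.
have m0 : monomial z a != 0.
  rewrite prodf_seq_neq0; apply/allP => k; rewrite mem_finsupp => ak; apply/implyP => _.
  rewrite expf_neq0// zn ltnNge; apply: contraNN ak => /an ->//.
apply: (mulIf m0); apply/eqP; rewrite -subr_eq0; apply/eqP; apply: eq0_normc.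
apply/eqP; rewrite eq_le normc_ge0 andbT; apply/ler_addgt0Pr => e e0; rewrite add0r.
have e20 : 0 < e / 2 by rewrite divr_gt0.
have [K1 H1] := expansion_average fc z1 zfin HS e20.
have [K2 H2] := expansion_average fc' z1 zfin HS e20.
pose K0 := maxn K1 K2.
have [w prw] := prim_root_pow2 R K0.
have /choice [Z HZ] : forall g : {ffun 'I_n.+1 -> 'I_(2 ^ K0)}, exists z' : ell r1,
    unit_ball r1 z' /\ forall i, z' i = w ^+ g (pi i) * z i.
  move=> g; have [i|z' ? ?] := @twist_ex z (fun i => w ^+ g (pi i)) _ z1; last by exists z'.
  by rewrite normc_exp (normc_root prw) expr1n.
have := H1 K0 w Z (leq_maxl _ _) prw (fun g => (HZ g).1) (fun g => (HZ g).2).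
have := H2 K0 w Z (leq_maxr _ _) prw (fun g => (HZ g).1) (fun g => (HZ g).2).
rewrite !big_seq_fset1; set avg := (X in _ - X) => h2 h1.
rewrite (_ : _ - _ = (c a * monomial z a - avg) + - (c' a * monomial z a - avg)); last by ring.
by rewrite (le_trans (le_normcD _ _))// normcN; lra.
Qed.

End CoefficientExtraction.

(** * Separating finitely many head variables *)

Section HeadTail.
Variables (R : realType) (r : R) (r1 : 1 < r).
Local Notation C := R[i].
Local Notation sg := (1 - (Num.min r 2)^-1).

Definition index_of (h : nat -> nat) (n : nat) : multi_index :=
  [fsfun k in [fset k | k in iota 0 n]%fset => h k].

Lemma index_ofE h n k : index_of h n k = if (k < n)%N then h k else 0%N.
Proof. by rewrite fsfunE !inE/= mem_iota/= add0n. Qed.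

Lemma sum_finsupp (a : multi_index) (P : pred nat) n : (forall k, (n <= k)%N -> a k = 0%N) ->
  (\sum_(k <- finsupp a | P k) a k = \sum_(0 <= k < n | P k) a k)%N.
Proof.
move=> an; rewrite (perm_big [seq k <- index_iota 0 n | a k != 0%N]); last first.
  apply: uniq_perm; rewrite ?filter_uniq ?iota_uniq ?fset_uniq// => k.
  rewrite mem_finsupp mem_filter mem_index_iota/= andb_idr// => ak.
  by rewrite ltnNge; apply: contraNN ak => /an ->.
rewrite big_filter_cond big_mkcond [RHS]big_mkcond; apply: eq_bigr => k _ /=.
by case: eqVneq => [->|_] //; case: ifP.
Qed.

Definition natfun n M (g : {ffun 'I_n -> 'I_M}) (j : nat) : nat := oapp (fun i => g i : nat) 0%N (insub j).

Lemma natfunE n M (g : {ffun 'I_n -> 'I_M}) (i : 'I_n) : natfun g i = g i.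
Proof. by rewrite /natfun valK. Qed.

Definition glue N0 n (be ga : nat -> nat) : multi_index :=
  index_of (fun k => if (k < N0)%N then be k else ga (k - N0)%N) (N0 + n).

Lemma glue_head N0 n be ga k : (k < N0)%N -> glue N0 n be ga k = be k.
Proof. by move=> kN; rewrite index_ofE kN ltn_addr. Qed.

Lemma glue_tail N0 n be ga k : (k < n)%N -> glue N0 n be ga (N0 + k)%N = ga k.
Proof. by move=> kn; rewrite index_ofE ltn_add2l kn ltnNge leq_addr/= addKn. Qed.

Lemma glue_out N0 n be ga k : (N0 + n <= k)%N -> glue N0 n be ga k = 0%N.
Proof. by move=> kn; rewrite index_ofE ltnNge kn. Qed.

Lemma prod_head_tail (K : comPzRingType) N0 n (x : nat -> K) (a : nat -> nat) :
  \prod_(0 <= k < N0 + n) x k ^+ a k =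
  \prod_(k < N0) x k ^+ a k * \prod_(i < n) x (N0 + i)%N ^+ a (N0 + i)%N.
Proof.
rewrite (@big_cat_nat _ _ _ N0)//= ?leq_addr// big_mkord; congr (_ * _).
rewrite -{1}[N0]add0n big_addn addKn big_mkord.
by apply: eq_bigr => i _; rewrite addnC.
Qed.

Lemma monomial_glue N0 n (z : nat -> C) be ga :
  monomial z (glue N0 n be ga) = \prod_(k < N0) z k ^+ be k * \prod_(i < n) z (N0 + i)%N ^+ ga i.
Proof.
rewrite (@monomialE _ _ _ (N0 + n)) ?prod_head_tail => [|k]; last exact: glue_out.
congr (_ * _); apply: eq_bigr => k _; first by rewrite glue_head.
by rewrite glue_tail.
Qed.

(** Every head coordinate is a class of its own; class [N0] is the whole tail, of which only the
    total degree is prescribed. *)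
Definition head_class N0 (k : nat) : 'I_N0.+1 := inord (minn k N0).

Lemma class_degree_head N0 n (a : multi_index) (l : 'I_N0.+1) : (forall k, (N0 + n <= k)%N -> a k = 0%N) ->
  class_degree (head_class N0) a l = if (l < N0)%N then a l else (\sum_(i < n) a (N0 + i))%N.
Proof.
move=> an; rewrite /class_degree (sum_finsupp _ an).
have hE k : (head_class N0 k == l) = (minn k N0 == l :> nat).
  by rewrite -val_eqE/= inordK// ltnS geq_minr.
rewrite (eq_bigl _ _ hE) (@big_cat_nat _ _ _ N0)//= ?leq_addr//.
case: ifPn => [lN|lN].
  rewrite big_mkord (big_pred1 (Ordinal lN)) => [|k]; last first.
    by rewrite (minn_idPl (ltnW (ltn_ord k))).
  rewrite big_nat_cond big_pred0 ?addn0// => k; apply/negbTE; rewrite negb_and.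
  by case: (leqP N0 k) => Nk //=; rewrite gtn_eqF ?orbT.
have lE : l = N0 :> nat by apply/eqP; rewrite eqn_leq -ltnS ltn_ord leqNgt.
rewrite big_nat_cond big_pred0 ?add0n => [|k]; last first.
  apply/negbTE; rewrite lE; case: (ltnP k N0) => //= kN.
  by rewrite ltn_eqF.
rewrite -{1}[N0]add0n big_addn addKn big_mkord.
apply: eq_big => [i|i _]; last by rewrite addnC.
by rewrite lE (minn_idPr _) ?eqxx// leq_addl.
Qed.

(** With the head frozen at [lam * y], the part of [f] with head exponents [be] and tail degree [m]
    is a homogeneous polynomial in the tail variables, whose coefficients absorb the head monomial.
    [expansion_sum_le] bounds it by [B], because the point with head [lam * y] and a tail of radius
    [rho] lies in the unit ball. *)
Lemma head_tail_le (f : ell (ltW r1) -> C) c B D N0 n m (y : nat -> R) (lam rho : R) (be : nat -> nat) :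
  tail_coef_bound r D ->
  monomial_expansion f c -> 0 < B -> (forall z, unit_ball _ z -> normc (f z) <= B) ->
  (forall k, 0 <= y k) -> 0 <= lam -> 0 < rho ->
  \sum_(k < N0) (lam * y k) `^ r + rho `^ r < 1 ->
  \sum_(i < n) y (N0 + i)%N `^ r <= (rho / D) `^ r ->
  \sum_(ga : {ffun 'I_n -> 'I_m.+1} | (\sum_i ga i == m)%N)
    normc (c (glue N0 n be (natfun ga))) * \prod_(k < N0) (lam * y k) ^+ be k *
      \prod_(i < n) (i.+1%:R `^ (- sg) * y (N0 + i)%N) ^+ ga i <= B * 2^-1 ^+ m.
Proof.
move=> HD fc B0 fB y0 lam0 rho0 hr tr.
pose h : R := \prod_(k < N0) (lam * y k) ^+ be k.
have h0 : 0 <= h by apply: prodr_ge0 => k _; rewrite exprn_ge0 ?mulr_ge0.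
pose a (ga : {ffun 'I_n -> 'I_m.+1}) : C := c (glue N0 n be (natfun ga)) * h%:C.
have := HD n m a (fun i => y (N0 + i)%N) rho B rho0 B0.
rewrite (eq_bigr (fun ga => normc (c (glue N0 n be (natfun ga))) * h *
   \prod_(i < n) (i.+1%:R `^ (- sg) * y (N0 + i)%N) ^+ ga i)) => [|ga _]; last first.
  by rewrite normcM normc_real ger0_norm.
move=> H; apply: H => // {tr} z z1.
have r0 : 0 < r by rewrite (lt_trans ltr01).
pose zz (k : nat) : C := if (k < N0)%N then (lam * y k)%:C else oapp z 0 (insub (k - N0)%N).
have zzh k : (k < N0)%N -> zz k = (lam * y k)%:C by rewrite /zz => ->.
have zzt (i : 'I_n) : zz (N0 + i)%N = z i by rewrite /zz ltnNge leq_addr/= addKn valK.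
have zzo k : (N0 + n <= k)%N -> zz k = 0.
  move=> kn; rewrite /zz ltnNge (leq_trans (leq_addr n N0) kn)/= insubF//.
  by rewrite ltnNge leq_subRL ?kn// (leq_trans (leq_addr n N0) kn).
have zzs M : \sum_(0 <= k < M) normc (zz k) `^ r <= \sum_(k < N0) (lam * y k) `^ r + rho `^ r.
  have E : \sum_(0 <= k < N0 + n) normc (zz k) `^ r = \sum_(k < N0) (lam * y k) `^ r + \sum_(i < n) normc (z i) `^ r.
    rewrite (@big_cat_nat _ _ _ N0)//= ?leq_addr// big_mkord; congr (_ + _).
      by apply: eq_bigr => k _; rewrite zzh// normc_real ger0_norm ?mulr_ge0.
    rewrite -{1}[N0]add0n big_addn addKn big_mkord.
    by apply: eq_bigr => i _; rewrite addnC zzt.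
  apply: (@le_trans _ _ (\sum_(0 <= k < N0 + n) normc (zz k) `^ r)); last by rewrite E lerD2l.
  have [Mn|nM] := leqP M (N0 + n).
    rewrite [leRHS](@big_cat_nat _ _ _ M)//= lerDl sumr_ge0// => k _.
    exact: powR_ge0.
  rewrite (@big_cat_nat _ _ _ (N0 + n))//= ?(ltnW nM)//.
  rewrite [X in _ + X]big_nat_cond [X in _ + X]big1 ?addr0// => k /andP[/andP[kn _] _].
  by rewrite zzo// normc0 powR0// gt_eqF.
have [zb zbE zb1] := @ball_of_sum_le R r (ltW r1) zz _ hr zzs.
have zbfin : finite_set [set k | zb k != 0].
  apply: (@sub_finite_set _ _ `I_(N0 + n)) => // k /=; rewrite zbE.
  by apply: contraNT; rewrite -leqNgt => /zzo ->.
have mz (a' : multi_index) : monomial zb a' != 0 -> forall k, (N0 + n <= k)%N -> a' k = 0%N.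
  move=> m0 k nk; apply: contraNeq m0 => ak; rewrite prodf_seq_eq0.
  apply/hasP; exists k; first by rewrite mem_finsupp.
  by rewrite /= expf_eq0 lt0n ak zbE zzo/=.
pose S := [fset glue N0 n be (natfun ga) | ga in [pred ga : {ffun 'I_n -> 'I_m.+1} | (\sum_i ga i == m)%N]]%fset.
pose b (l : 'I_N0.+1) : nat := if (l < N0)%N then be l else m.
have HS a' : monomial zb a' != 0 -> (a' \in S) = [forall l, class_degree (head_class N0) a' l == b l].
  move=> /mz an; apply/imfsetP/forallP => [[ga /= gam ->] l|H].
    rewrite (class_degree_head _ (@glue_out N0 n be (natfun ga))) /b.
    case: ifP => lN; first by rewrite glue_head.
    rewrite -[X in _ == X](eqP gam); apply/eqP; apply: eq_bigr => i _.
    by rewrite glue_tail// natfunE.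
  have Hh k : (k < N0)%N -> a' k = be k.
    move=> kN; have kN1 : (k < N0.+1)%N by rewrite ltnW.
    have := H (Ordinal kN1); rewrite (class_degree_head _ an)/= /b/= kN => /eqP.
    by [].
  have Ht : (\sum_(i < n) a' (N0 + i) = m)%N.
    by have := H ord_max; rewrite (class_degree_head _ an)/= /b/= ltnn => /eqP.
  have ale (i : 'I_n) : (a' (N0 + i) < m.+1)%N.
    by rewrite ltnS -Ht (bigD1 i)//= leq_addr.
  pose ga : {ffun 'I_n -> 'I_m.+1} := [ffun i => Ordinal (ale i)].
  have gam : (\sum_i ga i == m)%N by apply/eqP/(etrans _ Ht)/eq_bigr => i _; rewrite ffunE.
  exists ga; first exact: gam.
  apply/fsfunP => k; case: (ltnP k N0) => kN; first by rewrite glue_head ?Hh.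
  case: (ltnP k (N0 + n)) => kn; last by rewrite glue_out// an.
  have kn' : (k - N0 < n)%N by rewrite ltn_subLR.
  rewrite -(subnKC kN) glue_tail// -[(k - N0)%N]/(val (Ordinal kn')) natfunE ffunE/=.
  by [].
have := expansion_sum_le fc zb1 zbfin HS fB; congr (normc _ <= _).
rewrite /S big_imfset/=; last first.
  move=> g1 g2 _ _ /fsfunP E; apply/ffunP => i; apply: val_inj => /=.
  by have := E (N0 + i)%N; rewrite !glue_tail// !natfunE.
rewrite big_enum/=; apply: eq_big => [//|ga _].
rewrite /a -mulrA; congr (_ * _); rewrite zbE monomial_glue; congr (_ * _).
  rewrite /h rmorph_prod; apply: eq_bigr => k _; by rewrite zzh// rmorphXn.
by apply: eq_bigr => i _; rewrite zzt natfunE.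
Qed.

End HeadTail.

(** * The inclusion *)

Section Inclusion.
Variable R : realType.
Local Notation C := R[i].

Lemma sum_fset_le_image (I : choiceType) (T : finType) (A : {fset I}) (P : pred I) (Q : pred T)
    (phi : T -> I) (F : I -> R) : (forall a, 0 <= F a) ->
  (forall a, a \in A -> P a -> exists2 t, Q t & phi t = a) ->
  \sum_(a <- A | P a) F a <= \sum_(t | Q t) F (phi t).
Proof.
move=> F0 HA.
apply: (@le_trans _ _ (\sum_(t | Q t) \sum_(a <- A | P a && (phi t == a)) F a)); last first.
  apply: ler_sum => t _; case: (boolP (phi t \in A)) => tA.
    rewrite big_mkcond (bigD1_seq (phi t) tA (fset_uniq A))/= eqxx andbT big1 ?addr0 => [|a].
      by case: ifP.
    by rewrite eq_sym => /negbTE ->; rewrite andbF.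
  rewrite big_seq_cond big_pred0 ?F0// => a; apply/negbTE; apply: contra tA.
  by move=> /and3P[aA _ /eqP ->].
rewrite (exchange_big_dep P)/=; last by move=> t a _ /andP[].
rewrite big_seq_cond [leRHS]big_seq_cond; apply: ler_sum => a /andP[aA Pa].
have [t Qt ta] := HA a aA Pa; have tP : Q t && (P a && (phi t == a)) by rewrite Qt Pa ta eqxx.
by rewrite (bigD1 t tP)/= lerDl sumr_ge0.
Qed.

Lemma tail_small (y : nat -> R) s e : (forall k, 0 <= y k) -> (forall n, \sum_(0 <= k < n) y k <= s) ->
  0 < e -> exists N0, forall n, \sum_(i < n) y (N0 + i)%N <= e.
Proof.
move=> y0 ys e0; pose u n := \sum_(0 <= k < n) y k.
have ndu : nondecreasing_seq u.
  by apply/nondecreasing_seqP => n; rewrite /u big_nat_recr//= lerDl.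
have cu : cvgn u.
  apply: nondecreasing_is_cvgn => //; exists s => _ [n _ <-]; exact: ys.
have /cvgrPdist_lt /(_ _ e0) [N0 _ H] := cu.
exists N0 => n; have := H N0 (leqnn _); rewrite /= ger0_norm; last first.
  by rewrite subr_ge0 nondecreasing_cvgn_le.
have := nondecreasing_cvgn_le ndu cu (N0 + n)%N.
have -> : u (N0 + n)%N = u N0 + \sum_(i < n) y (N0 + i)%N.
  rewrite /u (@big_cat_nat _ _ _ N0)//= ?leq_addr//; congr (_ + _).
  by rewrite -{1}[N0]add0n big_addn addKn big_mkord; apply: eq_bigr => i _; rewrite addnC.
lra.
Qed.

Variables (r : R) (r1 : 1 < r).
Let sg := 1 - (Num.min r 2)^-1.

Lemma sigma_gt0 : 0 < sg.
Proof.
have m1 : 1 < Num.min r 2 by rewrite lt_min r1 ltr1n.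
by rewrite subr_gt0 invf_lt1// (lt_trans ltr01).
Qed.

Lemma natr_powRN_le (i k : nat) (t : R) : 0 <= t -> (0 < i)%N -> (i <= k)%N ->
  (k%:R : R) `^ (- t) <= i%:R `^ (- t).
Proof.
move=> t0 i0 ik; rewrite !powRN lef_pV2 ?posrE ?powR_gt0 ?ltr0n// ?(leq_trans i0)//.
by rewrite ge0_ler_powR ?nnegrE// ler_nat.
Qed.

Variable p : nat -> nat.
Hypothesis pk : forall k, (k < p k)%N.

Lemma weighted_ball_ball (t : R) (u : ell (ltW r1)) : 0 <= t -> unit_ball (ltW r1) u ->
  exists2 z : ell (ltW r1), ell_val z = (fun k => ((p k)%:R `^ (- t))%:C * u k) & unit_ball (ltW r1) z.
Proof.
move=> t0 /ball_sum_le[s /andP[_ s1] us].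
apply: (@ball_of_sum_le R r (ltW r1) (fun k => ((p k)%:R `^ (- t))%:C * u k) s s1) => n.
apply: le_trans (us n); apply: ler_sum => k _.
rewrite normcM normc_real ger0_norm ?powR_ge0// ge0_ler_powR ?nnegrE ?mulr_ge0 ?powR_ge0 ?normc_ge0//.
  by rewrite (le_trans ler01)// ltW.
rewrite ler_piMl ?normc_ge0// -[leRHS](powRr0 (p k)%:R) ler_powR ?oppr_le0// ler1n.
exact: leq_ltn_trans (pk k).
Qed.

(** Returning from the dilated head [lam * y] to [y] yields factors [lam^-1 ^+ b k], which sum to at
    most [G] over all head exponents; tail degree [m] yields [2^-1 ^+ m]. The prime weights are at
    most 1 in the head, and at tail position [i] at most [(i+1)^(-sg)], as [p (N0 + i) > i]. *)
Lemma expansion_summable (f : ell (ltW r1) -> C) c (z u : ell (ltW r1)) :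
  monomial_expansion f c -> [bounded f z | z in unit_ball (ltW r1)] ->
  unit_ball (ltW r1) u -> (forall k, z k = ((p k)%:R `^ (- sg))%:C * u k) ->
  exists M : R, forall A : {fset multi_index}, \sum_(a <- A) normc (c a * monomial z a) <= M.
Proof.
move=> fc fbd u1 zE.
have r0 : 0 < r by rewrite (lt_trans ltr01).
have sg0 := ltW sigma_gt0.
have half1 : (2^-1 : R) < 1 by lra.
have half2 : (1 - 2^-1 : R)^-1 <= 2 by rewrite -[leRHS]invrK lef_pV2 ?posrE//; lra.
have [B B0 fB] : exists2 B : R, 0 < B & forall z', unit_ball (ltW r1) z' -> normc (f z') <= B.
  have [M0 [_ HM]] := fbd; pose M := M0 + 1.
  exists (`|complex.Re M| + 1) => [|z' z'1]; first by rewrite ltr_wpDl.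
  have : `|f z'| <= M by apply: HM; rewrite ?ltrDl.
  by rewrite lecE/= => /andP[_ h]; rewrite (le_trans h)// (le_trans (ler_norm _))// lerDl.
have [D D0 HD] := tail_coef_sum_le r1.
have [s /andP[s0 s1] us] := ball_sum_le u1.
pose y k := normc (u k).
have y0 k : 0 <= y k by exact: normc_ge0.
(* [s'] stands in for [s], which may be 0, as a denominator. Of the unit mass, the head dilated by
   [lam] uses the share [s''], and the tail of radius [rho] the share [(1 - s'') / 2]. *)
have [s' [s'0 s'1 ss']] : exists s', [/\ 0 < s', s' < 1 & s <= s'] by exists ((1 + s) / 2); split; lra.
have [s'' [s''0 s''1 s's'' ss2]] : exists s'', [/\ 0 < s'', s'' < 1, s' < s'' & s'' + (1 - s'') / 2 < 1].
  by exists ((1 + s') / 2); split; lra.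
pose lam := (s'' / s') `^ r^-1; pose rho := ((1 - s'') / 2) `^ r^-1.
have lamr : lam `^ r = s'' / s'.
  by rewrite /lam -powRrM mulVf ?gt_eqF// powRr1// divr_ge0 ?ltW.
have rhor : rho `^ r = (1 - s'') / 2.
  by rewrite /rho -powRrM mulVf ?gt_eqF// powRr1// divr_ge0// subr_ge0 ltW.
have lam1 : 1 < lam.
  have p1 : (1 : R) `^ r^-1 = 1 by rewrite powR1.
  rewrite -p1 gt0_ltr_powR ?invr_gt0// ?nnegrE ?divr_ge0 ?(ltW s''0) ?(ltW s'0)//.
  by rewrite ltr_pdivlMr// mul1r.
have lam0 : 0 < lam by rewrite (lt_trans ltr01).
have rho0 : 0 < rho by rewrite powR_gt0// divr_gt0// subr_gt0.
have e0 : 0 < (rho / D) `^ r by rewrite powR_gt0// divr_gt0.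
have [N0 HN0] := tail_small (fun k => powR_ge0 (y k) r) us e0.
have hr : \sum_(k < N0) (lam * y k) `^ r + rho `^ r < 1.
  rewrite (eq_bigr (fun k : 'I_N0 => lam `^ r * y k `^ r)) => [|k _]; last by rewrite powRM// ltW.
  rewrite -mulr_sumr lamr rhor -(big_mkord xpredT (fun k => y k `^ r)).
  have h : s'' / s' * \sum_(0 <= k < N0) y k `^ r <= s''.
    apply: (@le_trans _ _ (s'' / s' * s')); last by rewrite divfK ?gt_eqF.
    by rewrite ler_wpM2l ?divr_ge0 ?(ltW s''0) ?(ltW s'0)// (le_trans (us N0)).
  by rewrite (le_lt_trans (lerD h (lexx _))).
pose G := ((1 - lam^-1)^-1) ^+ N0.
exists (B * G * 2) => A.
pose F a := normc (c a * monomial z a).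
have F0 a : 0 <= F a by exact: normc_ge0.
(* [n] and [L] only have to cover the indices and exponents that occur in [A]; they do not enter the
   final bound. *)
pose n := (\sum_(a <- A) \sum_(k <- finsupp a) k.+1)%N.
pose L := (\sum_(a <- A) \sum_(k <- finsupp a) a k).+1.
have An a k : a \in A -> (N0 + n <= k)%N -> a k = 0%N.
  move=> aA nk; apply/eqP; apply: contraTT nk => ak; rewrite -ltnNge.
  rewrite (@leq_trans n) ?leq_addl// /n (big_fsetD1 a)//= (big_fsetD1 k) ?mem_finsupp//=.
  by rewrite -addnA leq_addr.
have AL a k : a \in A -> (a k < L)%N.
  move=> aA; case: (eqVneq (a k) 0%N) => [->//|ak].
  by rewrite /L ltnS (big_fsetD1 a)//= (big_fsetD1 k) ?mem_finsupp//= -addnA leq_addr.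
pose td (a : multi_index) := (\sum_(i < n) a (N0 + i))%N.
have tdL a : a \in A -> (td a < L)%N.
  move=> aA; rewrite ltnS (big_fsetD1 a)//= (@leq_trans (\sum_(k <- finsupp a) a k))%N ?leq_addr//.
  rewrite (sum_finsupp xpredT (fun k => @An a k aA)) (@big_cat_nat _ _ _ N0)//= ?leq_addr//.
  have -> : (\sum_(N0 <= i < N0 + n) a i = td a)%N.
    by rewrite -{1}[N0]add0n big_addn addKn big_mkord; apply: eq_bigr => i _; rewrite addnC.
  exact: leq_addl.
have step m : \sum_(a <- A | td a == m) F a <= B * G * 2^-1 ^+ m.
  pose T := ({ffun 'I_N0 -> 'I_L} * {ffun 'I_n -> 'I_m.+1})%type.
  pose phi (t : T) := glue N0 n (natfun t.1) (natfun t.2).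
  apply: (@le_trans _ _ (\sum_(t : T | (\sum_i t.2 i == m)%N) F (phi t))).
    apply: sum_fset_le_image => // a aA /eqP tdm.
    have ale (i : 'I_n) : (a (N0 + i) < m.+1)%N by rewrite ltnS -tdm /td (bigD1 i)//= leq_addr.
    exists ([ffun k : 'I_N0 => Ordinal (AL a k aA)], [ffun i => Ordinal (ale i)]) => /=.
      by apply/eqP/(etrans _ tdm)/eq_bigr => i _; rewrite ffunE.
    apply/fsfunP => k; case: (ltnP k N0) => kN.
      by rewrite glue_head// -[k]/(val (Ordinal kN)) natfunE ffunE.
    case: (ltnP k (N0 + n)) => kn; last by rewrite glue_out// An.
    have kn' : (k - N0 < n)%N by rewrite ltn_subLR.
    by rewrite -(subnKC kN) glue_tail// -[(k - N0)%N]/(val (Ordinal kn')) natfunE ffunE.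
  rewrite -(pair_big_dep xpredT (fun _ (g : {ffun 'I_n -> 'I_m.+1}) => (\sum_i g i == m)%N)
    (fun b g => F (phi (b, g))))/=.
  apply: (@le_trans _ _ (\sum_(b : {ffun 'I_N0 -> 'I_L}) (\prod_(k < N0) lam^-1 ^+ b k) * (B * 2^-1 ^+ m))).
    apply: ler_sum => b _.
    have := @head_tail_le R r r1 f c B D N0 n m y lam rho (natfun b) HD fc B0 fB y0 (ltW lam0) rho0 hr (HN0 n).
    have P0 : 0 <= \prod_(k < N0) lam^-1 ^+ b k.
      by apply: prodr_ge0 => k _; rewrite exprn_ge0// invr_ge0 ltW.
    move=> /(ler_wpM2l P0); apply: le_trans; rewrite mulr_sumr; apply: ler_sum => g _.
    rewrite /F /phi/= normcM mulrCA -!mulrA ler_wpM2l ?normc_ge0// monomial_glue normcM mulrA.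
    rewrite !normc_prod -big_split/=; apply: ler_pM; try by apply: prodr_ge0 => k _; exact: normc_ge0.
      apply: ler_prod => k _; rewrite natfunE normc_ge0 -exprMn mulrAC divff ?gt_eqF// mul1r /= normc_exp.
      apply: lerXn2r; rewrite ?nnegrE ?normc_ge0// zE normcM normc_real ger0_norm ?powR_ge0//.
      rewrite ler_piMl ?normc_ge0// -[leRHS](powRr0 (p k)%:R) ler_powR ?oppr_le0// ler1n.
      exact: leq_ltn_trans (pk k).
    apply: ler_prod => i _; rewrite normc_ge0/= normc_exp natfunE.
    apply: lerXn2r; rewrite ?nnegrE ?normc_ge0 ?mulr_ge0 ?powR_ge0 ?normc_ge0//.
    rewrite zE normcM normc_real ger0_norm ?powR_ge0// ler_wpM2r ?normc_ge0//.
    by rewrite natr_powRN_le// (leq_ltn_trans _ (pk _))// leq_addl.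
  rewrite -mulr_suml mulrCA mulrA ler_wpM2r ?exprn_ge0 ?invr_ge0// ler_wpM2l ?(ltW B0)//.
  rewrite -(bigA_distr_bigA (fun (k : 'I_N0) (b : 'I_L) => lam^-1 ^+ b)) /G.
  rewrite -[X in _ <= _ ^+ X](card_ord N0) -prodr_const; apply: ler_prod => k _.
  rewrite sumr_ge0 => [|b _]; last by rewrite exprn_ge0// invr_ge0 ltW.
  by rewrite geometric_le ?invr_ge0 ?(ltW lam0)// invf_lt1.
rewrite (partition_big (fun a => inord (td a) : 'I_L) xpredT)//=.
apply: (@le_trans _ _ (\sum_(m < L) B * G * 2^-1 ^+ m)).
  apply: ler_sum => m _; apply: le_trans (step m).
  rewrite big_seq_cond [leRHS]big_seq_cond le_eqVlt; apply/orP; left; apply/eqP; apply: eq_bigl => a.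
  by case: (boolP (a \in A)) => //= aA; rewrite -val_eqE/= inordK// tdL.
rewrite -mulr_sumr ler_wpM2l// ?mulr_ge0 ?(ltW B0) ?exprn_ge0 ?invr_ge0 ?subr_ge0 ?invf_le1 ?(ltW lam1)//.
by rewrite (le_trans (geometric_le _ _ half1)) ?invr_ge0.
Qed.

(* Without a monomial expansion of [f], [monomial_coef f] is the junk value [0]
   and the sum is trivially finite. *)
Lemma weighted_ball_sub_mon :
  weighted_ball (ltW r1) p sg `<=` [set (z : nat -> R[i]) | z in mon_Hinfty (ltW r1)].
Proof.
move=> _ [u u1 <-]; have [z zE z1] := weighted_ball_ball (ltW sigma_gt0) u1.
exists z => //; split=> // f [_ fb].
have [M HM] : exists M : R, forall A : {fset multi_index},
    \sum_(a <- A) normc (monomial_coef f a * monomial z a) <= M.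
  have [[c fc]|nc] := pselect (exists c, monomial_expansion f c).
    have fc' : monomial_expansion f (monomial_coef f) by apply: getPex; exists c.
    by apply: (expansion_summable fc' fb u1) => k; rewrite zE.
  exists 0 => A; rewrite big1// => a _.
  by rewrite /monomial_coef xgetPN ?mul0r ?normc0// => c fc; apply: nc; exists c.
apply: (@le_lt_trans _ _ M%:E); last exact: ltry.
apply: ub_ereal_sup => _ [A [Afin _] <-].
by rewrite fsbig_finite//= sumEFin lee_fin HM.
Qed.

End Inclusion.

(** * Growth of the primes *)

Section Chebyshev.
Local Open Scope nat_scope.

Lemma expn2_le_central_bin n : 2 ^ n <= 'C(n + n, n).
Proof.
rewrite -[2]/(1 + 1) expnDn -(binomial.Vandermonde n n n); apply: leq_sum => j _.
by rewrite !exp1n !muln1 leq_pmulr// bin_gt0 leq_subr.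
Qed.

(** By Legendre's formula each [k] contributes the floor of 2n / q^k minus twice the floor of n /
    q^k, which is at most 1, and 0 once [q ^ k] exceeds 2n. *)
Lemma logn_central_bin_le q n : prime q -> 0 < n -> logn q 'C(n + n, n) <= trunc_log q (n + n).
Proof.
move=> pq n0; have q1 := prime_gt1 pq.
have bin0 : 0 < 'C(n + n, n) by rewrite bin_gt0 leq_addr.
have E : logn q 'C(n + n, n) + (logn q n`! + logn q n`!) = logn q (n + n)`!.
  rewrite -(bin_fact (leq_addr n n)) addKn !lognM ?muln_gt0 ?fact_gt0//.
rewrite -(leq_add2r (logn q n`! + logn q n`!)) E !logn_fact//.
have -> : \sum_(1 <= k < n.+1) n %/ q ^ k = \sum_(1 <= k < (n + n).+1) n %/ q ^ k.
  rewrite [RHS](@big_cat_nat _ _ _ n.+1)//= ?ltnS ?leq_addr// [X in _ = _ + X]big_nat_cond.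
  rewrite [X in _ = _ + X]big1 ?addn0// => k /andP[/andP[nk _] _].
  by rewrite divn_small// (ltn_trans nk)// ltn_expl.
apply: (@leq_trans (\sum_(1 <= k < (n + n).+1) ((q ^ k <= n + n) + (n %/ q ^ k + n %/ q ^ k)))).
  apply: leq_sum => k _; set d := q ^ k; have d0 : 0 < d by rewrite expn_gt0 prime_gt0.
  have [dn|nd] := leqP d (n + n); last by rewrite divn_small.
  rewrite -ltnS ltn_divLR// {1 2}(divn_eq n d) add1n -!addSn.
  have := ltn_pmod n d0; nia.
rewrite big_split/= big_split/= leq_add2r.
apply: (@leq_trans (\sum_(1 <= k < (trunc_log q (n + n)).+1) 1)); last by rewrite sum_nat_const_nat subn1 muln1.
apply: (@leq_trans (\sum_(1 <= k < (n + n).+1 | k < (trunc_log q (n + n)).+1) 1)).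
  rewrite [leqRHS]big_mkcond/=; apply: leq_sum => k _; case: (boolP (q ^ k <= n + n)) => // h.
  by rewrite ltnS trunc_log_max.
have tn : (trunc_log q (n + n)).+1 <= (n + n).+1.
  rewrite ltnS (leq_trans (ltnW (ltn_expl _ q1)))// trunc_logP// addn_gt0 n0.
  by [].
rewrite (@big_cat_nat _ _ _ (trunc_log q (n + n)).+1)//= -[leqRHS]addn0 leq_add//.
  by rewrite [leqLHS]big_mkcond; apply: leq_sum => k _; case: ifP.
rewrite leqn0 big_nat_cond big_pred0// => k.
by apply/negbTE/negP => /andP[/andP[a _]]; rewrite ltnNge a.
Qed.

Variable p : nat -> nat.
Hypothesis p_incr : forall i j, i < j -> p i < p j.
Hypothesis p_primes : forall q, prime q <-> exists k, p k = q.

Lemma prime_enum_prime k : prime (p k).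
Proof. by apply/p_primes; exists k. Qed.

(** Chebyshev's argument for the central binomial coefficient with [n] the half of [p k]: it is at
    least [2 ^ n], and each maximal prime power dividing it is at most [2 n <= p k], so at most the
    first [k + 1] primes occur. *)
Lemma expn2_half_prime_le k : 2 ^ (p k)./2 <= (p k) ^ k.+1.
Proof.
set n := (p k)./2; have p1 := prime_gt1 (prime_enum_prime k).
have n0 : 0 < n by rewrite half_gt0.
have np : n + n <= p k by rewrite addnn -[leqRHS](odd_double_half (p k)) leq_addl.
apply: leq_trans (expn2_le_central_bin n) _; set c := 'C(_, _).
have c0 : 0 < c by rewrite bin_gt0 leq_addr.
have qle q : q \in primes c -> prime q /\ q ^ logn q c <= p k.
  rewrite mem_primes => /and3P[pq _ qc]; split=> //.
  apply: leq_trans np; apply: (@leq_trans (q ^ trunc_log q (n + n))).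
    by rewrite leq_exp2l ?prime_gt1// logn_central_bin_le.
  by rewrite trunc_logP ?prime_gt1// addn_gt0 n0.
rewrite {1}(prod_prime_decomp c0) prime_decompE big_map/=.
apply: (@leq_trans (\prod_(q <- primes c) p k)).
  by rewrite big_seq [leqRHS]big_seq; apply: leq_prod => q /qle[].
rewrite big_const_seq count_predT iter_muln_1 leq_exp2l//.
rewrite -[k.+1](size_iota 0) -[size (iota _ _)](size_map p); apply: uniq_leq_size; first exact: primes_uniq.
move=> q qc; have [pq qk] := qle q qc; have [j pj] := (p_primes q).1 pq.
apply/mapP; exists j => //; rewrite mem_iota/= add0n ltnS leqNgt; apply/negP => kj.
have := p_incr kj; rewrite pj ltnNge => /negP; apply; apply: leq_trans qk.
rewrite -{1}(expn1 q) leq_exp2l ?prime_gt1// logn_gt0//.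
Qed.

Lemma prime_enum_gt k : k < p k.
Proof.
elim: k => [|k IH]; first exact: prime_gt0 (prime_enum_prime 0).
exact: leq_ltn_trans IH (p_incr (ltnSn k)).
Qed.

End Chebyshev.

Section PrimeGrowth.
Variables (R : realType) (p : nat -> nat).
Hypothesis p_incr : forall i j, (i < j)%N -> (p i < p j)%N.
Hypothesis p_primes : forall q, prime q <-> exists k, p k = q.

(** Taking logarithms in [expn2_half_prime_le] bounds [p k] by a multiple of [(k + 1) * ln (p k)].
    Absorbing [ln x <= x^eta / eta] leaves a bound on [x^(1 - eta)], and [eta] is chosen such that
    [1 - eta = 1 / (1 + del)]. *)
Lemma prime_growth (del : R) : 0 < del -> exists2 K : R, 0 < K &
  forall k, (p k)%:R <= K * k.+1%:R `^ (1 + del).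
Proof.
move=> d0; pose eta := del / (1 + del).
have d1 : 0 < 1 + del by lra.
have eta0 : 0 < eta by rewrite divr_gt0.
have etaE : 1 - eta = (1 + del)^-1 by rewrite /eta; field; rewrite gt_eqF.
have ln2 : 0 < ln 2 :> R by rewrite ln_gt0// ltr1n.
pose K := (3 / (eta * ln 2)) `^ (1 + del).
have K0 : 0 < K by rewrite powR_gt0// divr_gt0// mulr_gt0.
exists K => // k; set x := (p k)%:R.
have x1 : 1 < x by rewrite ltr1n prime_gt1// prime_enum_prime.
have x0 : 0 < x by rewrite (lt_trans ltr01).
(* Rounding the half down costs most at [p k = 3], whence the factor 3. *)
have xh : x <= 3 * (p k)./2%:R.
  rewrite -natrM ler_nat; have := odd_double_half (p k); have := prime_gt1 (prime_enum_prime p_primes k).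
  by case: odd => /=; lia.
have h1 : (p k)./2%:R * ln 2 <= k.+1%:R * ln x.
  have h : ((2 ^ (p k)./2)%N%:R : R) <= (p k ^ k.+1)%N%:R.
    by rewrite ler_nat expn2_half_prime_le.
  have {h} : ln (2 ^+ (p k)./2 : R) <= ln (x ^+ k.+1).
    by rewrite ler_ln ?posrE ?exprn_gt0// -!natrX.
  by rewrite !lnXn// -[ln 2 *+ _]mulr_natl -[ln x *+ _]mulr_natl.
have xe0 : 0 < x `^ eta by rewrite powR_gt0.
have h2 : eta * ln x <= x `^ eta by rewrite -ln_powR ltW// ln_sublinear.
have h3 : x * (eta * ln 2) <= 3 * (k.+1%:R * x `^ eta).
  apply: (@le_trans _ _ (3 * (p k)./2%:R * (eta * ln 2))).
    by rewrite ler_wpM2r// mulr_ge0// ltW.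
  rewrite -mulrA ler_wpM2l// mulrCA (le_trans (ler_wpM2l (ltW eta0) h1))//.
  by rewrite mulrCA ler_wpM2l.
have h4 : x `^ (1 + del)^-1 <= 3 / (eta * ln 2) * k.+1%:R.
  have -> : x `^ (1 + del)^-1 = x / x `^ eta.
    rewrite -etaE powRB; last by apply/implyP => _; rewrite gt_eqF.
    by rewrite powRr1// ltW.
  rewrite ler_pdivrMr//.
  rewrite (_ : _ * x `^ eta = 3 * (k.+1%:R * x `^ eta) / (eta * ln 2)).
    rewrite ler_pdivlMr; last exact: mulr_gt0.
    exact: h3.
  by rewrite -!mulrA; congr (_ * _); rewrite mulrC -mulrA.
have -> : x = (x `^ (1 + del)^-1) `^ (1 + del) by rewrite -powRrM mulVf ?gt_eqF// powRr1// ltW.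
rewrite /K -powRM// ?divr_ge0// ?mulr_ge0 ?(ltW eta0) ?(ltW ln2)//.
by rewrite ge0_ler_powR ?nnegrE ?powR_ge0 ?(ltW d1)// (le_trans (powR_ge0 _ _) h4).
- exact: ltW.
- by rewrite invr_ge0 ltW.
Qed.

End PrimeGrowth.

(** * Multilinear forms with random signs *)

Section RandomSigns.
Variable R : realType.
Local Notation C := R[i].

Lemma expR_le_quadratic (b : R) : b <= 2^-1 -> expR b <= 1 + b + 2 * b ^+ 2.
Proof.
move=> b2; have b1 : 0 < 1 - b by lra.
have h := expR_ge1Dx (- b); have e0 : 0 < expR b by rewrite expR_gt0.
have h1 : expR b * (1 - b) <= 1.
  by rewrite -[leRHS](expR0) -(subrr b) expRD ler_wpM2l// ltW.
rewrite -(ler_pM2r b1) (le_trans h1)//.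
rewrite -subr_ge0 (_ : _ - 1 = b ^+ 2 * (1 - 2 * b)); last by ring.
by rewrite mulr_ge0 ?sqr_ge0//; lra.
Qed.

(** A subgaussian bound for a random sign. Adding the two quadratic bounds cancels the linear terms
    and leaves [2 + a ^+ 2]. *)
Lemma cosh_le (a : R) : `|a| <= 1 -> expR (a / 2) + expR (- (a / 2)) <= 2 * expR (a ^+ 2 / 2).
Proof.
rewrite ler_norml => /andP[a1 a2].
have h1 : expR (a / 2) <= 1 + a / 2 + 2 * (a / 2) ^+ 2 by apply: expR_le_quadratic; lra.
have h2 : expR (- (a / 2)) <= 1 + - (a / 2) + 2 * (- (a / 2)) ^+ 2 by apply: expR_le_quadratic; lra.
have h3 := expR_ge1Dx (a ^+ 2 / 2).
rewrite sqrrN in h2; have E : (a / 2) ^+ 2 = a ^+ 2 / 4 by field.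
rewrite E in h1 h2; lra.
Qed.

Definition sgn_of (b : bool) : R := if b then 1 else -1.

(** A Chernoff bound in averaged form. For each [g] the mean of [expR (S / 2)] over all signs is at
    most [expR 1], and likewise for [- S]. Hence some choice keeps the sum of all these exponentials
    below [2 * #|G| * e], and the logarithm of each single one bounds [S]. *)
Lemma signs_ex (J G : finType) (a : G -> J -> R) : (forall g, \sum_j a g j ^+ 2 <= 1) ->
  exists eps : {ffun J -> bool}, forall g,
    `|\sum_j sgn_of (eps j) * a g j| <= 2 * ln (2 * #|G|%:R) + 2.
Proof.
move=> a1; pose S (eps : {ffun J -> bool}) g := \sum_j sgn_of (eps j) * a g j.
have aj g j : `|a g j| <= 1.
  rewrite -(ler_pXn2r (isT : (0 < 2)%N)) ?nnegrE// expr1n real_normK ?num_real//.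
  by rewrite (le_trans _ (a1 g))// (bigD1 j)//= lerDl sumr_ge0// => i _; rewrite sqr_ge0.
have mgf (v : R) g : v = 1 \/ v = -1 ->
    \sum_(eps : {ffun J -> bool}) expR (v * S eps g / 2) <= 2 ^+ #|J| * expR 1.
  move=> v1; have vS eps : expR (v * S eps g / 2) = \prod_j expR (v * (sgn_of (eps j) * a g j) / 2).
    by rewrite -expR_sum mulr_sumr mulr_suml.
  under eq_bigr do rewrite vS.
  rewrite -(bigA_distr_bigA (fun j (b : bool) => expR (v * (sgn_of b * a g j) / 2)))/=.
  apply: (@le_trans _ _ (\prod_(j : J) (2 * expR (a g j ^+ 2 / 2)))).
    apply: ler_prod => j _; rewrite sumr_ge0 => [|b _]; last exact: expR_ge0.
    rewrite big_bool/= /sgn_of (le_trans _ (cosh_le (aj g j)))//.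
    case: v1 => ->; rewrite !mulN1r ?mul1r ?opprK ?mulNr ?mul1r//.
    by rewrite addrC.
  rewrite big_split/= prodr_const -expR_sum ler_wpM2l ?exprn_ge0// ler_expR -mulr_suml.
  by have := a1 g; lra.
(* on average over all signs, the exponential moments are bounded by [mgf] *)
have [eps Heps] : exists eps, \sum_g (expR (1 * S eps g / 2) + expR (-1 * S eps g / 2)) <= 2 * #|G|%:R * expR 1.
  apply/existsP; apply: contraT; rewrite negb_exists => /forallP h.
  have : \sum_(eps : {ffun J -> bool}) 2 * #|G|%:R * expR 1 <
      \sum_(eps : {ffun J -> bool}) \sum_g (expR (1 * S eps g / 2) + expR (-1 * S eps g / 2)).
    apply: ltr_sum => [|eps _]; last by rewrite ltNge h.
    by apply/hasP; exists [ffun=> true]; rewrite ?mem_index_enum.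
  rewrite ltNge => /negP; case; rewrite exchange_big/=.
  apply: (@le_trans _ _ (\sum_(g : G) 2 * (2 ^+ #|J| * expR 1))).
    apply: ler_sum => g _; rewrite big_split/= (_ : 2 * _ = 2 ^+ #|J| * expR 1 + 2 ^+ #|J| * expR 1); last by ring.
    by rewrite lerD// mgf; auto.
  rewrite !sumr_const card_ffun card_bool -[leLHS]mulr_natr -[leRHS]mulr_natr natrX.
  by rewrite le_eqVlt; apply/orP; left; apply/eqP; ring.
exists eps => g; rewrite -/(S eps g).
have G0 : 0 < (#|G|%:R : R) by rewrite ltr0n; apply/card_gt0P; exists g.
have each (v : R) : expR (v * S eps g / 2) <= 2 * #|G|%:R * expR 1 -> v * S eps g <= 2 * ln (2 * #|G|%:R) + 2.
  rewrite -(ler_ln) ?posrE ?mulr_gt0 ?expR_gt0// expRK lnM ?posrE ?mulr_gt0 ?expR_gt0// expRK.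
  by lra.
have bnd (F : G -> R) : (forall g, 0 <= F g) -> F g <= \sum_g F g.
  by move=> F0; rewrite (bigD1 g)//= lerDl sumr_ge0.
rewrite big_split/= in Heps.
have s0 (v : R) : 0 <= \sum_g expR (v * S eps g / 2) by apply: sumr_ge0 => *; exact: expR_ge0.
have e1 : 1 * S eps g <= 2 * ln (2 * #|G|%:R) + 2.
  apply: each; apply: le_trans (bnd (fun g => expR (1 * S eps g / 2)) _) _ => [h|]; first exact: expR_ge0.
  by apply: le_trans Heps; rewrite lerDl.
have e2 : -1 * S eps g <= 2 * ln (2 * #|G|%:R) + 2.
  apply: each; apply: le_trans (bnd (fun g => expR (-1 * S eps g / 2)) _) _ => [h|]; first exact: expR_ge0.
  by apply: le_trans Heps; rewrite lerDr.
by rewrite ler_norml; apply/andP; split; lra.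
Qed.

(** Rounding goes towards zero, so the modulus does not increase and points of the unit ball stay in
    it. The shift by [L] lets [j] encode the integers from [-L] to [L]. *)
Lemma round_real (L : nat) (x : R) : (0 < L)%N -> `|x| <= 1 ->
  exists j : 'I_(2 * L).+1, `|(j%:R - L%:R) / L%:R| <= `|x| /\ `|x - (j%:R - L%:R) / L%:R| <= L%:R^-1.
Proof.
move=> L0; have L0' : 0 < (L%:R : R) by rewrite ltr0n.
have pos (y : R) : 0 <= y -> y <= 1 -> exists k : nat, [/\ (k <= L)%N, k%:R / L%:R <= y & y - k%:R / L%:R <= L%:R^-1].
  move=> y0 y1; have yL : 0 <= y * L%:R by rewrite mulr_ge0// ltW.
  exists (Num.truncn (y * L%:R)); have /andP[h1 h2] := truncn_itv yL; split.
  - by rewrite -(ler_nat R) (le_trans h1)// ler_piMl// ltW.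
  - by rewrite ler_pdivrMr.
  rewrite -(ler_pM2r L0') mulrBl divfK ?gt_eqF// mulVf ?gt_eqF//.
  by move: h2; rewrite -natr1; lra.
move=> x1; have [x0|x0] := leP 0 x.
  rewrite ger0_norm// in x1 *; have [k [kL h1 h2]] := pos x x0 x1.
  have jL : (k + L < (2 * L).+1)%N by rewrite ltnS mul2n -addnn leq_add2r.
  exists (Ordinal jL) => /=; rewrite natrD addrK; split.
    by rewrite ger0_norm// divr_ge0// ltW.
  by rewrite ger0_norm// subr_ge0.
rewrite ltr0_norm// in x1 *; have [k [kL h1 h2]] := pos (- x) (ltW (etrans (oppr_gt0 x) x0)) x1.
have jL : (L - k < (2 * L).+1)%N by rewrite ltnS (leq_trans (leq_subr _ _))// leq_pmull.
exists (Ordinal jL) => /=; rewrite natrB// addrAC subrr add0r mulNr normrN; split.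
  by rewrite ger0_norm// divr_ge0// ltW.
by rewrite opprK -normrN ger0_norm opprD ?subr_ge0.
Qed.

Lemma prod_diff_le (m : nat) (x y : 'I_m -> C) :
  (forall i, normc (x i) <= 1) -> (forall i, normc (y i) <= 1) ->
  normc (\prod_i x i - \prod_i y i) <= \sum_i normc (x i - y i).
Proof.
move=> x1 y1.
have : normc (\prod_i x i - \prod_i y i) <= \sum_i normc (x i - y i) /\ normc (\prod_i y i) <= 1.
  elim/big_rec3: _ => [|i d b c _ [IH b1]]; first by rewrite subrr normc0 normc1.
  split; last by rewrite normcM mulr_ile1 ?normc_ge0.
  rewrite (_ : _ - _ = x i * (c - b) + (x i - y i) * b); last by ring.
  rewrite (le_trans (le_normcD _ _))// !normcM addrC lerD//.
    by rewrite ler_piMr ?normc_ge0.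
  by rewrite (le_trans _ IH)// ler_piMl ?normc_ge0.
by case.
Qed.

End RandomSigns.

Section RandomForms.
Variable R : realType.
Local Notation C := R[i].
Variables m n : nat.
Local Notation J := {ffun 'I_m -> 'I_n}.

Definition sform (eps : J -> bool) (x : 'I_m -> 'I_n -> C) : C :=
  \sum_(j : J) (sgn_of R (eps j))%:C * \prod_i x i (j i).

Lemma normc_sgn b : normc ((sgn_of R b)%:C) = 1.
Proof. by rewrite normc_real /sgn_of; case: b; rewrite ?normrN normr1. Qed.

Lemma normc_le_ReIm (z : C) : normc z <= `|complex.Re z| + `|complex.Im z|.
Proof.
case: z => a b; have {1}-> : a +i* b = a%:C + (0 +i* b).
  by apply/eqP; rewrite eq_complex/= addr0 add0r !eqxx.
rewrite (le_trans (le_normcD _ _))// normc_real/= lerD2l.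
by rewrite /normc expr0n add0r sqrtr_sqr.
Qed.

Definition grid_pt L (t : 'I_(2 * L).+1 * 'I_(2 * L).+1) : C :=
  ((t.1%:R - L%:R) / L%:R) +i* ((t.2%:R - L%:R) / L%:R).

Lemma round_complex (L : nat) (z : C) : (0 < L)%N -> normc z <= 1 ->
  exists t : 'I_(2 * L).+1 * 'I_(2 * L).+1, normc (grid_pt t) <= normc z /\ normc (z - grid_pt t) <= 2 / L%:R.
Proof.
case: z => a b L0 z1.
have aR : `|a| <= normc (a +i* b) by rewrite /normc -sqrtr_sqr ler_wsqrtr// lerDl sqr_ge0.
have bR : `|b| <= normc (a +i* b) by rewrite /normc -sqrtr_sqr ler_wsqrtr// lerDr sqr_ge0.
have [i [i1 i2]] := round_real L0 (le_trans aR z1).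
have [j [j1 j2]] := round_real L0 (le_trans bR z1).
exists (i, j); split.
  rewrite /grid_pt/= /normc; apply: ler_wsqrtr; apply: lerD.
    by rewrite -[leLHS]real_normK ?num_real// -[leRHS]real_normK ?num_real// lerXn2r ?nnegrE.
  by rewrite -[leLHS]real_normK ?num_real// -[leRHS]real_normK ?num_real// lerXn2r ?nnegrE.
rewrite (le_trans (normc_le_ReIm _))//= (_ : 2 / L%:R = L%:R^-1 + L%:R^-1); last by rewrite mulr_natl.
by rewrite lerD.
Qed.

(** Rounding to a grid of mesh [1/L] leaves finitely many points, for which [signs_ex] chooses the
    signs at once; the [bool] in [G] separates real and imaginary parts. The squared moduli of the
    monomials sum to the product of the squared l_2 norms, hence to at most 1. The last summand is
    the rounding error: [n ^ m] monomials, each changed by at most [m * (2 / L)]. *)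
Lemma sform_grid L : (0 < L)%N -> exists eps : J -> bool,
  forall x : 'I_m -> 'I_n -> C, (forall i, \sum_j normc (x i j) ^+ 2 <= 1) ->
    normc (sform eps x) <=
      2 * (2 * ln (2 * (2 * ((2 * L).+1 ^ (2 * (m * n)))%N%:R)) + 2) + (n ^ m)%N%:R * (m%:R * (2 / L%:R)).
Proof.
move=> L0; pose G := ({ffun 'I_m * 'I_n -> 'I_(2 * L).+1 * 'I_(2 * L).+1} * bool)%type.
pose pt (g : G) i j : C := grid_pt (g.1 (i, j)).
pose inb (g : G) := [forall i, \sum_j normc (pt g i j) ^+ 2 <= 1].
pose part (b : bool) (z : C) : R := if b then complex.Re z else complex.Im z.
have part_le b z : `|part b z| <= normc z.
  case: z => u v; rewrite /part /normc; case: b => /=; rewrite -sqrtr_sqr ler_wsqrtr// ?lerDl ?lerDr sqr_ge0//.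
(* Grid points outside the balls get the zero vector, so that the hypothesis of [signs_ex] holds on
   all of [G]. *)
pose a (g : G) (j : J) : R := if inb g then part g.2 (\prod_i pt g i (j i)) else 0.
have a1 g : \sum_j a g j ^+ 2 <= 1.
  rewrite /a; have [gi|_] := boolP (inb g); last by rewrite big1// => j _; rewrite expr0n.
  have /forallP gb := gi.
  apply: (@le_trans _ _ (\sum_(j : J) \prod_i normc (pt g i (j i)) ^+ 2)).
    apply: ler_sum => j _; rewrite -[leLHS]real_normK ?num_real//.
    rewrite prodrXl -normc_prod lerXn2r ?nnegrE ?normc_ge0//.
  rewrite -(bigA_distr_bigA (fun i j => normc (pt g i j) ^+ 2)).
  apply: prodr_ile1 => i _.
  by rewrite gb sumr_ge0// => j _; rewrite sqr_ge0.
have [eps Heps] := signs_ex a1; exists eps => x x1.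
have xij i j : normc (x i j) <= 1.
  rewrite -(ler_pXn2r (isT : (0 < 2)%N)) ?nnegrE ?normc_ge0// expr1n.
  by rewrite (le_trans _ (x1 i))// (bigD1 j)//= lerDl sumr_ge0// => k _; rewrite sqr_ge0.
have /choice [t Ht] : forall ij : 'I_m * 'I_n, exists t : 'I_(2 * L).+1 * 'I_(2 * L).+1,
    normc (grid_pt t) <= normc (x ij.1 ij.2) /\
    normc (x ij.1 ij.2 - grid_pt t) <= 2 / L%:R by move=> ij; apply: round_complex.
pose g0 : {ffun 'I_m * 'I_n -> 'I_(2 * L).+1 * 'I_(2 * L).+1} := [ffun ij => t ij].
pose y i j := grid_pt (g0 (i, j)).
have y1 i j : normc (y i j) <= normc (x i j) by rewrite /y ffunE; exact: (Ht (i, j)).1.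
have y2 i j : normc (x i j - y i j) <= 2 / L%:R by rewrite /y ffunE; exact: (Ht (i, j)).2.
have yb b : inb (g0, b).
  apply/forallP => i; rewrite (le_trans _ (x1 i))//; apply: ler_sum => j _.
  by rewrite lerXn2r ?nnegrE ?normc_ge0//; exact: y1.
have cardG : #|{: G}| = (2 * ((2 * L).+1 ^ (2 * (m * n))))%N.
  rewrite card_prod card_ffun !card_prod !card_ord card_bool mulnC; congr (_ * _)%N.
  by rewrite mulnn -expnM.
have sy : normc (sform eps y) <= 2 * (2 * ln (2 * (2 * ((2 * L).+1 ^ (2 * (m * n)))%N%:R)) + 2).
  rewrite (le_trans (normc_le_ReIm _))//.
  have bnd b : `|part b (sform eps y)| <= 2 * ln (2 * (2 * ((2 * L).+1 ^ (2 * (m * n)))%N%:R)) + 2.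
    have := Heps (g0, b); rewrite cardG natrM; congr (`|_| <= _).
    have partD : {morph part b : u v / u + v >-> u + v} by case: b => [[? ?] [? ?]|[? ?] [? ?]].
    have part0 : part b 0 = 0 by case: (b).
    rewrite /sform (big_morph _ partD part0); apply: eq_bigr => j _; rewrite /a yb.
    by rewrite /part; case: (b); case: (\prod_i _) => u v /=; rewrite mul0r ?subr0 ?addr0.
  have := bnd true; have := bnd false; rewrite /part; lra.
rewrite -[sform eps x](subrK (sform eps y)) (le_trans (le_normcD _ _))// addrC lerD//.
rewrite /sform -sumrB (le_trans (normc_sum _ _ _))//.
apply: (@le_trans _ _ (\sum_(j : J) m%:R * (2 / L%:R))); last first.
  by rewrite sumr_const card_ffun !card_ord -[leLHS]mulr_natl.
apply: ler_sum => j _; rewrite -mulrBr normcM normc_sgn mul1r.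
rewrite (le_trans (prod_diff_le _ _))// => [i|]; first exact: le_trans (y1 _ _) (xij _ _).
rewrite (le_trans (ler_sum _ (fun i _ => y2 i (j i))))//.
by rewrite sumr_const card_ord -[leLHS]mulr_natl.
Qed.

End RandomForms.

(** The logarithm of the number of grid points is of order [n * ln n] for fixed [m], which is
    generously bounded by [n ^+ 2]. The constant collects [4 * 6 m (m + 1)] from this logarithm,
    [2 m] from the rounding, and [16 + 4] from [4 * ln 4] and the additive term of [signs_ex]. *)
Lemma small_forms_ex (R : realType) (m : nat) : exists2 K : R, 0 < K & forall n, (0 < n)%N ->
  exists eps : {ffun 'I_m -> 'I_n} -> bool,
    forall x : 'I_m -> 'I_n -> R[i], (forall i, \sum_j normc (x i j) ^+ 2 <= 1) ->
      normc (sform eps x) <= K * n%:R ^+ 2.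
Proof.
exists (24 * m%:R * m.+1%:R + 2 * m%:R + 20 : R) => [|n n0].
  by rewrite ltr_wpDl// addr_ge0 ?mulr_ge0.
(* with mesh [n ^ -m] the rounding error of the form is bounded by a constant *)
have L0 : (0 < n ^ m)%N by rewrite expn_gt0 n0.
have [eps Heps] := @sform_grid R m n _ L0; exists eps => x x1; apply: le_trans (Heps x x1) _.
have LR : 0 < ((n ^ m)%N%:R : R) by rewrite ltr0n.
have -> : (n ^ m)%N%:R * (m%:R * (2 / (n ^ m)%N%:R)) = 2 * m%:R :> R by field; rewrite gt_eqF.
have n1 : 1 <= n%:R :> R by rewrite ler1n.
set c := (2 * n ^ m).+1.
have c0 : 0 < (c%:R : R) by rewrite ltr0n.
have c3 : (c <= (3 * n) ^ m.+1)%N.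
  rewrite expnS expnMn (@leq_trans (3 * n ^ m))//; first by rewrite /c; lia.
  by rewrite mulnACA leq_mul ?leq_pmulr ?expn_gt0// leq_pmull.
have lnc : ln c%:R <= 3 * m.+1%:R * n%:R :> R.
  rewrite (@le_trans _ _ (ln ((3 * n%:R) ^+ m.+1)))//.
    rewrite ler_ln ?posrE ?exprn_gt0 ?mulr_gt0 ?ltr0n//.
    by rewrite -natrM -natrX ler_nat.
  have n3 : 0 < 3 * n%:R :> R by rewrite mulr_gt0 ?ltr0n.
  rewrite lnXn// -[_ *+ _]mulr_natl -mulrA mulrCA ler_wpM2l//.
  by apply/ltW/ln_sublinear.
have l4 : ln 4 <= 4 :> R by rewrite ltW// ln_sublinear.
have E : ln (2 * (2 * (c ^ (2 * (m * n)))%N%:R)) = ln 4 + 2 * (m%:R * n%:R) * ln c%:R :> R.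
  rewrite mulrA -natrM lnM ?posrE ?ltr0n ?expn_gt0// natrX lnXn// -[ln c%:R *+ _]mulr_natl.
  by rewrite !natrM.
have h1 : 2 * (m%:R * n%:R) * ln c%:R <= 2 * (m%:R * n%:R) * (3 * m.+1%:R * n%:R) :> R.
  by rewrite ler_wpM2l// ?mulr_ge0.
have n2 : 1 <= n%:R ^+ 2 :> R by rewrite exprn_ege1.
have h2 : 2 * m%:R <= 2 * m%:R * n%:R ^+ 2 :> R by rewrite ler_peMr// mulr_ge0.
have h3 : 2 * (m%:R * n%:R) * (3 * m.+1%:R * n%:R) = 6 * m%:R * m.+1%:R * n%:R ^+ 2 :> R by ring.
rewrite E; clear -h1 h2 h3 n2 l4; rewrite !mulrDl; lra.
Qed.

(** * Series of multilinear forms *)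

Lemma differentiable_of_quadratic (K : numFieldType) (V W : normedModType K) (f : V -> W)
    (D : {linear V -> W}) (x : V) (M : K) : 0 < M ->
  (forall h, `|D h| <= M * `|h|) ->
  (forall h, `|h| <= 1 -> `|f (h + x) - f x - D h| <= M * `|h| ^+ 2) ->
  differentiable f x.
Proof.
move=> M0 DM fM; apply/diffP.
(* The differential is a value chosen by [get], so it is enough to exhibit one continuous linear map
   with the required expansion. *)
apply: (@getPex _ (fun (df : {linear V -> W}) => continuous df /\
  forall y, f y = f (lim (nbhs x)) + df (y - lim (nbhs x))
                  +o_(y \near x) (y - lim (nbhs x)))).
exists D; split.
  apply: bounded_linear_continuous; apply/linear_boundedP.
  exists M; split; first by rewrite realE ltW.
  by move=> r Mr y; rewrite (le_trans (DM y))// ler_wpM2r// ltW.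
have : f = (fun y => f x + D (y - x)) +o_ x (center x).
  have near_lt d : 0 < d -> \forall y \near x, `|y - x| < d.
    by move=> d0; apply: cvgr_distC_lt => //; exact: cvg_id.
  apply/eqaddoP => e e0; near=> y => /=.
  have y1 : `|y - x| < 1 by near: y; exact: near_lt.
  have ye : `|y - x| < e / M by near: y; apply: near_lt; rewrite divr_gt0.
  rewrite -[leLHS]/(`|f y - (f x + D (y - x))|) opprD addrA.
  have := fM (y - x) (ltW y1); rewrite subrK => /le_trans; apply.
  by rewrite expr2 mulrA ler_wpM2r// -ler_pdivlMl// mulrC ltW.
by rewrite funeqE => H y; rewrite lim_id//; exact: H.
Unshelve. all: by end_near. Qed.

Section ComplexSeries.
Variable R : realType.
Local Notation C := R[i].
Implicit Types (a b : nat -> C).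

(** Real and imaginary parts are summed separately, so that under [geom_bounded] convergence is that
    of two real series. *)
Definition csum a : C :=
  limn (series (fun i => complex.Re (a i))) +i* limn (series (fun i => complex.Im (a i))).

Definition geom_bounded M a := forall i, normc (a i) <= M * 2^-1 ^+ i.

Lemma Re_le_normc (z : C) : `|complex.Re z| <= normc z.
Proof. by case: z => u v; rewrite /normc/= -sqrtr_sqr ler_wsqrtr// lerDl sqr_ge0. Qed.

Lemma Im_le_normc (z : C) : `|complex.Im z| <= normc z.
Proof. by case: z => u v; rewrite /normc/= -sqrtr_sqr ler_wsqrtr// lerDr sqr_ge0. Qed.

Lemma geom_bounded_ge0 M a : geom_bounded M a -> 0 <= M.
Proof. by move=> /(_ 0); rewrite expr0 mulr1; apply: le_trans; rewrite normc_ge0. Qed.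

Lemma geom_series_le M (u : nat -> R) : 0 <= M -> (forall i, `|u i| <= M * 2^-1 ^+ i) ->
  cvgn (series u) /\ `|limn (series u)| <= 2 * M.
Proof.
move=> M0 uM.
have gc : cvgn (series (geometric M 2^-1)) by apply: is_cvg_geometric_series; rewrite ger0_norm; lra.
have nc : cvgn [normed series u].
  by apply: (series_le_cvg _ _ uM gc) => i; rewrite ?mulr_ge0 ?exprn_ge0// invr_ge0.
split; first exact: normed_cvg.
rewrite (le_trans (lim_series_norm nc))// (le_trans (lim_series_le nc gc uM))//.
have h : `|2^-1| < 1 :> R by rewrite ger0_norm; lra.
have /cvg_lim -> // := @cvg_geometric_series R M 2^-1 h.
by rewrite (_ : 1 - 2^-1 = 2^-1 :> R) ?invrK 1?mulrC; lra.
Qed.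

Lemma geom_bounded_Re M a : geom_bounded M a ->
  cvgn (series (fun i => complex.Re (a i))) /\ `|limn (series (fun i => complex.Re (a i)))| <= 2 * M.
Proof.
move=> aM; apply: (geom_series_le (geom_bounded_ge0 aM)) => i.
exact: le_trans (Re_le_normc _) (aM i).
Qed.

Lemma geom_bounded_Im M a : geom_bounded M a ->
  cvgn (series (fun i => complex.Im (a i))) /\ `|limn (series (fun i => complex.Im (a i)))| <= 2 * M.
Proof.
move=> aM; apply: (geom_series_le (geom_bounded_ge0 aM)) => i.
exact: le_trans (Im_le_normc _) (aM i).
Qed.

Lemma csum_le M a : geom_bounded M a -> normc (csum a) <= 4 * M.
Proof.
move=> aM; rewrite (le_trans (normc_le_ReIm _))//=.
have := (geom_bounded_Re aM).2; have := (geom_bounded_Im aM).2; lra.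
Qed.

Lemma csumD M M' a b : geom_bounded M a -> geom_bounded M' b ->
  csum (fun i => a i + b i) = csum a + csum b.
Proof.
move=> aM bM; have [ar _] := geom_bounded_Re aM; have [ai _] := geom_bounded_Im aM.
have [br _] := geom_bounded_Re bM; have [bi _] := geom_bounded_Im bM.
rewrite /csum; apply/eqP; rewrite eq_complex/= -!lim_seriesD//.
by apply/andP; split; apply/eqP; apply: (congr1 (fun s : nat -> R => limn (series s))); apply/funext => i;
  [rewrite -[RHS]/(complex.Re (a i) + complex.Re (b i))|rewrite -[RHS]/(complex.Im (a i) + complex.Im (b i))];
  case: (a i) (b i) => [? ?] [? ?].
Qed.

Lemma csum_fin a I : (forall i, (I <= i)%N -> a i = 0) -> csum a = \sum_(i < I) a i.
Proof.
move=> a0.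
have fin (u : nat -> R) : (forall i, (I <= i)%N -> u i = 0) -> limn (series u) = \sum_(i < I) u i.
  move=> u0; apply: cvg_lim => //; apply: cvg_near_cst; near=> n.
  have In : (I <= n)%N by near: n; exact: nbhs_infty_ge.
  rewrite /series/= (@big_cat_nat _ _ _ I)//= big_mkord.
  by rewrite [X in _ + X]big1_seq ?addr0// => i; rewrite mem_index_iota => /and3P[_ /u0].
rewrite /csum !fin => [|i /a0 ->//|i /a0 ->//].
by apply/eqP; rewrite eq_complex/= !raddf_sum !eqxx.
Unshelve. all: by end_near. Qed.

Lemma csum_sum (I : Type) (s : seq I) (F : I -> nat -> C) : (forall t, exists M, geom_bounded M (F t)) ->
  csum (fun i => \sum_(t <- s) F t i) = \sum_(t <- s) csum (F t).
Proof.
move=> FM; suff [_ ->] : (exists M', geom_bounded M' (fun i => \sum_(t <- s) F t i)) /\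
    csum (fun i => \sum_(t <- s) F t i) = \sum_(t <- s) csum (F t) by [].
elim: s => [|t s [[M' IM] IH]].
  split; first by exists 0 => i; rewrite big_nil mul0r normc0.
  rewrite big_nil (_ : (fun _ => _) = fun=> 0); last by apply/funext => i; rewrite big_nil.
  by rewrite (@csum_fin _ 0) ?big_ord0.
have E : (fun i => \sum_(t' <- t :: s) F t' i) = (fun i => F t i + \sum_(t' <- s) F t' i).
  by apply/funext => i; rewrite big_cons.
have [M IF] := FM t; rewrite E big_cons -IH (csumD IF IM); split=> //.
by exists (M + M') => i; rewrite (le_trans (le_normcD _ _))// mulrDl; apply: lerD; [exact: IF|exact: IM].
Qed.

Lemma geom_boundedZ M a (k : C) : geom_bounded M a -> geom_bounded (normc k * M) (fun i => k * a i).
Proof. by move=> aM i; rewrite normcM -mulrA ler_wpM2l ?normc_ge0. Qed.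

Lemma csumZ M a (k : C) : geom_bounded M a -> csum (fun i => k * a i) = k * csum a.
Proof.
move=> aM; have [ar _] := geom_bounded_Re aM; have [ai _] := geom_bounded_Im aM.
have Z (t : R) (w : nat -> R) : cvgn (series w) ->
    t * limn (series w) = limn (series (fun i => t * w i)) /\ cvgn (series (fun i => t * w i)).
  by move=> wc; split; [rewrite -[LHS]/(t *: _) -lim_seriesZ|exact: (@is_cvg_seriesZ _ w t wc)].
case: k => u v; rewrite /csum; apply/eqP; rewrite eq_complex/=.
have [-> ur] := Z u _ ar; have [-> vr] := Z v _ ar.
have [-> ui] := Z u _ ai; have [-> vi] := Z v _ ai.
rewrite -lim_seriesB// -lim_seriesD//.
by apply/andP; split; apply/eqP; apply: (congr1 (fun s : nat -> R => limn (series s))); apply/funext => i;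
  [rewrite -[RHS]/(u * complex.Re (a i) - v * complex.Im (a i))
  |rewrite -[RHS]/(u * complex.Im (a i) + v * complex.Re (a i))];
  case: (a i).
Qed.

End ComplexSeries.

Section Multilinear.
Variables (R : realType) (r : R) (r1 : 1 <= r).
Local Notation C := R[i].

Lemma prod_mix_le m (S : {set 'I_m}) (a b A : R) : 0 <= a -> 0 <= b -> b <= A -> 1 <= A ->
  \prod_k (if k \in S then a else b) <= A ^+ m * a ^+ #|S|.
Proof.
move=> a0 b0 bA A1.
apply: (@le_trans _ _ (\prod_k (A * (if k \in S then a else 1)))).
  apply: ler_prod => k _; case: ifP => _; first by rewrite a0 ler_peMl.
  by rewrite b0 mulr1.
by rewrite big_split/= prodr_const card_ord -big_mkcond/= prodr_const.
Qed.

Lemma sum_sets_split m (F : {set 'I_m} -> C) :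
  \sum_S F S = F finset.set0 + \sum_k F [set k]%SET + \sum_(S : {set 'I_m} | (1 < #|S|)%N) F S.
Proof.
rewrite (bigID (fun S : {set 'I_m} => (1 < #|S|)%N))/= addrC; congr (_ + _).
rewrite (bigD1 finset.set0)/= ?cards0//; congr (_ + _).
rewrite -(big_imset F (h := fun k : 'I_m => [set k]%SET)) => [|i j _ _]; last by move/finset.set1_inj.
apply: eq_bigl => S; rewrite -leqNgt -finset.card_gt0.
apply/andP/finset.imsetP => [[S1 S0]|[k _ ->]]; last by rewrite finset.cards1.
have /finset.cards1P[k ->] : #|S| == 1%N by rewrite eqn_leq S1.
by exists k.
Qed.

(** Expand [Phi] at [h + z] over the set [S] of slots that receive [h]. The empty set gives the
    value at [z], the singletons give the derivative, and larger sets contribute terms quadratically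
    small in [h]. *)
Lemma multilinear_Hinfty m (Phi : ('I_m -> ell r1) -> C) (B : R) : 0 <= B ->
  (forall z h, Phi (fun _ => h + z) = \sum_(S : {set 'I_m}) Phi (fun k => if k \in S then h else z)) ->
  (forall z k (a : C) u v, Phi (fun l => if l \in [set k]%SET then a *: u + v else z) =
     a * Phi (fun l => if l \in [set k]%SET then u else z) + Phi (fun l => if l \in [set k]%SET then v else z)) ->
  (forall x, normc (Phi x) <= B * \prod_k nrm (x k)) ->
  Hinfty r1 (fun z => Phi (fun _ => z)).
Proof.
move=> B0 PhiD PhiL PhiB; split=> [z _|]; last first.
  exists B%:C; split; first by rewrite realE lecR B0.
  move=> y By z z1 /=; apply: le_trans (ltW By).
  rewrite -[leLHS]/((normc (Phi (fun _ => z)))%:C) lecR.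
  rewrite (le_trans (PhiB _))// ler_piMr// prodr_ile1// => k _.
  by rewrite nrm_ge0/= ltW// -ltcR.
pose D h := \sum_k Phi (fun l => if l \in [set k]%SET then h else z).
have Dlin : linear D.
  move=> a u v; rewrite /D scaler_sumr -big_split/=; apply: eq_bigr => k _.
  exact: PhiL.
pose DL : {linear ell r1 -> C} := HB.pack D (GRing.isLinear.Build _ _ _ _ D Dlin).
pose A := Num.max 1 (nrm z); have A1 : 1 <= A by rewrite le_max lexx.
have zA : nrm z <= A by rewrite le_max lexx orbT.
have A0 : 0 <= A by rewrite (le_trans ler01).
have mixB (S : {set 'I_m}) h : normc (Phi (fun k => if k \in S then h else z)) <= B * A ^+ m * nrm h ^+ #|S|.
  rewrite (le_trans (PhiB _))// -mulrA ler_wpM2l//.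
  rewrite (eq_bigr (fun k => if k \in S then nrm h else nrm z)) => [|k _]; last by case: ifP.
  by apply: prod_mix_le; rewrite ?nrm_ge0.
pose M := B * A ^+ m * (m%:R + #|{set 'I_m}|%:R) + 1.
have M0 : 0 < M by rewrite ltr_wpDl// !mulr_ge0 ?exprn_ge0// addr_ge0.
have BA0 : 0 <= B * A ^+ m by rewrite mulr_ge0 ?exprn_ge0.
apply: (@differentiable_of_quadratic _ _ _ _ DL z M%:C); first by rewrite ltcR.
- move=> h; rewrite normr_nrm -rmorphM/= -[leLHS]/((normc (D h))%:C) lecR.
  rewrite (le_trans (normc_sum _ _ _))//.
  apply: (@le_trans _ _ (\sum_(k < m) B * A ^+ m * nrm h)).
    by apply: ler_sum => k _; rewrite (le_trans (mixB _ _))// finset.cards1 expr1.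
  rewrite sumr_const card_ord -[leLHS]mulr_natl mulrA ler_wpM2r ?nrm_ge0// /M mulrDr -addrA mulrC lerDl.
  by rewrite addr_ge0// mulr_ge0.
move=> h; rewrite normr_nrm -[1]/(1%:C) lecR => h1.
rewrite -rmorphXn -rmorphM/= -[leLHS]/((normc (Phi (fun _ => h + z) - Phi (fun _ => z) - D h))%:C) lecR.
have -> : Phi (fun _ => h + z) - Phi (fun _ => z) - D h =
    \sum_(S : {set 'I_m} | (1 < #|S|)%N) Phi (fun k => if k \in S then h else z).
  rewrite PhiD sum_sets_split (_ : (fun k => _) = fun _ => z); last by apply/funext => k; rewrite finset.in_set0.
  by rewrite -/(D h); ring.
rewrite (le_trans (normc_sum _ _ _))//.
apply: (@le_trans _ _ (\sum_(S : {set 'I_m} | (1 < #|S|)%N) B * A ^+ m * nrm h ^+ 2)).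
  apply: ler_sum => S S1; rewrite (le_trans (mixB _ _))// ler_wpM2l//.
  by apply: ler_wiXn2l => //; rewrite nrm_ge0.
apply: (@le_trans _ _ (\sum_(S : {set 'I_m}) B * A ^+ m * nrm h ^+ 2)).
  rewrite [leRHS](bigID (fun S : {set 'I_m} => (1 < #|S|)%N))/= lerDl sumr_ge0// => S _.
  by rewrite mulr_ge0// exprn_ge0// nrm_ge0.
rewrite sumr_const -[leLHS]mulr_natl mulrA ler_wpM2r ?exprn_ge0 ?nrm_ge0// /M mulrDr mulrC addrAC lerDr.
by rewrite addr_ge0// mulr_ge0.
Qed.

End Multilinear.

Lemma prod_slot_linear (R : realType) m (k : 'I_m) (a : R[i]) (u v z : 'I_m -> R[i]) :
  \prod_l (if l \in [set k]%SET then a * u l + v l else z l) =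
  a * \prod_l (if l \in [set k]%SET then u l else z l) + \prod_l (if l \in [set k]%SET then v l else z l).
Proof.
rewrite (bigD1 k)//= [X in _ = a * X + _](bigD1 k)//= [X in _ = _ + X](bigD1 k)//= !finset.set11 mulrDl -mulrA.
by congr (_ * (_ * _) + _ * _); apply: eq_bigr => l /negbTE lk; rewrite finset.in_set1 lk.
Qed.

Section BlockSum.
Variables (R : realType) (r : R) (r1 : 1 <= r) (m : nat).
Local Notation C := R[i].
Variables (n : nat -> nat) (eps : forall i, {ffun 'I_m -> 'I_(n i)} -> bool).
Variables (pos : nat -> 'I_m -> nat -> nat) (w : nat -> R).

(** [pos i k j] is the coordinate read by variable [j] of slot [k] in block [i]. Once these are all
    different, every monomial of the total sum is square-free and comes from one place only, with
    coefficient [w i] up to sign. *)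
Definition block_form i (x : 'I_m -> nat -> C) : C :=
  (w i)%:C * sform (@eps i) (fun k j => x k (pos i k j)).

Lemma block_form_add i (h z : nat -> C) :
  block_form i (fun _ k => h k + z k) = \sum_(S : {set 'I_m}) block_form i (fun k => if k \in S then h else z).
Proof.
rewrite /block_form -mulr_sumr; congr (_ * _); rewrite /sform exchange_big/=; apply: eq_bigr => j _.
rewrite -mulr_sumr; congr (_ * _); rewrite bigA_distr; apply: eq_bigr => S _.
by apply: eq_bigr => k _; case: ifP.
Qed.

Lemma block_form_linear i (z : nat -> C) k (a : C) (u v : nat -> C) :
  block_form i (fun l => if l \in [set k]%SET then (fun t => a * u t + v t) else z) =
  a * block_form i (fun l => if l \in [set k]%SET then u else z) +
  block_form i (fun l => if l \in [set k]%SET then v else z).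
Proof.
rewrite /block_form mulrCA -mulrDr; congr (_ * _); rewrite /sform mulr_sumr -big_split/=; apply: eq_bigr => j _.
rewrite mulrCA -mulrDr; congr (_ * _).
rewrite (eq_bigr (fun l => if l \in [set k]%SET then a * u (pos i l (j l)) + v (pos i l (j l))
  else z (pos i l (j l)))) => [|l _]; last by case: ifP.
rewrite prod_slot_linear; congr (_ * _ + _); by apply: eq_bigr => l _; case: ifP.
Qed.

Hypothesis block_le : forall i (x : 'I_m -> ell r1),
  normc (block_form i x) <= 2^-1 ^+ i * \prod_k nrm (x k).

Definition block_sum (z : ell r1) : C := csum (fun i => block_form i (fun _ => z)).

Lemma block_sum_Hinfty : Hinfty r1 block_sum.
Proof.
pose Phi (x : 'I_m -> ell r1) := csum (fun i => block_form i x).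
have bnd (x : 'I_m -> ell r1) : geom_bounded (\prod_k nrm (x k)) (fun i => block_form i x).
  by move=> i; rewrite mulrC.
apply: (@multilinear_Hinfty _ _ _ m Phi 4) => // [z h|z k a u v|x]; last by rewrite csum_le.
  rewrite /Phi -csum_sum => [|S]; last by eexists; exact: bnd.
  congr csum; apply/funext => i; rewrite -[LHS]/(block_form i (fun _ k => h k + z k)) block_form_add.
  by apply: eq_bigr => S _; congr block_form; apply/funext => k; case: ifP.
rewrite /Phi -(csumZ _ (bnd _)) -(csumD (geom_boundedZ a (bnd _)) (bnd _)).
congr csum; apply/funext => i.
have := block_form_linear i z k a u v; congr (block_form i _ = a * block_form i _ + block_form i _);
  by apply/funext => l; case: ifP.
Qed.

Hypothesis m0 : (0 < m)%N.
Hypothesis pos_inj : forall i i' k k' j j', (j < n i)%N -> (j' < n i')%N ->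
  pos i k j = pos i' k' j' -> [/\ i = i', k = k' & j = j'].
Hypothesis pos_ge : forall i k j, (i <= pos i k j)%N.

Local Notation T := {i : nat & {ffun 'I_m -> 'I_(n i)}}.
Local Notation tag_block := (Tagged (fun i => {ffun 'I_m -> 'I_(n i)})).

Definition block_index (t : T) : multi_index :=
  [fsfun p in [fset pos (tag t) k (tagged t k) | k : 'I_m]%fset => 1%N].

Lemma block_pos_inj (t : T) : injective (fun k => pos (tag t) k (tagged t k)).
Proof. by move=> k k' /pos_inj[]. Qed.

Lemma finsupp_block_index t : finsupp (block_index t) = [fset pos (tag t) k (tagged t k) | k : 'I_m]%fset.
Proof. by apply/fsetP => p; rewrite mem_finsupp fsfunE; case: ifP. Qed.

Lemma monomial_block_index (z : nat -> C) t :
  monomial z (block_index t) = \prod_k z (pos (tag t) k (tagged t k)).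
Proof.
rewrite /monomial finsupp_block_index big_imfset => [|k k' _ _ /block_pos_inj//].
rewrite big_enum/=; apply: eq_bigr => k _.
by rewrite fsfunE in_imfset.
Qed.

(** Any coordinate in the support reveals the block, which takes at least one slot, hence [0 < m].
    Then each coordinate reveals its slot and the value of the function there. *)
Lemma block_index_inj : injective block_index.
Proof.
move=> t t' tt'; have h k : exists k', pos (tag t) k (tagged t k) = pos (tag t') k' (tagged t' k').
  have : pos (tag t) k (tagged t k) \in finsupp (block_index t) by rewrite finsupp_block_index in_imfset.
  by rewrite tt' finsupp_block_index => /imfsetP[k' _ ->]; exists k'.
have ii' : tag t = tag t' by have [k' /pos_inj[]] := h (Ordinal m0).
case: t t' ii' h {tt'} => i j [i' j'] /= ii'; move: j'; rewrite -ii' => j' h.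
congr existT; apply/ffunP => k; apply: val_inj; have [k' e] := h k.
have [_ kk jj] := pos_inj (ltn_ord _) (ltn_ord _) e.
by apply: (etrans jj); rewrite kk.
Qed.

Definition block_coef (a : multi_index) : C :=
  if pselect (exists t, block_index t = a) is left ex_t
  then let t := projT1 (cid ex_t) in (w (tag t))%:C * (sgn_of R (eps (tagged t)))%:C else 0.

Lemma block_coef_index t : block_coef (block_index t) = (w (tag t))%:C * (sgn_of R (eps (tagged t)))%:C.
Proof.
rewrite /block_coef; case: pselect => [e|[]]; last by exists t.
by case: (cid e) => t' /= /block_index_inj ->.
Qed.

Lemma sum_block_index (V : nmodType) M (F : multi_index -> V) :
  \sum_(a <- [fset block_index (tag_block (tagged t)) |
              t : {i : 'I_M & {ffun 'I_m -> 'I_(n i)}}]%fset) F a =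
  \sum_(i < M) \sum_(j : {ffun 'I_m -> 'I_(n i)}) F (block_index (tag_block j)).
Proof.
rewrite big_imfset => [|[i j] [i' j'] _ _ /block_index_inj/= e].
  rewrite big_enum/=.
  by rewrite (sig_big_dep xpredT (fun _ => xpredT) (fun (i : 'I_M) j => F (block_index (tag_block j)))).
have ii' : i = i' by apply: val_inj; exact: (congr1 tag e).
move: j' e; rewrite -ii' => j' e; congr existT; exact: (eq_from_Tagged e).
Qed.

Lemma block_form_monomials i (z : nat -> C) : block_form i (fun _ => z) =
  \sum_(j : {ffun 'I_m -> 'I_(n i)}) block_coef (block_index (tag_block j)) *
    monomial z (block_index (tag_block j)).
Proof.
rewrite /block_form /sform mulr_sumr; apply: eq_bigr => j _.
by rewrite block_coef_index monomial_block_index mulrA.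
Qed.

(** By [pos_ge] block [i] reads only coordinates from [i] on, so at a finitely supported point all
    but finitely many blocks vanish and the net of partial sums is eventually constant. *)
Lemma block_sum_expansion : monomial_expansion block_sum block_coef.
Proof.
move=> z z1 zfin.
have [M zM] : exists M, forall k, (M <= k)%N -> z k = 0.
  exists (\max_(k <- fset_set [set k | z k != 0]) k).+1 => k; apply: contraTeq => zk.
  by rewrite -ltnNge ltnS (@leq_bigmax_seq _ _ xpredT id)// in_fset_set// inE.
have z0 i : (M <= i)%N -> forall k j, z (pos i k j) = 0.
  by move=> Mi k j; apply: zM; rewrite (leq_trans Mi).
have -> : block_sum z = \sum_(i < M) block_form i (fun _ => z).
  apply: csum_fin => i Mi; rewrite /block_form /sform big1 ?mulr0// => j _.
  by rewrite (bigD1 (Ordinal m0))//= z0// mul0r mulr0.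
under eq_bigr do rewrite block_form_monomials.
rewrite -(sum_block_index _ (fun a => block_coef a * monomial z a)).
set A0 := [fset _ | _ in _]%fset.
move=> P /nbhs_singleton Pl; exists A0 => // A /= A0A.
suff -> : summability.partial_sum (fun a => block_coef a * monomial z a) A =
  \sum_(a <- A0) block_coef a * monomial z a by [].
transitivity (\sum_(a <- A) block_coef a * monomial z a); first by rewrite big_seq_fsetE.
rewrite -(big_fset_incl _ A0A)// => a _ aA0.
rewrite /block_coef; case: pselect => [e|_]; last by rewrite mul0r.
case: (cid e) => -[i j] /= ea; move: aA0; rewrite -ea monomial_block_index.
have [iM|iM _] := ltnP i M; last by rewrite (bigD1 (Ordinal m0))//= z0// mul0r mulr0.
by case/imfsetP; exists (existT _ (Ordinal iM) j).
Qed.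

End BlockSum.

Lemma monomial_coefE (R : realType) (r : R) (r1 : 1 <= r) (f : ell r1 -> R[i]) c :
  monomial_expansion f c -> monomial_coef f = c.
Proof.
move=> fc; have fc' : monomial_expansion f (monomial_coef f) by apply: getPex; exists c.
apply/funext => a; pose n := (\max_(k <- finsupp a) k).+1.
have an k : (n <= k)%N -> a k = 0%N.
  apply: contraTeq => ak; rewrite -ltnNge ltnS (@leq_bigmax_seq _ _ xpredT id)//.
  by rewrite mem_finsupp.
(* Since [d <= 1], the [n] coordinates equal to [d] contribute at most [n * d <= 1/2] to the sum of
   [r]-th powers. *)
pose d : R := (2 * n.+1%:R)^-1.
have d0 : 0 < d by rewrite invr_gt0 mulr_gt0.
have d1 : d <= 1 by rewrite invf_le1 ?mulr_gt0// -natrM ler1n.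
pose x k : R[i] := if (k < n)%N then d%:C else 0.
have [|k|z zx z1] := @ball_of_sum_le R r r1 x 2^-1; first by lra.
  apply: (@le_trans _ _ (\sum_(0 <= i < k) if (i < n)%N then d else 0)).
    apply: ler_sum => i _; rewrite /x; case: ifP => _.
      by rewrite normc_real gtr0_norm// -[leRHS]powRr1 ?(ltW d0)// ger_powR// d0 d1.
    by rewrite normc0 powR0// gt_eqF// (lt_le_trans ltr01).
  apply: (@le_trans _ _ (\sum_(0 <= i < n) d)).
    apply: (@le_trans _ _ (\sum_(0 <= i < k + n) if (i < n)%N then d else 0)).
      rewrite [leRHS](@big_cat_nat _ _ _ k)//= ?leq_addr// lerDl sumr_ge0// => i _.
      by case: ifP => // _; rewrite ltW.
    rewrite (@big_cat_nat _ _ _ n)//= ?leq_addl// addrC big1_seq => [|i]; last first.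
      by rewrite mem_index_iota => /and3P[_ ni _]; rewrite ltnNge ni.
    rewrite add0r le_eqVlt; apply/orP; left; apply/eqP; apply: eq_big_nat => i /andP[_ ->].
    by [].
  rewrite sumr_const_nat subn0 -[leLHS]mulr_natl /d invfM mulrCA ler_piMr// ler_pdivrMr//.
  by rewrite mul1r ler_nat.
apply: (expansion_unique fc' fc z1 _ an) => k.
rewrite zx /x; case: ifP => _; rewrite ?eqxx//.
by rewrite (_ : 0 = 0%:C)// (inj_eq (@complexI _)) gt_eqF.
Qed.

(** * Optimality *)

Section BlockBound.
Variables (R : realType) (r : R) (r1 : 1 <= r).
Local Notation C := R[i].
Let r0 : 0 < r. Proof. exact: lt_le_trans ltr01 r1. Qed.
Local Notation e := ((Num.min r 2)^-1 - r^-1).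

(** For [r <= 2] the exponent [e] is 0 and all [y j] are at most 1. For [r > 2] entries below the
    threshold [b = n^(-1/r)] contribute at most [n b^2] in total, and the others satisfy
    [y^2 <= b^(2 - r) y^r]. Both bounds equal [n^(2 e)], whence the factor 2. *)
Lemma sum_sq_le1 n (y : 'I_n -> R) : (0 < n)%N -> (forall j, 0 <= y j) -> \sum_j y j `^ r <= 1 ->
  \sum_j y j ^+ 2 <= 2 * n%:R `^ (2 * e).
Proof.
move=> n0 y0 y1; have nR : 0 < (n%:R : R) by rewrite ltr0n.
have yr j : y j `^ r <= 1.
  by rewrite (le_trans _ y1)// (bigD1 j)//= lerDl sumr_ge0// => i _; exact: powR_ge0.
have yle1 j : y j <= 1.
  rewrite leNgt; apply/negP => yj; have := le1r_powR (ltW yj) r1; have := yr j.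
  by move: yj; lra.
have [r2|r2] := leP r 2.
  rewrite subrr mulr0 powRr0 mulr1 (@le_trans _ _ 1)//; last by lra.
  apply: le_trans y1; apply: ler_sum => j _; rewrite -powR_mulrn//.
  have [->|yj] := eqVneq (y j) 0; first by rewrite !powR0// ?gt_eqF.
  by rewrite ger_powR// lt_neqAle eq_sym yj y0 yle1.
pose b := n%:R `^ (- r^-1) : R; have b0 : 0 < b by rewrite powR_gt0.
have claim j : y j ^+ 2 <= b ^+ 2 + b `^ (2 - r) * y j `^ r.
  have [yb|yb] := leP (y j) b.
    by rewrite (@le_trans _ _ (b ^+ 2)) ?lerXn2r ?nnegrE ?(ltW b0)// lerDl mulr_ge0 ?powR_ge0.
  have yj : 0 < y j by exact: lt_trans yb.
  rewrite (@le_trans _ _ (b `^ (2 - r) * y j `^ r)) ?lerDr ?sqr_ge0//.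
  have -> : y j ^+ 2 = y j `^ (2 - r) * y j `^ r.
    by rewrite -powRD ?subrK ?powR_mulrn// gt_eqF ?implybT.
  rewrite ler_wpM2r ?powR_ge0// -[2 - r]opprB !powRN lef_pV2 ?posrE ?powR_gt0//.
  by rewrite ge0_ler_powR ?nnegrE ?subr_ge0 ?(ltW r2) ?(ltW b0) ?(ltW yb).
rewrite (le_trans (ler_sum _ (fun j _ => claim j)))// big_split/= sumr_const card_ord.
have D s t : n%:R `^ (s + t) = n%:R `^ s * n%:R `^ t :> R by rewrite powRD// (gt_eqF nR) implybT.
have E1 : b ^+ 2 *+ n = n%:R `^ (2 * (2^-1 - r^-1)).
  rewrite -[LHS]mulr_natl -(powR_mulrn _ (ltW b0)) /b -powRrM -{1}[n%:R]powRr1 ?ler0n//.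
  by rewrite -D; congr (_ `^ _); field; exact: lt0r_neq0.
have E2 : b `^ (2 - r) = n%:R `^ (2 * (2^-1 - r^-1)).
  by rewrite /b -powRrM; congr (_ `^ _); field; exact: lt0r_neq0.
rewrite E1 E2 -mulr_sumr; have := ler_wpM2l (powR_ge0 n%:R (2 * (2^-1 - r^-1))) y1.
by rewrite mulr1; lra.
Qed.

Lemma sum_sq_le n (y : 'I_n -> R) s : (0 < n)%N -> (forall j, 0 <= y j) -> 0 <= s -> \sum_j y j `^ r <= s `^ r ->
  \sum_j y j ^+ 2 <= (2 * n%:R `^ e * s) ^+ 2.
Proof.
move=> n0 y0; rewrite le_eqVlt => /predU1P[<-|s0] ys.
  rewrite mulr0 expr0n/= big1// => j _; rewrite powR0 ?gt_eqF// in ys.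
  have : y j `^ r == 0.
    rewrite eq_le powR_ge0 andbT (le_trans _ ys)// (bigD1 j)//= lerDl sumr_ge0// => i _; exact: powR_ge0.
  by rewrite powR_eq0 => /andP[/eqP-> _]; rewrite expr0n.
have h : \sum_j (y j / s) `^ r <= 1.
  under eq_bigr do rewrite powRM ?invr_ge0 ?(ltW s0)//.
  have sE : s^-1 `^ r = (s `^ r)^-1 by rewrite -(powR_inv1 (ltW s0)) -powRrM mulN1r powRN.
  by rewrite -mulr_suml sE ler_pdivrMr ?powR_gt0// mul1r.
have := sum_sq_le1 n0 (fun j => divr_ge0 (y0 j) (ltW s0)) h.
under eq_bigr do rewrite expr_div_n.
rewrite -mulr_suml ler_pdivrMr ?exprn_gt0// => /le_trans; apply.
have -> : n%:R `^ (2 * e) = (n%:R `^ e) ^+ 2 by rewrite -powR_mulrn ?powR_ge0// -powRrM mulrC.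
by rewrite !exprMn !ler_wpM2r ?sqr_ge0// expr2; lra.
Qed.

Lemma sform_homog m n (eps : {ffun 'I_m -> 'I_n} -> bool) (B : R) (x : 'I_m -> 'I_n -> C) (a : 'I_m -> R) :
  (forall x : 'I_m -> 'I_n -> C, (forall i, \sum_j normc (x i j) ^+ 2 <= 1) -> normc (sform eps x) <= B) ->
  (forall i, 0 <= a i) -> (forall i, \sum_j normc (x i j) ^+ 2 <= a i ^+ 2) ->
  normc (sform eps x) <= B * \prod_i a i.
Proof.
move=> HB a0 xa.
have [/existsP[i /eqP ai]|] := boolP [exists i, a i == 0].
  have xi j : x i j = 0.
    apply: eq0_normc; apply/eqP; have := xa i; rewrite ai expr0n/= => xi.
    rewrite -sqrf_eq0 eq_le sqr_ge0 andbT (le_trans _ xi)// (bigD1 j)//= lerDl sumr_ge0// => k _.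
    exact: sqr_ge0.
  rewrite (bigD1 i)//= ai mul0r mulr0 /sform big1 ?normc0// => j _.
  by rewrite (bigD1 i)//= xi mul0r mulr0.
rewrite negb_exists => /forallP an.
have ap i : 0 < a i by rewrite lt_neqAle eq_sym an a0.
pose y i j := (a i)^-1%:C * x i j.
have /HB : forall i, \sum_j normc (y i j) ^+ 2 <= 1.
  move=> i; under eq_bigr do rewrite /y normcM exprMn normc_real ger0_norm ?invr_ge0//.
  by rewrite -mulr_sumr exprVn ler_pdivrMl ?exprn_gt0// mulr1.
have -> : sform eps y = (\prod_i (a i)^-1%:C) * sform eps x.
  rewrite /sform mulr_sumr; apply: eq_bigr => j _.
  by rewrite mulrCA; congr (_ * _); rewrite /y big_split.
rewrite normcM normc_prod; under eq_bigr do rewrite normc_real ger0_norm ?invr_ge0//.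
by rewrite prodfV ler_pdivrMl ?prodr_gt0// mulrC.
Qed.

Lemma scaled_sform_le m n (eps : {ffun 'I_m -> 'I_n} -> bool) (B : R) (x : 'I_m -> ell r1) (pos : 'I_m -> nat) :
  (0 < n)%N ->
  (forall x : 'I_m -> 'I_n -> C, (forall i, \sum_j normc (x i j) ^+ 2 <= 1) -> normc (sform eps x) <= B) ->
  normc (sform eps (fun k (j : 'I_n) => x k (pos k + j)%N)) <= B * (2 * n%:R `^ e) ^+ m * \prod_k nrm (x k).
Proof.
move=> n0 HB; have -> : (2 * n%:R `^ e) ^+ m = \prod_(k < m) (2 * n%:R `^ e) by rewrite prodr_const card_ord.
rewrite -mulrA -big_split/=.
apply: sform_homog => // k; first by rewrite !mulr_ge0 ?powR_ge0 ?nrm_ge0.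
apply: sum_sq_le => // [j||]; [exact: normc_ge0|exact: nrm_ge0|].
apply: le_trans (nrm_sum_le (x k) (pos k + n)).
rewrite (@big_cat_nat _ _ _ (pos k))//= ?leq_addr//.
have -> : \sum_(pos k <= i < pos k + n) normc (x k i) `^ r = \sum_(j < n) normc (x k (pos k + j)%N) `^ r.
  by rewrite -{1}[pos k]add0n big_addn addKn big_mkord; apply: eq_bigr => j _; rewrite addnC.
by rewrite lerDr sumr_ge0// => i _; exact: powR_ge0.
Qed.

End BlockBound.

Section PositionsAndSeries.
Variable R : realType.

(** A telescoping substitute for the integral test: [(1 - 1/y)^(-s) >= 1 + s/y] compares each term
    with a difference of consecutive powers of exponent [-s]. *)
Lemma sum_powR_le (s : R) n : 0 < s -> \sum_(0 <= k < n) k.+1%:R `^ (- (1 + s)) <= 1 + s^-1.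
Proof.
move=> s0.
have step k : k.+2%:R `^ (- (1 + s)) <= s^-1 * (k.+1%:R `^ (- s) - k.+2%:R `^ (- s)) :> R.
  have y0 : 0 < (k.+2%:R : R) by rewrite ltr0n.
  have y1 : 0 < (k.+1%:R : R) by rewrite ltr0n.
  pose d : R := k.+1%:R / k.+2%:R; have d0 : 0 < d by rewrite divr_gt0.
  have dE : d = 1 - k.+2%:R^-1.
    rewrite /d (_ : k.+1%:R = k.+2%:R - 1 :> R); last by rewrite -[k.+2%:R]natr1 addrK.
    by rewrite mulrBl divff ?mul1r// gt_eqF.
  have lnd : ln d <= - k.+2%:R^-1 by rewrite dE le_ln1Dx// ltrN2 invf_lt1// ltr1n.
  have h : 1 + s / k.+2%:R <= d `^ (- s).
    rewrite /powR gt_eqF// (le_trans _ (expR_ge1Dx _))// lerD2l mulNr -mulrN ler_wpM2l ?(ltW s0)//.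
    by rewrite lerNr.
  have E : k.+1%:R `^ (- s) = k.+2%:R `^ (- s) * d `^ (- s) :> R.
    by rewrite -powRM ?(ltW y0) ?(ltW d0)// /d mulrC divfK// gt_eqF.
  have -> : k.+2%:R `^ (- (1 + s)) = k.+2%:R^-1 * k.+2%:R `^ (- s) :> R.
    by rewrite opprD powRD ?powR_inv1 ?ler0n// (gt_eqF y0) implybT.
  rewrite ler_pdivlMl// E; have := ler_wpM2l (powR_ge0 k.+2%:R (- s)) h.
  have -> : s * (k.+2%:R^-1 * k.+2%:R `^ (- s)) = k.+2%:R `^ (- s) * (s / k.+2%:R) by ring.
  by rewrite mulrDr mulr1 lerBrDl.
suff h k : \sum_(0 <= i < k.+1) i.+1%:R `^ (- (1 + s)) <= 1 + s^-1 * (1 - k.+1%:R `^ (- s)) :> R.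
  case: n => [|n]; first by rewrite big_nil addr_ge0// invr_ge0 ltW.
  rewrite (le_trans (h n))// lerD2l ler_piMr ?invr_ge0 ?(ltW s0)// gerBl powR_ge0//.
elim: k => [|k IH]; first by rewrite big_nat1 !powR1 subrr mulr0 addr0.
rewrite big_nat_recr//=; have := step k; move: IH; rewrite !mulrBr; lra.
Qed.

(** Block [i] lies in the interval from [m N^(i+1)] to [2 m N^(i+1)], and these intervals are
    disjoint as [N >= 2]. Within a block, [m + k] and [j] are quotient and remainder modulo
    [N^(i+1)]. *)
Lemma block_pos_eq m N i i' (k k' : 'I_m) j j' : (1 < N)%N -> (j < N ^ i.+1)%N -> (j' < N ^ i'.+1)%N ->
  ((m + k) * N ^ i.+1 + j = (m + k') * N ^ i'.+1 + j')%N -> [/\ i = i', k = k' & j = j'].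
Proof.
move=> N1; have N0 : (0 < N)%N by exact: ltnW.
have lt a b (l l' : 'I_m) c c' : (c < N ^ a.+1)%N -> (a < b)%N ->
    ((m + l) * N ^ a.+1 + c < (m + l') * N ^ b.+1 + c')%N.
  move=> ca ab; apply: (@leq_trans ((m + l).+1 * N ^ a.+1)%N).
    by rewrite mulSn addnC ltn_add2r.
  apply: (@leq_trans (m * N ^ b.+1)%N); last by rewrite mulnDl -addnA leq_addr.
  apply: (@leq_trans (m * (N * N ^ a.+1))%N); last by rewrite leq_mul2l -expnS leq_pexp2l// orbT.
  rewrite mulnA leq_mul2r; apply/orP; right.
  by rewrite (@leq_trans (m * 2))// ?leq_mul2l ?N1 ?orbT// muln2 -addnn -addnS leq_add2l.
move=> ji ji' e; have [ii'|ii'|ii'] := ltngtP i i'.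
- by have := lt i i' k k' j j' ji ii'; rewrite e ltnn.
- by have := lt i' i k' k j' j ji' ii'; rewrite e ltnn.
subst i'; have n0 : (0 < N ^ i.+1)%N by rewrite expn_gt0 N0.
have := congr1 (fun x => x %/ N ^ i.+1)%N e; rewrite !divnMDl// !divn_small// !addn0 => /addnI/val_inj kk.
by have := congr1 (fun x => x %% N ^ i.+1)%N e; rewrite !modnMDl !modn_small.
Qed.

End PositionsAndSeries.

Section NonInclusion.
Variables (R : realType) (r : R) (r1 : 1 < r) (p : nat -> nat).
Local Notation C := R[i].
Local Notation sg := (1 - (Num.min r 2)^-1).
Hypothesis p_gt0 : forall k, (0 < p k)%N.
Hypothesis p_growth : forall del : R, 0 < del -> exists2 K, 0 < K & forall k, (p k)%:R <= K * k.+1%:R `^ (1 + del).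

Lemma ball_point s : 0 < s -> exists2 c, 0 < c & exists2 u : ell (ltW r1), unit_ball (ltW r1) u &
  forall k, u k = (c * k.+1%:R `^ (- ((1 + s) / r)))%:C.
Proof.
move=> s0; have r0 : 0 < r by exact: lt_trans r1.
have A0 : 0 < 2 * (1 + s^-1) :> R by rewrite mulr_gt0// addr_gt0 ?invr_gt0.
pose c : R := (2 * (1 + s^-1)) `^ (- r^-1); have c0 : 0 < c by rewrite powR_gt0.
have cr : c `^ r = (2 * (1 + s^-1))^-1.
  by rewrite -powRrM mulNr mulVf ?gt_eqF// powR_inv1// ltW.
exists c => //.
have [|n|u uE u1] := @ball_of_sum_le R r (ltW r1) (fun k => (c * k.+1%:R `^ (- ((1 + s) / r)))%:C) 2^-1; first by lra.
  rewrite (eq_bigr (fun k => c `^ r * k.+1%:R `^ (- (1 + s)))) => [|k _].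
    rewrite -mulr_sumr cr ler_pdivrMl// (le_trans (sum_powR_le n s0))//; lra.
  rewrite normc_real ger0_norm ?mulr_ge0 ?powR_ge0 ?(ltW c0)// powRM ?powR_ge0 ?(ltW c0)//.
  by rewrite -powRrM mulNr divfK ?gt_eqF.
by exists u => // k; rewrite uE.
Qed.

Local Notation e := ((Num.min r 2)^-1 - r^-1).

(** The gap [sg - t = 4 th] is spent as follows: [2 th] on the growth of the primes beyond linear,
    [th] on the summability of [u], and [th] remains as the gain, since
    [-(t + 2 th) - (1/r + th) = th + e - 1]. The range [k < 2 * m * n] contains the positions of a
    block of size [n]. *)
Lemma weighted_point_ge tau : tau < sg -> exists2 th, 0 < th &
  exists2 z, weighted_ball (ltW r1) p tau z & forall m, (0 < m)%N -> exists2 c : R, 0 < c &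
    forall n k, (0 < n)%N -> (k < 2 * m * n)%N -> c * n%:R `^ (th + e - 1) <= normc (z k).
Proof.
move=> tausg; have r0 : 0 < r by exact: lt_trans r1.
have sg0 := sigma_gt0 r1.
(* A larger exponent only makes the weights smaller, and a positive one is required for the choice
   [del = 2 th / t] in the growth of the primes. *)
pose t := Num.max tau (sg / 2).
have taut : tau <= t by rewrite le_max lexx.
have t0 : 0 < t by rewrite lt_max [X in _ || X]divr_gt0 ?orbT.
have tsg : t < sg by rewrite gt_max tausg ltr_pdivrMr// ltr_pMr// ltr1n.
have [th th0 thE] : exists2 th, 0 < th & 4 * th = sg - t.
  by exists ((sg - t) / 4); [rewrite divr_gt0 ?subr_gt0|rewrite mulrC divfK].
exists th => //.
have [K K0 pK] := p_growth (divr_gt0 (mulr_gt0 (ltr0n R 2) th0) t0).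
have [c c0 [u u1 uE]] := ball_point (mulr_gt0 r0 th0).
exists (fun k => ((p k)%:R `^ (- tau))%:C * u k); first by exists u.
move=> m m0; exists (c * K `^ (- t) * (2 * m)%:R `^ (th + e - 1)) => [|n k n0 kmn].
  by rewrite !mulr_gt0 ?powR_gt0// ltr0n muln_gt0.
have mn0 : 0 < ((2 * m * n)%:R : R) by rewrite ltr0n !muln_gt0 m0.
have k0 : 0 < (k.+1%:R : R) by rewrite ltr0n.
have kmn' : k.+1%:R <= (2 * m * n)%:R :> R by rewrite ler_nat.
have pk0 : 0 < ((p k)%:R : R) by rewrite ltr0n.
have anti (a b x : R) : 0 < a -> a <= b -> 0 <= x -> b `^ (- x) <= a `^ (- x).
  move=> a0 ab x0; have b0 := lt_le_trans a0 ab.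
  by rewrite !powRN lef_pV2 ?posrE ?powR_gt0// ge0_ler_powR ?nnegrE ?(ltW a0) ?(ltW b0).
have h1 : K `^ (- t) * (2 * m * n)%:R `^ (- (t + 2 * th)) <= (p k)%:R `^ (- tau).
  apply: (@le_trans _ _ ((p k)%:R `^ (- t))); last by rewrite ler_powR ?lerN2// ler1n.
  apply: le_trans (anti _ _ _ pk0 (pK k) (ltW t0)).
  rewrite powRM ?powR_ge0 ?(ltW K0)// ler_wpM2l ?powR_ge0// -powRrM.
  rewrite (_ : (1 + 2 * th / t) * - t = - (t + 2 * th)); last by field; rewrite gt_eqF.
  by apply: anti => //; rewrite addr_ge0 ?(ltW t0)// mulr_ge0// ltW.
have h2 : (2 * m * n)%:R `^ (- (r^-1 + th)) <= k.+1%:R `^ (- ((1 + r * th) / r)) :> R.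
  rewrite (_ : (1 + r * th) / r = r^-1 + th); last by field; rewrite gt_eqF.
  by apply: anti => //; rewrite addr_ge0 ?invr_ge0 ?(ltW r0) ?(ltW th0).
rewrite normcM uE !normc_real !ger0_norm ?mulr_ge0 ?powR_ge0 ?(ltW c0)//.
have -> : c * K `^ (- t) * (2 * m)%:R `^ (th + e - 1) * n%:R `^ (th + e - 1) =
    c * (K `^ (- t) * (2 * m * n)%:R `^ (th + e - 1)) by rewrite [(2 * m * n)%:R]natrM powRM ?ler0n// !mulrA.
rewrite [leRHS]mulrCA ler_wpM2l ?(ltW c0)//.
have E : (2 * m * n)%:R `^ (th + e - 1) = (2 * m * n)%:R `^ (- (t + 2 * th)) * (2 * m * n)%:R `^ (- (r^-1 + th)) :> R.
  rewrite -powRD ?(gt_eqF mn0) ?implybT//; congr (_ `^ _); move: thE; clear; lra.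
by rewrite E mulrA ler_pM ?mulr_ge0 ?powR_ge0.
Qed.

Lemma not_weighted_ball_sub tau : tau < sg ->
  ~ (weighted_ball (ltW r1) p tau `<=` [set (z : nat -> C) | z in mon_Hinfty (ltW r1)]).
Proof.
move=> /weighted_point_ge [th th0 [z zw zge]] sub.
have [z' [z'1 z'mon] z'E] := sub z zw.
(* In this degree the gain [n^(m th)] exceeds the loss [n^2] by at least a full factor [n]. *)
pose m := (Num.truncn (3 / th)).+1.
have m0 : (0 < m)%N by [].
have mth : 3 <= m%:R * th by rewrite -ler_pdivrMr// ltW// truncnS_gt.
have [c c0 zc] := zge m m0.
have [K K0 HK] := small_forms_ex R m.
(* The constant that remains when [(c n^(th + e))^m] is divided by the norm bound
   [K n^2 (2 n^e)^m]. *)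
pose c3 := K^-1 * (c / 2) ^+ m; have c30 : 0 < c3 by rewrite mulr_gt0 ?exprn_gt0 ?invr_gt0 ?divr_gt0.
(* [N >= 2] keeps the blocks disjoint and gives [n i >= 2 ^ i * N], which beats the factor
   [2^-1 ^+ i]; with [c3 * N >= 1] every block then contributes at least 1. *)
pose N := maxn 2 (Num.truncn c3^-1).+1.
have N1 : (1 < N)%N by rewrite leq_maxl.
have N0 : (0 < N)%N by exact: ltnW.
have cN : 1 <= c3 * N%:R.
  rewrite -ler_pdivrMl// mulr1 (@le_trans _ _ (Num.truncn c3^-1).+1%:R) ?ler_nat ?leq_maxr//.
  by rewrite ltW// truncnS_gt.
pose n i := (N ^ i.+1)%N; have n0 i : (0 < n i)%N by rewrite expn_gt0 N0.
have nR i : 0 < ((n i)%:R : R) by rewrite ltr0n.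
pose eps i := sval (cid (HK (n i) (n0 i))); have Heps i := svalP (cid (HK (n i) (n0 i))).
pose pos i (k : 'I_m) j := ((m + k) * n i + j)%N.
pose Ci i := K * (n i)%:R ^+ 2 * (2 * (n i)%:R `^ e) ^+ m.
have Ci0 i : 0 < Ci i by rewrite !mulr_gt0 ?exprn_gt0 ?mulr_gt0 ?powR_gt0.
pose w i := 2^-1 ^+ i / Ci i.
have w0 i : 0 <= w i by rewrite divr_ge0 ?exprn_ge0 ?invr_ge0 ?(ltW (Ci0 i)).
have ble i (x : 'I_m -> ell (ltW r1)) : normc (block_form eps pos w i x) <= 2^-1 ^+ i * \prod_k nrm (x k).
  rewrite normcM normc_real ger0_norm// /w -mulrA ler_wpM2l ?exprn_ge0 ?invr_ge0//.
  by rewrite ler_pdivrMl//; exact: (scaled_sform_le x (fun k : 'I_m => ((m + k) * n i)%N) (n0 i) (Heps i)).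
have pinj i i' k k' j j' : (j < n i)%N -> (j' < n i')%N ->
  pos i k j = pos i' k' j' -> [/\ i = i', k = k' & j = j'] by exact: block_pos_eq.
have pge i k j : (i <= pos i k j)%N.
  rewrite /pos (@leq_trans (n i))//; last by rewrite (@leq_trans ((m + k) * n i)) ?leq_addr// leq_pmull.
  by rewrite (@leq_trans (2 ^ i.+1)) ?leq_exp2r// ltnW// (ltn_trans (ltnSn i))// ltn_expl.
have fH := block_sum_Hinfty ble.
have fE := monomial_coefE (block_sum_expansion (r1 := ltW r1) (eps := eps) (w := w) m0 pinj pge).
have := z'mon _ fH; rewrite fE ltNge => /negP; apply.
pose tag_block (i : nat) (j : {ffun 'I_m -> 'I_(n i)}) := Tagged (fun i => {ffun 'I_m -> 'I_(n i)}) j.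
pose F (a : multi_index) := normc (block_coef eps pos w a * monomial z' a).
have block_ge i : 1 <= \sum_(j : {ffun 'I_m -> 'I_(n i)}) F (block_index pos (tag_block i j)).
  (* As the slots have separate variables, the sum of the moduli of all monomials factors over the
     slots. *)
  have -> : \sum_(j : {ffun 'I_m -> 'I_(n i)}) F (block_index pos (tag_block i j)) =
      w i * \prod_(k < m) \sum_(j < n i) normc (z (pos i k j)).
    rewrite bigA_distr_bigA mulr_sumr; apply: eq_bigr => j _.
    rewrite /F (block_coef_index eps w m0 pinj) (monomial_block_index pinj) !normcM normc_sgn mulr1.
    by rewrite normc_real ger0_norm// normc_prod z'E.
  apply: (@le_trans _ _ (w i * (c * (n i)%:R `^ (th + e)) ^+ m)); last first.
    have -> : (c * (n i)%:R `^ (th + e)) ^+ m = \prod_(k < m) \sum_(j < n i) c * (n i)%:R `^ (th + e - 1).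
      have sumE : \sum_(j < n i) c * (n i)%:R `^ (th + e - 1) = c * (n i)%:R `^ (th + e).
        rewrite sumr_const card_ord -[LHS]mulr_natl mulrCA; congr (c * _).
        rewrite [in RHS](_ : th + e = 1 + (th + e - 1)); last by rewrite [1 + _]addrC subrK.
        by rewrite [in RHS]powRD ?(gt_eqF (nR i)) ?implybT// powRr1// ltW.
      by under [RHS]eq_bigr do rewrite sumE; rewrite prodr_const card_ord.
    rewrite ler_wpM2l//; apply: ler_prod => k _.
    rewrite sumr_ge0 => [|j _]; last by rewrite mulr_ge0 ?powR_ge0 ?(ltW c0).
    apply: ler_sum => j _; apply: zc => //.
    rewrite /pos (@leq_trans ((m + k).+1 * n i))//; first by rewrite mulSn addnC ltn_add2r.
    by rewrite leq_mul2r mul2n -addnn -addnS leq_add2l ltn_ord orbT.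
  have Xm : (n i)%:R ^+ 3 <= ((n i)%:R `^ th) ^+ m :> R.
    rewrite -powR_mulrn ?(ltW (nR i))// -[leRHS]powR_mulrn ?powR_ge0// -powRrM ler_powR ?ler1n//.
    by rewrite mulrC.
  have -> : w i * (c * (n i)%:R `^ (th + e)) ^+ m = c3 * (2^-1 ^+ i * (((n i)%:R `^ th) ^+ m / (n i)%:R ^+ 2)).
    rewrite powRD ?(gt_eqF (nR i)) ?implybT// /w /Ci /c3 !exprMn !exprVn.
    have := exprn_gt0 m (powR_gt0 e (nR i)); have := exprn_gt0 m (ltr0n R 2).
    move: (((n i)%:R `^ e) ^+ m) (((n i)%:R `^ th) ^+ m) (2 ^+ m : R) (c ^+ m) ((2 ^+ i)^-1 : R)
      => x1 x2 x3 x4 x5 x30 x10.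
    by field; rewrite !gt_eqF.
  apply: (le_trans cN); rewrite ler_wpM2l ?(ltW c30)//.
  apply: (@le_trans _ _ (2^-1 ^+ i * (n i)%:R)); last first.
    by rewrite ler_wpM2l ?exprn_ge0 ?invr_ge0// ler_pdivlMr ?exprn_gt0// -exprS.
  rewrite exprVn ler_pdivlMl ?exprn_gt0// -natrX -natrM ler_nat /n expnSr leq_mul2r.
  by case: (i) => [|l]; rewrite ?expn0 ?orbT// leq_exp2r// N1 orbT.
rewrite leye_eq; apply/eqP/eqyP => A _.
apply: esum_ge.
pose M := (Num.truncn A).+1.
pose A0 := [fset block_index pos (tag_block _ (tagged t)) |
              t : {i : 'I_M & {ffun 'I_m -> 'I_(n i)}}]%fset.
exists [set` A0]; first by split.
rewrite fsbig_finite//= set_fsetK sumEFin lee_fin (sum_block_index m0 pinj M F).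
apply: (@le_trans _ _ (\sum_(i < M) 1)); last by apply: ler_sum => i _; exact: block_ge.
by rewrite sumr_const card_ord ltW// truncnS_gt.
Qed.

End NonInclusion.

Theorem corollary5p7 (R : realType) (r : R) (r1 : 1 < r)
    (p : nat -> nat) (p_incr : forall i j, (i < j)%N -> (p i < p j)%N)
    (p_primes : forall q, prime q <-> exists k, p k = q) :
  let sigma : R := 1 - (Num.min r 2)^-1 in
  let mon : set (nat -> R[i]) := [set (z : nat -> R[i]) | z in mon_Hinfty (ltW r1)] in
  weighted_ball (ltW r1) p sigma `<=` mon /\
  forall tau : R, tau < sigma -> ~ (weighted_ball (ltW r1) p tau `<=` mon).
Proof.
move=> sigma mon; have pk := prime_enum_gt p_incr p_primes; split.
  exact: weighted_ball_sub_mon.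
move=> tau; apply: not_weighted_ball_sub => [k|del d0].
  exact: leq_ltn_trans (pk k).
exact: prime_growth p_incr p_primes _ d0.
Qed.
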